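(* Let $X_1,\ldots,X_n$ be i.i.d. real random variables with absolutely continuous distribution function $F$, and $Y_1,\ldots,Y_m$ i.i.d. real random variables with absolutely continuous distribution function $G$, the two samples being independent, where $c_0 n\le m\le n$ for a fixed constant $0<c_0\le 1$. Let $\{\psi_k\}_{k\ge1}$ be either the trigonometric series $\psi_k(z)=\sqrt2\cos(\pi k z)$, or the normalized Legendre polynomials $\psi_k(z)=\frac{\sqrt{2k+1}}{k!}\frac{d^k}{dz^k}(z^2-z)^k$, $z\in[0,1]$, and let $d=d_{n,m}$ satisfy $d=o(n^{1/4})$ in the trigonometric case and $d=o(n^{1/9})$ in the Legendre case. Let $F_n(x)=n^{-1}\sum_{i=1}^n I(X_i\le x)$, $\hat\psi_k=m^{-1}\sum_{j=1}^m\psi_k(F_n(Y_j))$, $\hat\Psi(d)=\sqrt{nm/(n+m)}\max_{1\le k\le d}|\hat\psi_k|$, and for fixed $\alpha\in(0,1)$ let $c_\alpha(d)=\Phi^{-1}(1/2+(1-\alpha)^{1/d}/2)$ and $\Phi^{\rm S}_\alpha(d)=I\{\hat\Psi(d)\ge c_\alpha(d)\}$. Let $\bar n=2(n^{-1}+m^{-1})^{-1}$. Consider the alternative $H^d_1$: the random variable $V=F(Y_1)$ has density on $(0,1)$ $$\rho_\theta(z)=C_d(\theta)\exp\Big\{\sum_{k=1}^d\theta_k\psi_k(z)\Big\},\qquad \{C_d(\theta)\}^{-1}=\int_0^1\exp\Big\{\sum_{k=1}^d\theta_k\psi_k(z)\Big\}dz,$$ for some $\theta=(\theta_1,\ldots,\theta_d)^\intercal$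 with $\max_{1\le k\le d}|\theta_k|=\lambda\sqrt{\log d/\bar n}$, where $\lambda\ge2+\varepsilon$ for some fixed $\varepsilon>0$. Then $$\lim_{n,d\to\infty}P_{H^d_1}\{\Phi^{\rm S}_\alpha(d)=1\}=1.$$
   Context: $\Phi$ denotes the standard normal distribution function. *)

(* Defs.v *)
From HB Require Import structures.
From mathcomp Require Import all_boot all_order all_algebra.
From mathcomp Require Import all_classical all_reals all_analysis.
Set Implicit Arguments. Unset Strict Implicit. Unset Printing Implicit Defensive.
Import Order.TTheory GRing.Theory Num.Theory.
Import numFieldNormedType.Exports.
Local Open Scope classical_set_scope.
Local Open Scope ring_scope.

Section defs.
Context {R : realType}.

Definition Phi (x : R) : R := fine (normal_prob 0 1 `]-oo, x]).
Definition Phi_inv (p : R) : R := xget 0 [set x | Phi x = p].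

Definition c_alpha (alpha : R) (d : nat) : R :=
  Phi_inv (2^-1 + (1 - alpha) `^ ((d%:R)^-1) / 2).

Inductive obasis := Trig | Legendre.

Definition psi (b : obasis) (k : nat) (z : R) : R :=
  match b with
  | Trig => Num.sqrt 2 * cos (pi * k%:R * z)
  | Legendre => Num.sqrt (2 * k%:R + 1) / (k`!)%:R *
                (((('X^2 - 'X : {poly R}) ^+ k)^`(k)).[z])
  end.

(* d = o(n^{1/4}) (trigonometric), d = o(n^{1/9}) (Legendre) *)
Definition rate_exp (b : obasis) : R :=
  match b with Trig => 4%:R | Legendre => 9%:R end.

Definition Fn (n : nat) (X : 'I_n -> R) (x : R) : R :=
  (n%:R)^-1 * \sum_(i < n) (((X i <= x)%R : bool)%:R).

Definition psihat (b : obasis) (n m : nat) (X : 'I_n -> R) (Y : 'I_m -> R)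
  (k : nat) : R :=
  (m%:R)^-1 * \sum_(j < m) psi b k (Fn X (Y j)).

Definition Psihat (b : obasis) (n m : nat) (X : 'I_n -> R) (Y : 'I_m -> R)
  (d : nat) : R :=
  Num.sqrt (n%:R * m%:R / (n%:R + m%:R)) *
  \big[Num.max/0]_(i < d) `|psihat b X Y i.+1|.

Definition nbar (n m : nat) : R := 2 * ((n%:R)^-1 + (m%:R)^-1)^-1.

(* exponential family density rho_theta on (0,1); theta i = theta_{i+1} *)
Definition expo_sum (b : obasis) (d : nat) (theta : 'I_d -> R) (z : R) : R :=
  \sum_(i < d) theta i * psi b i.+1 z.

Definition Cd (b : obasis) (d : nat) (theta : 'I_d -> R) : R :=
  (fine (\int[lebesgue_measure]_(z in `[0, 1]) (expR (expo_sum b theta z))%:E))^-1.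

Definition rho (b : obasis) (d : nat) (theta : 'I_d -> R) (z : R) : R :=
  Cd b theta * expR (expo_sum b theta z).

Definition abs_cont_cdf (F : R -> R) : Prop :=
  exists f : R -> R, measurable_fun setT f /\ (forall t, 0 <= f t) /\
    forall x, (F x)%:E = (\int[lebesgue_measure]_(t in `]-oo, x]) (f t)%:E)%E.

Section prob.
Context {dT : measure_display} {T : measurableType dT}.

Definition has_cdf (P : probability T R) (Z : T -> R) (F : R -> R) : Prop :=
  forall x, P [set w | Z w <= x] = (F x)%:E.

Definition mutual_indep (I : finType) (P : probability T R) (Z : I -> T -> R) : Prop :=
  forall B : I -> set R, (forall i, measurable (B i)) ->
    fine (P [set w | forall i, B i (Z i w)]) =
    \prod_(i : I) fine (P [set w | B i (Z i w)]).

Definition join2 (n m : nat) (X : 'I_n -> T -> R) (Y : 'I_m -> T -> R)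
  (s : ('I_n + 'I_m)%type) : T -> R :=
  match s with inl i => X i | inr j => Y j end.
End prob.

End defs.

(* Main.v *)
(* Let rho be the density of V = F(Y_1), mu_k the mean of psi_k(V), and
   M = max_{k <= d} |mu_k|.  Only the frequency k that attains M is used: the
   test rejects as soon as |psihat_k - mu_k| <= delta M, because nm/(n+m) M^2 exceeds
   2 (1 + eps/4)^2 ln d while c_alpha(d)^2 is at most 2 ln(2 d / alpha).

   Signal.  Write rho = e^s.  The integral J of s (rho - 1) is the sum of the
   theta_k mu_k, hence J <= M |theta|_1.  From below, the pointwise inequality
   s (e^s - 1) >= s^2 / (1 + |s|) bounds J by |theta|_2^2 / (1 + sup |s|), so M stays
   large however large theta is, while for small sup |s| a direct expansion
   gives mu_k ~ theta_k.  Chebyshev's association inequality bounds J from below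
   by a multiple of |theta|_oo |rho - 1|_1, whence
   |rho - 1|_1 <= 4 d sup |psi| M.

   Noise.  Expanding psi_k(F_n(Y_j)) at F(Y_j), psihat_k - mu_k is a second-order
   remainder plus three averages of pairwise orthogonal variables, so that second
   moments suffice.  The average over the X-sample is that of -psi_k(F(X_i)), up to
   sup |psi'| |rho - 1|_1, which is controlled by M.  There F(X_i) is uniform: as
   rho > 0, the range of F is dense in [0,1].

   For the Legendre polynomials the sup norms of psi_k, psi_k', psi_k'' come from a
   monotone energy of their differential equation. *)
From HB Require Import structures.
From mathcomp Require Import all_boot all_order all_algebra.
From mathcomp Require Import all_classical all_reals all_analysis.
From mathcomp Require Import measurable_realfun.
From mathcomp Require Import ring lra.
Require Import Defs.
Set Implicit Arguments. Unset Strict Implicit. Unset Printing Implicit Defensive.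
Import Order.TTheory GRing.Theory Num.Theory.
Import numFieldNormedType.Exports.
Local Open Scope classical_set_scope.
Local Open Scope ring_scope.

(** * Bounded measurable functions *)

(** The size of [theta] is bounded from below only, so neither a linearization of [rho] nor a fixed
    noise level is available. Two regimes meet where [d sup|psi| |theta|_oo] equals [eta]. Below,
    the expansion keeps the sharp constant. Above, a crude lower bound on [M] is enough, because the
    rate of [d] then lifts [nm/(n+m) M^2] above a multiple of [d] itself, and [d] exceeds [ln d].
    The noise may grow with [|rho - 1|_1], but only in proportion to [M], so after division by [M^2]
    it costs powers of [d] over [n]. Budget of constants: [nbar] is twice [nm/(n+m)], so that
    [|theta|_oo^2 nm/(n+m)] is [lambda^2/2] times [ln d]. With [eta = eps/(6(2+eps))] the factor
    [1 - 3 eta] turns [2 + eps] into [2 + eps/2]; then [delta] turns [1 + eps/4] into [1 + eps/8],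
    and the [eps/4] contained in the square of the latter absorbs [ln(2/alpha)]. *)

Section bounded_measurable.
Context {d : measure_display} {T : measurableType d} {R : realType}.
Variable D : set T.

(** Every integrand below is bounded on a set of finite measure, and this class is closed under the
    operations used, so integrability follows by closure. The bound is required on [D] only, because
    the basis functions and densities are controlled on [0,1]. *)
Definition bmfun (f : T -> R) :=
  measurable_fun D f /\ exists M, forall x, D x -> `|f x| <= M.

Lemma bmfun_cst c : bmfun (fun=> c).
Proof. by split; [exact: measurable_cst|exists `|c|]. Qed.

Lemma bmfunD f g : bmfun f -> bmfun g -> bmfun (fun x => f x + g x).
Proof.
move=> [mf [M fM]] [mg [N gN]]; split; first exact: measurable_funD.
exists (M + N) => x Dx.
by rewrite (le_trans (ler_normD _ _))// lerD ?fM ?gN.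
Qed.

Lemma bmfunM f g : bmfun f -> bmfun g -> bmfun (fun x => f x * g x).
Proof.
move=> [mf [M fM]] [mg [N gN]]; split; first exact: measurable_funM.
by exists (M * N) => x Dx; rewrite normrM ler_pM ?fM ?gN.
Qed.

Lemma bmfunN f : bmfun f -> bmfun (fun x => - f x).
Proof.
move=> [mf [M fM]]; split; first exact: measurable_funN.
by exists M => x Dx; rewrite normrN fM.
Qed.

Lemma bmfunB f g : bmfun f -> bmfun g -> bmfun (fun x => f x - g x).
Proof. by move=> bf bg; apply: bmfunD => //; exact: bmfunN. Qed.

Lemma bmfunZ c f : bmfun f -> bmfun (fun x => c * f x).
Proof. by move=> bf; apply: bmfunM => //; exact: bmfun_cst. Qed.

Lemma bmfunX f n : bmfun f -> bmfun (fun x => f x ^+ n).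
Proof.
move=> bf; elim: n => [|n ih]; first exact: bmfun_cst.
by under eq_fun do rewrite exprS; exact: bmfunM.
Qed.

Lemma bmfun_norm f : bmfun f -> bmfun (fun x => `|f x|).
Proof.
move=> [mf [M fM]]; split; first exact: measurableT_comp.
by exists M => x Dx; rewrite normr_id fM.
Qed.

Lemma bmfun_indic (A : set T) : measurable A -> bmfun (\1_A : T -> R).
Proof.
move=> mA; split; first exact: measurable_indic.
by exists 1 => x _; rewrite indicE; case: (_ \in _); rewrite ?normr1 ?normr0.
Qed.

Lemma bmfun_sum (I : Type) (r : seq I) (f : I -> T -> R) :
  (forall i, bmfun (f i)) -> bmfun (fun x => \sum_(i <- r) f i x).
Proof.
move=> bf; elim: r => [|i r ih].
  by under eq_fun do rewrite big_nil; exact: bmfun_cst.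
by under eq_fun do rewrite big_cons; exact: bmfunD.
Qed.

End bounded_measurable.

Lemma ler_indicE (T : Type) (R : realType) (f g : T -> R) :
  (fun w => ((f w <= g w)%R : bool)%:R) = \1_[set w | f w <= g w] :> (T -> R).
Proof.
apply/funext => w; rewrite indicE; congr (_%:R); congr nat_of_bool.
by apply/idP/idP => [?|/set_mem//]; rewrite inE.
Qed.

Lemma measurable_ler d (T : measurableType d) (R : realType) (f g : T -> R) :
  measurable_fun setT f -> measurable_fun setT g -> measurable [set w | f w <= g w].
Proof.
by move=> mf mg; rewrite -[X in measurable X]setTI; exact: measurable_fun_le.
Qed.

Section Rintegral_bounded.
Context {d : measure_display} {T : measurableType d} {R : realType}.
Variables (mu : {measure set T -> \bar R}) (D : set T).
Hypotheses (mD : measurable D) (muD : (mu D < +oo)%E).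
Local Notation I f := (Rintegral mu D f).
Local Notation bm := (bmfun D).

Lemma bmfun_integrable f : bm f -> mu.-integrable D (EFin \o f).
Proof.
move=> [mf [M fM]]; apply: measurable_bounded_integrable => //.
by exists M; split; rewrite ?num_real // => x Mx y Dy; exact: (le_trans (fM y Dy) (ltW Mx)).
Qed.

Lemma bm_RintegralE f : bm f -> (I f)%:E = (\int[mu]_(x in D) (f x)%:E)%E.
Proof.
by move=> bf; rewrite /Rintegral fineK//; apply: integrable_fin_num => //; exact: bmfun_integrable.
Qed.

Lemma bm_RintegralD f g : bm f -> bm g -> I (fun x => f x + g x) = I f + I g.
Proof. by move=> ? ?; apply: RintegralD => //; exact: bmfun_integrable. Qed.

Lemma bm_RintegralB f g : bm f -> bm g -> I (fun x => f x - g x) = I f - I g.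
Proof. by move=> ? ?; apply: RintegralB => //; exact: bmfun_integrable. Qed.

Lemma bm_RintegralZ c f : bm f -> I (fun x => c * f x) = c * I f.
Proof. by move=> ?; apply: RintegralZl => //; exact: bmfun_integrable. Qed.

Lemma bm_le_Rintegral f g : bm f -> bm g -> (forall x, D x -> f x <= g x) ->
  I f <= I g.
Proof. by move=> ? ? ?; apply: le_Rintegral => //; exact: bmfun_integrable. Qed.

Lemma bm_le_normr_Rintegral f : bm f -> `|I f| <= I (fun x => `|f x|).
Proof. by move=> ?; apply: le_normr_Rintegral => //; exact: bmfun_integrable. Qed.

Lemma bm_Rintegral_sum (J : Type) (r : seq J) (f : J -> T -> R) :
  (forall i, bm (f i)) ->
  I (fun x => \sum_(i <- r) f i x) = \sum_(i <- r) I (f i).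
Proof.
move=> bf; elim: r => [|i r ih].
  by under eq_fun do rewrite big_nil; rewrite Rintegral_cst// mul0r big_nil.
under eq_fun do rewrite big_cons.
by rewrite bm_RintegralD ?ih ?big_cons//; exact: bmfun_sum.
Qed.

Lemma Rintegral_eq f g : (forall x, D x -> f x = g x) -> I f = I g.
Proof. by move=> fg; apply: eq_Rintegral => x /set_mem; exact: fg. Qed.

End Rintegral_bounded.

Section expectation.
Context {d : measure_display} {T : measurableType d} {R : realType}.
Variable P : probability T R.
Local Notation E f := (Rintegral P setT f).
Local Notation bm := (bmfun setT).

Lemma probT_lty : (P setT < +oo)%E.
Proof. by have /= -> := probability_setT P; rewrite ltry. Qed.

Lemma E_cst c : E (fun=> c) = c.
Proof.
rewrite Rintegral_cst//; have -> : fine (P setT) = 1 by have /= -> := probability_setT P.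
by rewrite mulr1.
Qed.

Lemma E_le f g : bm f -> bm g -> (forall x, f x <= g x) -> E f <= E g.
Proof. by move=> bf bg fg; apply: bm_le_Rintegral => //; exact: probT_lty. Qed.

Lemma E_D f g : bm f -> bm g -> E (fun x => f x + g x) = E f + E g.
Proof. by move=> *; apply: bm_RintegralD => //; exact: probT_lty. Qed.

Lemma E_B f g : bm f -> bm g -> E (fun x => f x - g x) = E f - E g.
Proof. by move=> *; apply: bm_RintegralB => //; exact: probT_lty. Qed.

Lemma E_Z c f : bm f -> E (fun x => c * f x) = c * E f.
Proof. by move=> *; apply: bm_RintegralZ => //; exact: probT_lty. Qed.

Lemma E_sum (J : Type) (r : seq J) (f : J -> T -> R) :
  (forall i, bm (f i)) ->
  E (fun x => \sum_(i <- r) f i x) = \sum_(i <- r) E (f i).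
Proof. by move=> *; apply: bm_Rintegral_sum => //; exact: probT_lty. Qed.

Lemma markov_bm f t : bm f -> (forall x, 0 <= f x) -> 0 < t ->
  fine (P [set w | t <= f w]) <= E f / t.
Proof.
move=> bf f0 t0.
have mA : measurable [set w | t <= f w].
  by apply: measurable_ler => //; exact: bf.1.
have -> : fine (P [set w | t <= f w]) = E (\1_[set w | t <= f w]).
  by rewrite /Rintegral integral_indic// setIT.
have b1 : bm (\1_[set w | t <= f w] : T -> R) by exact: bmfun_indic.
rewrite ler_pdivlMr// mulrC -E_Z//; apply: E_le => //.
  exact: bmfunZ.
move=> x; rewrite indicE; case: (boolP (x \in _)) => [/set_mem/= tx|_].
  by rewrite mulr1.
by rewrite mulr0.
Qed.

(** Expanding the square leaves the diagonal terms only. The index is an arbitrary finite type, so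
    that the lemma also serves the array of pairs (i,j), whose entries are orthogonal without being
    independent. *)
Lemma orthogonal_mean (J : finType) (f : J -> T -> R) (B : R) :
  (forall i, bm (f i)) ->
  (forall i j, i != j -> E (fun x => f i x * f j x) = 0) ->
  (forall i, E (fun x => f i x ^+ 2) <= B) ->
  (0 < #|J|)%N ->
  E (fun x => (#|J|%:R^-1 * \sum_i f i x) ^+ 2) <= B / #|J|%:R.
Proof.
move=> bf o fB J0.
have bij i j : bm (fun x => f i x * f j x) by exact: bmfunM.
have -> : E (fun x => (#|J|%:R^-1 * \sum_i f i x) ^+ 2) =
   #|J|%:R^-1 ^+ 2 * \sum_i \sum_j E (fun x => f i x * f j x).
  under [in RHS]eq_bigr do rewrite -E_sum//.
  rewrite -E_sum; last by move=> i; exact: bmfun_sum.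
  rewrite -E_Z; last by apply: bmfun_sum => i; exact: bmfun_sum.
  congr Rintegral; apply/funext => x.
  rewrite exprMn; congr (_ * _); rewrite expr2 mulr_suml.
  by apply: eq_bigr => i _; rewrite mulr_sumr.
have -> : \sum_i \sum_j E (fun x => f i x * f j x) = \sum_i E (fun x => f i x ^+ 2).
  apply: eq_bigr => i _; rewrite (bigD1 i)//= big1 ?addr0 => [|j ji].
    by congr Rintegral; apply/funext => x; rewrite expr2.
  by rewrite o// eq_sym.
have J0' : (0 : R) < #|J|%:R by rewrite ltr0n.
rewrite expr2 -mulrA mulrC ler_wpM2r ?invr_ge0 ?ler0n//.
rewrite mulrC ler_pdivrMr//.
apply: (le_trans (ler_sum _ (fun i _ => fB i))).
by rewrite sumr_const mulr_natr.
Qed.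

End expectation.

(** * Independence *)

Section independent_pair.
Context {d d1 d2 : measure_display} {T : measurableType d}
  {T1 : measurableType d1} {T2 : measurableType d2} {R : realType}.
Variable P : probability T R.
Local Notation E f := (Rintegral P setT f).

(** Tonelli's theorem yields measurability for nonnegative integrands, so [H] is shifted by its
    bound [M] and the constant is subtracted afterwards. *)
Lemma bmfun_partial_mean (Y : T -> T2) (H : T1 * T2 -> R) :
  measurable_fun setT Y -> bmfun setT H ->
  bmfun setT (fun x => E (fun w => H (x, Y w))).
Proof.
move=> mY [mH [M HM]].
have bsec x : bmfun setT (fun w => H (x, Y w)).
  split; last by exists M => w _; exact: HM.
  by apply: measurableT_comp => //; exact: measurable_fun_pair.
split; last first.
  exists M => x _; apply: (le_trans (bm_le_normr_Rintegral measurableT (probT_lty P) (bsec x))).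
  rewrite -[leRHS](E_cst P); apply: E_le; [exact: bmfun_norm|exact: bmfun_cst|].
  by move=> w; exact: HM.
pose Yf : {mfun T >-> T2} := HB.pack Y (isMeasurableFun.Build _ _ _ _ _ mY).
pose G (z : T1 * T2) := (M + H z)%:E.
have mG : measurable_fun setT G by apply/measurable_EFinP; exact: measurable_funD.
have G0 z : (0 <= G z)%E.
  by rewrite lee_fin; have := HM z I; rewrite ler_norml => /andP[]; lra.
have mF := @measurable_fun_fubini_tonelli_F _ _ T1 T2 R (distribution P Yf) G mG G0.
have -> : (fun x => E (fun w => H (x, Y w))) =
          (fun x => fine (fubini_F (distribution P Yf) G x) - M).
  apply/funext => x; rewrite /fubini_F ge0_integral_distribution//; last first.
    by apply: measurableT_comp => //; exact: measurable_fun_pair.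
  rewrite -[X in _ - X](E_cst P) -E_B//; first last.
  - exact: bmfun_cst.
  - by apply: bmfunD => //; exact: bmfun_cst.
  - by apply: Rintegral_eq => w _ /=; rewrite addrAC subrr add0r.
apply: measurable_funB => //.
by apply: measurableT_comp => //; exact: mF.
Qed.

Lemma independent_fubini (X : T -> T1) (Y : T -> T2) (H : T1 * T2 -> R) :
  measurable_fun setT X -> measurable_fun setT Y ->
  (forall A B, measurable A -> measurable B ->
    P [set w | A (X w) /\ B (Y w)] = (P [set w | A (X w)] * P [set w | B (Y w)])%E) ->
  bmfun setT H ->
  E (fun w => H (X w, Y w)) = E (fun w => E (fun w' => H (X w, Y w'))).
Proof.
move=> mX mY XY bH; have [mH [M HM]] := bH.
have mXY : measurable_fun setT (fun w => (X w, Y w)) by exact: measurable_fun_pair.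
pose Xf : {mfun T >-> T1} := HB.pack X (isMeasurableFun.Build _ _ _ _ _ mX).
pose Yf : {mfun T >-> T2} := HB.pack Y (isMeasurableFun.Build _ _ _ _ _ mY).
pose XYf : {mfun T >-> (T1 * T2)%type} :=
  HB.pack (fun w => (X w, Y w)) (isMeasurableFun.Build _ _ _ _ _ mXY).
have mEH : measurable_fun setT (EFin \o H) by exact/measurable_EFinP.
have bsec x : bmfun setT (fun w => H (x, Y w)).
  split; last by exists M => w _; exact: HM.
  by apply: measurableT_comp => //; exact: measurable_fun_pair.
have bj : bmfun setT (fun w => H (X w, Y w)).
  by split; [exact: measurableT_comp|exists M => w _; exact: HM].
have bm := bmfun_partial_mean mY bH.
have bmX : bmfun setT (fun w => E (fun w' => H (X w, Y w'))).
  case: bm => mm [N mN]; split; last by exists N => w _; exact: mN.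
  exact: (measurableT_comp mm mX).
apply/EFin_inj; rewrite bm_RintegralE//; last exact: probT_lty.
rewrite bm_RintegralE//; last exact: probT_lty.
transitivity (\int[distribution P XYf]_z (EFin \o H) z)%E.
  rewrite integral_distribution//.
  exact: (bmfun_integrable measurableT (probT_lty P) bj).
transitivity (\int[distribution P Xf \x distribution P Yf]_z (EFin \o H) z)%E.
  apply: eq_measure_integral => A mA _; symmetry.
  exact: product_measure_unique.
rewrite -integral12_prod_meas1; last first.
  by apply: bmfun_integrable => //; exact: probT_lty.
transitivity (\int[distribution P Xf]_x (E (fun w' => H (x, Y w')))%:E)%E.
  apply: eq_integral => x _; rewrite /fubini_F bm_RintegralE//; last exact: probT_lty.
  rewrite integral_distribution//.
  - by apply: measurableT_comp => //; exact: measurable_fun_pair.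
  - exact: (bmfun_integrable measurableT (probT_lty P) (bsec x)).
rewrite integral_distribution//.
- by apply/measurable_EFinP; exact: bm.1.
- exact: (bmfun_integrable measurableT (probT_lty P) bmX).
Qed.

End independent_pair.

Section independent_family.
Context {d : measure_display} {T : measurableType d} {R : realType} {I : finType}.
Variables (P : probability T R) (Z : I -> T -> R).
Hypothesis mZ : forall i, measurable_fun setT (Z i).
Hypothesis indepZ : mutual_indep P Z.
Local Notation E f := (Rintegral P setT f).

Definition cylinders_avoiding (s : I) : set (set T) :=
  [set A | exists2 B : I -> set R, (forall i, measurable (B i)) &
    A = [set w | forall i, i != s -> B i (Z i w)]].

(* Independence of [Z s] from the other variables is used through functions on
   the sample space that are measurable for the smaller sigma-algebra. *)
Local Notation Tavoid s := (g_sigma_algebraType (cylinders_avoiding s)).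

Lemma measurable_box (Q : pred I) (B : I -> set R) : (forall i, measurable (B i)) ->
  measurable [set w | forall i, Q i -> B i (Z i w)].
Proof.
move=> mB.
have -> : [set w | forall i, Q i -> B i (Z i w)] =
    \bigcap_(i in [set i | Q i]) (Z i @^-1` B i).
  by apply/seteqP; split=> w h i Qi; exact: h.
apply: fin_bigcap_measurable; first exact: finite_finset.
by move=> i _; rewrite -[X in measurable X]setTI; exact: mZ.
Qed.

Lemma cylinders_avoiding_measurable s : cylinders_avoiding s `<=` measurable.
Proof. by move=> _ [B mB ->]; exact: (@measurable_box (fun i => i != s)). Qed.

(** The product formula is used twice, with [C] and with [setT] in coordinate [s]; the second use
    identifies the product over the other coordinates as the probability of the cylinder. *)
Lemma cylinders_avoiding_indep s B C : (forall i, measurable (B i)) -> measurable C ->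
  P ([set w | forall i, i != s -> B i (Z i w)] `&` [set w | C (Z s w)]) =
  (P [set w | forall i, i != s -> B i (Z i w)] * P [set w | C (Z s w)])%E.
Proof.
move=> mB mC.
have mZC : measurable [set w | C (Z s w)].
  by rewrite -[X in measurable X]setTI; exact: mZ.
have mA := @measurable_box (fun i => i != s) B mB.
pose B1 C' i := if i == s then C' else B i.
have mB1 C' : measurable C' -> forall i, measurable (B1 C' i).
  by move=> mC' i; rewrite /B1; case: ifP.
have key C' : measurable C' ->
    fine (P ([set w | forall i, i != s -> B i (Z i w)] `&` [set w | C' (Z s w)])) =
    fine (P [set w | C' (Z s w)]) * \prod_(i | i != s) fine (P [set w | B i (Z i w)]).
  move=> mC'; have := indepZ (mB1 C' mC').
  rewrite (bigD1 s)//= {2}/B1 eqxx => h.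
  have -> : [set w | forall i, i != s -> B i (Z i w)] `&` [set w | C' (Z s w)] =
      [set w | forall i, B1 C' i (Z i w)].
    apply/seteqP; split => w /=.
      by move=> [h1 h2] i; rewrite /B1; case: eqP => [->//|/eqP]; exact: h1.
    move=> h1; split=> [i /negbTE is_|]; first by move: (h1 i); rewrite /B1 is_.
    by move: (h1 s); rewrite /B1 eqxx.
  rewrite h; congr (_ * _); apply: eq_bigr => i /negbTE is_.
  by rewrite /B1 is_.
apply/eqP; rewrite -[X in X == _]fineK ?fin_num_measure//; last exact: measurableI.
rewrite -[X in _ == (X * _)%E]fineK ?fin_num_measure//.
rewrite -[X in _ == (_ * X)%E]fineK ?fin_num_measure//.
rewrite -EFinM eqe key//; apply/eqP; rewrite mulrC; congr (_ * _).
have := key setT measurableT.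
have -> : [set w | [set: R] (Z s w)] = setT by apply/seteqP.
by rewrite setIT => ->; have /= -> := probability_setT P; rewrite mul1r.
Qed.

Lemma cylinders_avoiding_setI s : setI_closed (cylinders_avoiding s).
Proof.
move=> _ _ [B mB ->] [C mC ->]; exists (fun i => B i `&` C i).
  by move=> i; exact: measurableI.
apply/seteqP; split=> w /=.
  by move=> [h1 h2] i is_; split; [exact: h1|exact: h2].
by move=> h; split=> i is_; have [] := h i is_.
Qed.

(** Two finite measures in [A], the restriction of [P] to the event that [Z s] lies in [C] and the
    multiple [p P], agree on the cylinders, which are stable under intersection. *)
Lemma sigma_avoiding_indep s A C : <<s cylinders_avoiding s >> A -> measurable C ->
  P (A `&` [set w | C (Z s w)]) = (P A * P [set w | C (Z s w)])%E.
Proof.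
move=> sA mC.
have mZC : measurable [set w | C (Z s w)].
  by rewrite -[X in measurable X]setTI; exact: mZ.
pose p := fine (P [set w | C (Z s w)]).
have p0 : 0 <= p by rewrite fine_ge0.
have pE : p%:E = P [set w | C (Z s w)] by rewrite /p fineK// fin_num_measure.
rewrite muleC -pE.
have h := @g_sigma_algebra_measure_unique _ R T (cylinders_avoiding s)
  (@cylinders_avoiding_measurable s) (fun=> setT) _ _ (mrestr P mZC)
  (mscale (NngNum p0) P) (@cylinders_avoiding_setI s) _ _ A sA.
apply: h.
- move=> _; exists (fun=> setT) => //; apply/seteqP; split=> // w _ i _//.
- by apply/seteqP; split=> // w _; exists 0%N.
- move=> _ [B mB ->]; apply: etrans; first exact: cylinders_avoiding_indep.
  by rewrite muleC -pE.
- move=> _; rewrite /mrestr; apply: (le_lt_trans (probability_le1 P _)); last exact: ltry.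
  exact: measurableI.
Qed.

Lemma measurable_avoiding s t : t != s ->
  measurable_fun (setT : set (Tavoid s)) (Z t : Tavoid s -> R).
Proof.
move=> ts _ C mC; rewrite setTI; apply: sub_sigma_algebra.
exists (fun i => if i == t then C else setT); first by move=> i; case: ifP.
apply/seteqP; split=> w /=.
  by move=> Cw i _; case: eqP => // ->.
by move=> /(_ t ts); rewrite eqxx.
Qed.

Lemma measurable_idavoiding s : measurable_fun setT (idfun : T -> Tavoid s).
Proof.
move=> _ A sA; rewrite setTI preimage_id.
apply: (smallest_sub (@sigma_algebra_measurable _ T)) sA.
exact: cylinders_avoiding_measurable.
Qed.

(** Freezes every coordinate but [s]: [H] reads the others from [w], while [Z s] is integrated out
    over an independent copy [w']. *)
Lemma fubini_avoiding s (H : Tavoid s * R -> R) : bmfun setT H ->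
  E (fun w => H (w, Z s w)) = E (fun w => E (fun w' => H (w, Z s w'))).
Proof.
move=> bH; apply: (@independent_fubini _ _ _ T (Tavoid s) _ _ P idfun (Z s) H) => //.
  exact: measurable_idavoiding.
move=> A B mA mB; exact: sigma_avoiding_indep.
Qed.

(** Given everything but [Z s], the factor [g] comes out of the inner mean, which is zero. All
    orthogonality relations between noise terms reduce to this. *)
Lemma fresh_orthogonal s (g : Tavoid s -> R) (h : Tavoid s * R -> R) :
  bmfun setT g -> bmfun setT h -> (forall w, E (fun w' => h (w, Z s w')) = 0) ->
  E (fun w => g w * h (w, Z s w)) = 0.
Proof.
move=> bg bh h0.
have bg' : bmfun setT (fun z : Tavoid s * R => g z.1).
  case: bg => mg [M gM]; split; last by exists M => z _; exact: gM.
  by apply: measurableT_comp => //; exact: measurable_fst.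
rewrite (@fubini_avoiding s (fun z => g z.1 * h z)); last exact: bmfunM.
rewrite -[RHS](E_cst P); apply: Rintegral_eq => w _ /=.
have bhw : bmfun setT (fun w' => h (w, Z s w')).
  case: bh => mh [M hM]; split; last by exists M => z _; exact: hM.
  apply: (measurableT_comp mh).
  by apply: (@measurable_fun_pair _ _ _ T (Tavoid s) _ (fun=> w)).
by rewrite (E_Z P (g w) bhw) h0 mulr0.
Qed.

Lemma fresh_orthogonal1 s (g : Tavoid s -> R) (h : R -> R) :
  bmfun setT g -> bmfun setT h -> E (fun w' => h (Z s w')) = 0 ->
  E (fun w => g w * h (Z s w)) = 0.
Proof.
move=> bg [mh [M hM]] h0.
apply: (@fresh_orthogonal s g (fun z => h z.2)) => //.
split; last by exists M => z _; exact: hM.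
by apply: measurableT_comp => //; exact: measurable_snd.
Qed.

Let bmfun_avoiding_pair s t (h : R * R -> R) : t != s -> bmfun setT h ->
  bmfun setT (fun z : Tavoid s * R => h (Z t z.1, z.2)).
Proof.
move=> ts [mh [M hM]]; split; last by exists M => z _; exact: hM.
apply: measurableT_comp => //; apply: measurable_fun_pair; last exact: measurable_snd.
by apply: (measurableT_comp (measurable_avoiding ts)); exact: measurable_fst.
Qed.

Lemma fubini_avoiding2 s t (h : R * R -> R) : t != s -> bmfun setT h ->
  E (fun w => h (Z t w, Z s w)) = E (fun w => E (fun w' => h (Z t w, Z s w'))).
Proof.
move=> ts bh.
exact: (@fubini_avoiding s (fun z => h (Z t z.1, z.2)) (bmfun_avoiding_pair ts bh)).
Qed.

Lemma fresh_orthogonal2 s t (g : Tavoid s -> R) (h : R * R -> R) : t != s ->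
  bmfun setT g -> bmfun setT h -> (forall x, E (fun w' => h (x, Z s w')) = 0) ->
  E (fun w => g w * h (Z t w, Z s w)) = 0.
Proof.
move=> ts bg bh h0.
apply: (@fresh_orthogonal s g (fun z => h (Z t z.1, z.2)) bg (bmfun_avoiding_pair ts bh)).
by move=> w; exact: (h0 (Z t w)).
Qed.

Lemma bmfun_avoiding1 s a (k : R -> R) : a != s -> bmfun setT k ->
  bmfun setT (fun w : Tavoid s => k (Z a w)).
Proof.
move=> as_ [mk [M kM]]; split; last by exists M => z _; exact: kM.
by apply: measurableT_comp => //; exact: measurable_avoiding.
Qed.

Lemma bmfun_avoiding2 s a b (k : R * R -> R) : a != s -> b != s -> bmfun setT k ->
  bmfun setT (fun w : Tavoid s => k (Z a w, Z b w)).
Proof.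
move=> as_ bs [mk [M kM]]; split; last by exists M => z _; exact: kM.
apply: measurableT_comp => //.
by apply: measurable_fun_pair; exact: measurable_avoiding.
Qed.

End independent_family.

(** * Laws on the unit interval given by a density *)

Section density.
Context {d : measure_display} {T : measurableType d} {R : realType}.
Variable P : probability T R.
Local Notation lam := (@lebesgue_measure R).
Local Notation I01 := (`[0%R, 1%R]%classic : set R).

Lemma lebesgue_cc01_lty : (lam I01 < +oo)%E.
Proof. by rewrite lebesgue_measure_itv/= lte_fin ltr01 sube0 ltry. Qed.

(** The hypothesis on [Z] concerns probabilities of sets. It makes [r] a version of the
    Radon-Nikodym derivative of the law of [Z], and the change of variables for that derivative
    passes to means. *)
Lemma density_mean (Z : T -> R) (r f : R -> R) :
  measurable_fun setT Z -> (forall w, 0 <= Z w <= 1) ->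
  bmfun I01 r ->
  (forall A : set R, measurable A ->
     P [set w | A (Z w)] = (\int[lam]_(z in A `&` `]0%R, 1%R[) (r z)%:E)%E) ->
  bmfun I01 f ->
  Rintegral P setT (fun w => f (Z w)) = Rintegral lam `[0, 1] (fun z => f z * r z).
Proof.
move=> mZ Z01 br Zr bf.
have mI : measurable (`[0, 1]%classic : set R) by exact: measurable_itv.
have mZ' : measurable_fun setT (Z : T -> measurableTypeR R) by exact: mZ.
pose Zf : {mfun T >-> measurableTypeR R} :=
  HB.pack (Z : T -> measurableTypeR R) (isMeasurableFun.Build _ _ _ _ _ mZ').
pose nu := distribution P Zf.
have dom : nu `<< lam.
  apply/null_content_dominatesP => A mA A0; rewrite /nu /distribution /pushforward.
  rewrite -[LHS]/(P [set w | A (Z w)]) Zr//; apply: null_set_integral.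
  - exact: measurableI.
  - apply/measurable_EFinP; apply: measurable_funS br.1 => //.
    by move=> x [_] /=; rewrite !in_itv/= => /andP[/ltW-> /ltW->].
  - apply/eqP; rewrite eq_le measure_ge0 andbT -A0; apply: le_measure; rewrite ?inE//.
    exact: measurableI.
(* [f] is controlled on [0,1] only, while the change of variables runs over the whole line. *)
pose f0 := f \_ `[0, 1].
have mf0 : measurable_fun setT f0 by apply/(measurable_restrictT _ _).1 => //; exact: bf.1.
have bf0 : bmfun setT f0.
  split => //; case: bf => _ [M fM]; exists `|M| => x _; rewrite /f0 patchE.
  case: ifPn => [/set_mem xI|_]; last by rewrite normr0.
  by rewrite (le_trans (fM x xI))// ler_norm.
pose h := Radon_Nikodym (charge_of_finite_measure nu) lam.
pose r0 x := ((r \_ `]0, 1[) x)%:E.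
have sub01 : (`]0, 1[%classic : set R) `<=` `[0, 1].
  by move=> x /=; rewrite !in_itv/= => /andP[/ltW-> /ltW->].
have mr0 : measurable_fun setT r0.
  apply/measurable_EFinP/(measurable_restrictT _ _).1 => //.
  by apply: measurable_funS br.1.
have hr0 : ae_eq lam setT h r0.
  apply: integral_ae_eq => //; first exact: Radon_Nikodym_integrable.
  move=> A _ mA; rewrite -Radon_Nikodym_integral//=.
  rewrite -[LHS]/(P [set w | A (Z w)]) Zr// integral_mkcondr.
  by apply: eq_integral => x _; rewrite /r0 !patchE; case: ifP.
have bfZ : bmfun setT (fun w => f0 (Z w)).
  split; first exact: measurableT_comp.
  by case: bf0 => _ [M fM]; exists M => x _; exact: fM.
have mh : measurable_fun setT h by apply: (measurable_int lam); exact: Radon_Nikodym_integrable.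
have mEf0 : measurable_fun setT (EFin \o f0) by exact/measurable_EFinP.
have bfr : bmfun I01 (fun z => f z * r z) by exact: bmfunM.
apply/EFin_inj.
have -> : Rintegral P setT (fun w => f (Z w)) = Rintegral P setT (fun w => f0 (Z w)).
  by apply: Rintegral_eq => w _; rewrite /f0 patchE mem_set//= in_itv/= Z01.
rewrite bm_RintegralE//; last exact: probT_lty.
rewrite bm_RintegralE//; last exact: lebesgue_cc01_lty.
transitivity (\int[nu]_x (EFin \o f0) x)%E.
  rewrite integral_distribution//.
  exact: (bmfun_integrable measurableT (probT_lty P) bfZ).
rewrite -(Radon_Nikodym_change_of_variables dom)//; last first.
  apply: bmfun_integrable => //.
  by apply: (le_lt_trans (probability_le1 _ _)) => //; exact: ltry.
transitivity (\int[lam]_x ((EFin \o f0) x * r0 x))%E.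
  apply: ae_eq_integral => //; [exact: emeasurable_funM|exact: emeasurable_funM|].
  exact: ae_eqe_mul2l.
transitivity (\int[lam]_(x in `]0%R, 1%R[) (f x * r x)%:E)%E.
  rewrite [RHS]integral_mkcond; apply: eq_integral => x _.
  rewrite /r0 /f0 /= !patchE; have [/set_mem xI|_] := boolP (x \in (`]0%R, 1%R[%classic : set R)).
    by rewrite mem_set//; exact: sub01.
  by rewrite mule0.
rewrite integral_itv_bndo_bndc//; last first.
  apply/measurable_EFinP; apply: measurable_funS bfr.1 => //.
rewrite integral_itv_obnd_cbnd//.
apply/measurable_EFinP; apply: measurable_funS bfr.1 => //.
by move=> x /=; rewrite !in_itv/= => /andP[/ltW-> ->].
Qed.

End density.

Section cdf_transform.
Context {d : measure_display} {T : measurableType d} {R : realType}.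
Variables (P : probability T R) (Z : T -> R) (F : R -> R).
Hypothesis mZ : measurable_fun setT Z.
Hypothesis ZF : has_cdf P Z F.
Local Notation lam := (@lebesgue_measure R).

Let mle x : measurable [set w | Z w <= x].
Proof. exact: (measurable_ler mZ (measurable_cst x)). Qed.

Lemma has_cdf_ge0 x : 0 <= F x.
Proof. by rewrite -lee_fin -ZF. Qed.

Lemma has_cdf_le1 x : F x <= 1.
Proof. by rewrite -lee_fin -ZF; exact: probability_le1. Qed.

Lemma has_cdf_itv01 x : 0 <= F x <= 1.
Proof. by rewrite has_cdf_ge0 has_cdf_le1. Qed.

Lemma has_cdf_homo : {homo F : x y / x <= y}.
Proof.
move=> x y xy; rewrite -lee_fin -!ZF; apply: le_measure; rewrite ?inE//.
by move=> w /= /le_trans; exact.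
Qed.

Lemma has_cdf_measurable : measurable_fun setT F.
Proof. by apply: nondecreasing_measurable => // x y; exact: has_cdf_homo. Qed.

Hypothesis F_dense : forall a b, 0 <= a -> a < b -> b <= 1 -> exists2 y, a < F y & F y < b.

Let mFZ : measurable_fun setT (fun w => F (Z w)).
Proof. by apply: measurableT_comp => //; exact: has_cdf_measurable. Qed.

Let mFle u : measurable [set w | F (Z w) <= u].
Proof. exact: (measurable_ler mFZ (measurable_cst u)). Qed.

Let mFgt u : measurable [set w | u < F (Z w)].
Proof.
have -> : [set w | u < F (Z w)] = ~` [set w | F (Z w) <= u].
  by apply/seteqP; split=> w /=; rewrite ltNge => /negP.
exact: measurableC.
Qed.

(** A squeeze in place of an inverse of [F]: if [u < F y], monotonicity puts the event
    [F (Z w) <= u] inside [Z w <= y]; if [F y < u], the inclusion is reversed. Density of the range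
    provides values [F y] within any [e] of [u] on either side. *)
Let cdf_transform_le u : 0 < u < 1 -> P [set w | F (Z w) <= u] = u%:E.
Proof.
move=> /andP[u0 u1].
rewrite -[LHS]fineK ?fin_num_measure//; congr (_%:E); apply/eqP; rewrite eq_le; apply/andP; split.
- apply/ler_addgt0Pr => e e0.
  have ub : u < Num.min 1 (u + e) by rewrite lt_min u1 ltrDl.
  have b1 : Num.min 1 (u + e) <= 1 by rewrite ge_min lexx.
  have [y uy yb] := F_dense (ltW u0) ub b1.
  apply: (@le_trans _ _ (F y)); last first.
    by move: yb; rewrite lt_min => /andP[_ /ltW].
  rewrite -lee_fin fineK ?fin_num_measure// -ZF; apply: le_measure; rewrite ?inE//.
  move=> w /= Fw; rewrite leNgt; apply/negP => /ltW/has_cdf_homo Fyw.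
  by move: (lt_le_trans uy Fyw); rewrite ltNge Fw.
- apply/ler_addgt0Pr => e e0; rewrite -lerBlDr.
  have a0 : 0 <= Num.max 0 (u - e) by rewrite le_max lexx.
  have au : Num.max 0 (u - e) < u by rewrite gt_max u0 ltrBlDr ltrDl.
  have [y uy yb] := F_dense a0 au (ltW u1).
  apply: (@le_trans _ _ (F y)).
    by move: uy; rewrite gt_max => /andP[_ /ltW].
  rewrite -lee_fin fineK ?fin_num_measure// -ZF; apply: le_measure; rewrite ?inE//.
  by move=> w /= /has_cdf_homo/le_trans; apply; exact: ltW.
Qed.

Let cdf_transform_gt u : 0 < u < 1 -> P [set w | u < F (Z w)] = (1 - u)%:E.
Proof.
move=> u01; have -> : [set w | u < F (Z w)] = ~` [set w | F (Z w) <= u].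
  by apply/seteqP; split=> w /=; rewrite ltNge => /negP.
by rewrite probability_setC// cdf_transform_le.
Qed.

Lemma uniform_cdf_transform (A : set R) : measurable A ->
  P [set w | A (F (Z w))] = (\int[lam]_(z in A `&` `]0%R, 1%R[) 1%:E)%E.
Proof.
move=> mA.
have mI : measurable (`]0%R, 1%R[%classic : set (measurableTypeR R)) by exact: measurable_itv.
have mFZ' : measurable_fun setT ((fun w => F (Z w)) : T -> measurableTypeR R) by exact: mFZ.
pose Ff : {mfun T >-> measurableTypeR R} :=
  HB.pack ((fun w => F (Z w)) : T -> measurableTypeR R) (isMeasurableFun.Build _ _ _ _ _ mFZ').
rewrite integral_cst//; last exact: measurableI.
rewrite mul1e -[LHS]/(distribution P Ff A) -[RHS]/(mrestr lam mI A).
apply: (@g_sigma_algebra_measure_unique _ R (measurableTypeR R) (@RGenOInfty.G R)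
   _ (fun n => `](- n%:R), +oo[%classic)).
- by move=> _ [x ->]; exact: measurable_itv.
- by move=> n; exists (- n%:R).
- apply/seteqP; split=> // x _; exists (Num.truncn `|x|).+1 => //=.
  rewrite in_itv/= andbT ltrNl; apply: (le_lt_trans (ler_norm _)).
  by rewrite normrN; exact: truncnS_gt.
- move=> _ _ [x ->] [y ->]; exists (Num.max x y).
  by apply/seteqP; split => z /=; rewrite !in_itv/= !andbT gt_max => /andP.
- move=> _ [u ->].
  rewrite -[LHS]/(P ((fun w => F (Z w)) @^-1` (`]u, +oo[%classic : set R))).
  rewrite -[RHS]/(lam (`]u, +oo[ `&` `]0, 1[ : set R)).
  have -> : (fun w => F (Z w)) @^-1` (`]u, +oo[%classic : set R) = [set w | u < F (Z w)].
    by apply/seteqP; split=> w /=; rewrite in_itv/= andbT.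
  have [u1|u1] := leP 1 u.
    have -> : [set w | u < F (Z w)] = set0.
      apply/seteqP; split=> w //=; rewrite ltNge (le_trans _ u1)//.
      exact: has_cdf_le1.
    have -> : `]u, +oo[ `&` `]0, 1[ = set0 :> set R.
      apply/seteqP; split=> z //=; rewrite !in_itv/= andbT => -[uz /andP[_ z1]].
      by move: (lt_trans uz z1); rewrite ltNge u1.
    by rewrite !measure0.
  have [u0|u0] := leP u 0.
    have -> : `]u, +oo[ `&` `]0, 1[ = `]0, 1[%classic :> set R.
      apply/seteqP; split=> z /=; rewrite !in_itv/= andbT; first by case.
      by move=> /andP[z0 z1]; rewrite z0 z1 (le_lt_trans u0 z0).
    rewrite lebesgue_measure_itv/= lte_fin ltr01 sube0.
    rewrite -[LHS]fineK ?fin_num_measure//; congr (_%:E); apply/eqP; rewrite eq_le; apply/andP; split.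
      by rewrite -lee_fin fineK ?fin_num_measure//; exact: probability_le1.
    apply/ler_addgt0Pr => e e0; rewrite -lerBlDr.
    (* [cdf_transform_gt] covers levels strictly between 0 and 1; for [u <= 0] the mass 1 is
       approached by [1 - v] with [v] small. *)
    pose v := Num.min e (2^-1).
    have v01 : 0 < v < 1.
      apply/andP; split; first by rewrite lt_min e0 invr_gt0 ltr0n.
      by rewrite gt_min invf_lt1 ?ltr0n// ltr1n orbT.
    apply: (@le_trans _ _ (1 - v)); first by rewrite lerB// ge_min lexx.
    rewrite -lee_fin fineK ?fin_num_measure// -cdf_transform_gt//.
    apply: le_measure; rewrite ?inE// => w /=; apply: le_lt_trans.
    by rewrite (le_trans u0)// ltW//; case/andP: v01.
  rewrite cdf_transform_gt ?u0 ?u1//.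
  have -> : `]u, +oo[ `&` `]0, 1[ = `]u, 1[%classic :> set R.
    apply/seteqP; split=> z /=; rewrite !in_itv/= andbT; first by move=> [-> /andP[_ ->]].
    by move=> /andP[uz ->]; rewrite uz (lt_trans u0 uz).
  by rewrite lebesgue_measure_itv/= lte_fin u1 EFinB.
- move=> k; apply: (le_lt_trans (probability_le1 _ _)) => //; exact: ltry.
- by have := @RGenOInfty.measurableE R; rewrite /measurable/= => <-.
Qed.

End cdf_transform.

(** * Calculus on the unit interval *)

Section unit_integral.
Context {R : realType}.
Local Notation lam := (@lebesgue_measure R).
Local Notation I01 := (`[0%R, 1%R]%classic : set R).
Local Notation I f := (Rintegral lam I01 f).

Lemma continuous_bmfun (a b : R) (f : R -> R) : continuous f ->
  bmfun (`[a, b]%classic : set R) f.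
Proof.
move=> cf; split; first by apply: measurable_funTS; exact: continuous_measurable_fun.
have /compact_bounded[M [_ hM]] := continuous_compact
  (continuous_subspaceT cf) (@segment_compact _ a b).
exists (M + 1) => x xab; apply: (hM (M + 1)); first by rewrite ltrDl.
by exists x.
Qed.

Lemma continuous_FTC (f F : R -> R) (a b : R) : continuous f ->
  (forall x, is_derive x (1 : R) F (f x)) -> a <= b ->
  Rintegral lam `[a, b] f = F b - F a.
Proof.
move=> cf dF; rewrite le_eqVlt => /predU1P[->|ab].
  by rewrite set_itv1 Rintegral_set1 subrr.
rewrite /Rintegral (@continuous_FTC2 _ f F)//.
- exact: continuous_subspaceT.
- have cF : continuous F.
    move=> x; apply: differentiable_continuous; apply/derivable1_diffP.
    by have [] := dF x.
  split.
  + by move=> x _; have [] := dF x.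
  + exact/cvg_at_right_filter/cF.
  + exact/cvg_at_left_filter/cF.
- by move=> x _; rewrite derive1E; exact: derive_val.
Qed.

Lemma I01_cst c : I (fun=> c) = c.
Proof.
rewrite Rintegral_cst//; have /= -> := @lebesgue_measure_itv R `[0, 1].
by rewrite lte_fin ltr01 sube0 mulr1.
Qed.

Lemma I01_D f g : bmfun I01 f -> bmfun I01 g -> I (fun x => f x + g x) = I f + I g.
Proof. by move=> *; apply: bm_RintegralD => //; exact: lebesgue_cc01_lty. Qed.

Lemma I01_B f g : bmfun I01 f -> bmfun I01 g -> I (fun x => f x - g x) = I f - I g.
Proof. by move=> *; apply: bm_RintegralB => //; exact: lebesgue_cc01_lty. Qed.

Lemma I01_Z c f : bmfun I01 f -> I (fun x => c * f x) = c * I f.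
Proof. by move=> *; apply: bm_RintegralZ => //; exact: lebesgue_cc01_lty. Qed.

Lemma I01_sum (J : Type) (r : seq J) (f : J -> R -> R) :
  (forall i, bmfun I01 (f i)) ->
  I (fun x => \sum_(i <- r) f i x) = \sum_(i <- r) I (f i).
Proof. by move=> *; apply: bm_Rintegral_sum => //; exact: lebesgue_cc01_lty. Qed.

Lemma I01_le f g : bmfun I01 f -> bmfun I01 g ->
  (forall x, 0 <= x <= 1 -> f x <= g x) -> I f <= I g.
Proof.
move=> bf bg fg; apply: bm_le_Rintegral => //; exact: lebesgue_cc01_lty.
Qed.

Lemma I01_eq f g : (forall x, 0 <= x <= 1 -> f x = g x) -> I f = I g.
Proof. by move=> fg; apply: Rintegral_eq => x /=; rewrite in_itv/=; exact: fg. Qed.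

Lemma I01_norm f : bmfun I01 f -> `|I f| <= I (fun x => `|f x|).
Proof. by move=> bf; apply: bm_le_normr_Rintegral => //; exact: lebesgue_cc01_lty. Qed.

End unit_integral.

Section smooth_on_unit.
Context {R : realType}.
Variables (p p1 p2 : R -> R) (S1 S2 : R).
Local Notation lam := (@lebesgue_measure R).
Local Notation I01 := (`[0%R, 1%R]%classic : set R).
Local Notation I f := (Rintegral lam I01 f).

Lemma increment_le (f f' : R -> R) (lo hi B a b : R) :
  (forall x, is_derive x (1 : R) f (f' x)) ->
  (forall x, lo <= x <= hi -> `|f' x| <= B) ->
  lo <= a <= hi -> lo <= b <= hi -> `|f a - f b| <= B * `|a - b|.
Proof.
move=> df f'B; wlog ab : a b / a < b.
  move=> h a01 b01; case: (ltgtP a b) => [ab|ba|->].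
  - exact: h.
  - by rewrite distrC [`|a - b|]distrC; exact: h.
  - by rewrite !subrr normr0 mulr0.
move=> /andP[a0 a1] /andP[b0 b1].
have cf : continuous f.
  move=> x; apply: differentiable_continuous; apply/derivable1_diffP.
  by have [] := df x.
rewrite distrC [`|a - b|]distrC.
have [|c] := MVT ab (fun x _ => df x); first exact: continuous_subspaceT.
rewrite in_itv/= => /andP[ac cb] ->; rewrite normrM ler_wpM2r// f'B//.
by rewrite (le_trans a0 (ltW ac)) (le_trans (ltW cb) b1).
Qed.

Hypothesis dp : forall x, is_derive x (1 : R) p (p1 x).
Hypothesis dp1 : forall x, is_derive x (1 : R) p1 (p2 x).
Hypothesis p1_le : forall x, 0 <= x <= 1 -> `|p1 x| <= S1.
Hypothesis p2_le : forall x, 0 <= x <= 1 -> `|p2 x| <= S2.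

Lemma continuous_of_derive (f f' : R -> R) :
  (forall x, is_derive x (1 : R) f (f' x)) -> continuous f.
Proof.
move=> df x; apply: differentiable_continuous; apply/derivable1_diffP.
by have [] := df x.
Qed.

(** Mean value theorem twice: [x |-> p x - p1 b * x] has derivative [p1 x - p1 b], which is at most
    [S2 |a - b|] between [a] and [b]. The factor 1/2 of Taylor's formula is given up. *)
Lemma taylor2_le (a b : R) : 0 <= a <= 1 -> 0 <= b <= 1 ->
  `|p a - p b - p1 b * (a - b)| <= S2 * (a - b) ^+ 2.
Proof.
move=> a01 b01.
pose g x := p x - p1 b * x.
have dg x : is_derive x (1 : R) g (p1 x - p1 b).
  have := dp x => ?; rewrite /g.
  apply: is_derive_eq; by rewrite /GRing.scale/= mulr1.
have -> : p a - p b - p1 b * (a - b) = g a - g b by rewrite /g; ring.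
have -> : S2 * (a - b) ^+ 2 = S2 * `|a - b| * `|a - b|.
  by rewrite -mulrA -expr2 real_normK// num_real.
apply: (@increment_le g (fun x => p1 x - p1 b) (Num.min a b) (Num.max a b)) => //.
- move=> x /andP[xm xM].
  have x01 : 0 <= x <= 1.
    move: a01 b01 => /andP[a0 a1] /andP[b0 b1]; apply/andP; split.
      by apply: le_trans xm; rewrite le_min a0 b0.
    by apply: (le_trans xM); rewrite ge_max a1 b1.
  apply: (le_trans (increment_le dp1 p2_le x01 b01)).
  have S20 : 0 <= S2 by exact: le_trans (normr_ge0 _) (p2_le a01).
  rewrite ler_wpM2l//.
  case: (leP a b) xm xM => ab xm xM.
    by rewrite distrC [`|a - b|]distrC !ger0_norm ?subr_ge0// lerB.
  by rewrite !ger0_norm ?subr_ge0 ?(ltW ab)// lerB.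
- by rewrite ge_min lexx le_max lexx.
- by rewrite ge_min lexx le_max lexx !orbT.
Qed.

Let cp := continuous_of_derive dp.
Let cp1 := continuous_of_derive dp1.

Lemma bmfun_ge_indicator u : bmfun I01 (fun z : R => ((u <= z)%R : bool)%:R : R).
Proof.
rewrite (@ler_indicE _ R (fun=> u) id).
have mA : measurable [set z : R | u <= z].
  by apply: (@measurable_ler _ _ R (fun=> u) id) => //; exact: measurable_cst.
have [mf [M fM]] := @bmfun_indic _ _ R setT _ mA.
by split; [exact: measurable_funTS|exists M => x _; exact: fM].
Qed.

Hypothesis p_mean : I p = 0.

(* Integration by parts. When V is uniform, this is the projection of the
   first-order term of the statistic on the X-sample. *)
Lemma bridge_integral u : 0 <= u <= 1 ->
  I (fun z => p1 z * (((u <= z)%R : bool)%:R - z)) = - p u.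
Proof.
move=> /andP[u0 u1].
have bp : bmfun I01 p by exact: continuous_bmfun.
have bp1 : bmfun I01 p1 by exact: continuous_bmfun.
have bid : bmfun I01 (fun z : R => z) by apply: continuous_bmfun => x; exact: cvg_id.
have bi := bmfun_ge_indicator u.
have -> : (fun z => p1 z * (((u <= z)%R : bool)%:R - z)) =
    (fun z => p1 z * ((u <= z)%R : bool)%:R - (p z + p1 z * z) + p z).
  by apply/funext => z; ring.
rewrite I01_D//; last first.
  by apply: bmfunB; [exact: bmfunM|apply: bmfunD => //; exact: bmfunM].
rewrite I01_B//; [|exact: bmfunM|by apply: bmfunD => //; exact: bmfunM].
have -> : I (fun z => p z + p1 z * z) = p 1.
  have dpid x : is_derive x (1 : R) (fun z => p z * z) (p x + p1 x * x).
    have := dp x => ?; apply: is_derive_eq.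
    by rewrite /GRing.scale/= mulr1 [x * _]mulrC.
  have cpid : continuous (fun z => p z + p1 z * z).
    by move=> x; apply: cvgD; [exact: cp|apply: cvgM; [exact: cp1|exact: cvg_id]].
  by rewrite (continuous_FTC cpid dpid ler01) mulr1 mulr0 subr0.
have -> : I (fun z => p1 z * ((u <= z)%R : bool)%:R) = Rintegral lam `[u, 1] p1.
  rewrite [RHS]Rintegral_mkcond [LHS]Rintegral_mkcond.
  congr Rintegral; apply/funext => z; rewrite !patchE.
  have -> : (z \in (`[0, 1]%classic : set R)) = (0 <= z <= 1) by rewrite mem_setE in_itv.
  have -> : (z \in (`[u, 1]%classic : set R)) = (u <= z <= 1) by rewrite mem_setE in_itv.
  case: (leP u z) => uz /=; last by rewrite mulr0 if_same.
  by rewrite (le_trans u0 uz) mulr1.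
by rewrite (continuous_FTC cp1 dp u1) p_mean; ring.
Qed.

Variable r : R -> R.
Hypothesis br : bmfun I01 r.

(** For [V] of density [r], this is the mean of the first-order term contributed by an observation
    of the X-sample with [F (X i) = u]. *)
Definition bridge_mean u := I (fun z => p1 z * (((u <= z)%R : bool)%:R - z) * r z).

(** Subtracting the uniform case [bridge_integral] leaves the factor [r - 1], and the bracket, an
    indicator minus [z], is at most 1 in absolute value. *)
Lemma bridge_mean_approx u : 0 <= u <= 1 ->
  `|bridge_mean u + p u| <= S1 * I (fun z => `|r z - 1|).
Proof.
move=> u01; have bi := bmfun_ge_indicator u.
have bp1 : bmfun I01 p1 by exact: continuous_bmfun.
have bid : bmfun I01 (fun z : R => z) by apply: continuous_bmfun => x; exact: cvg_id.
have b1 : bmfun I01 (fun z => p1 z * (((u <= z)%R : bool)%:R - z)).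
  by apply: bmfunM => //; exact: bmfunB.
have br1 : bmfun I01 (fun z => r z - 1) by apply: bmfunB => //; exact: bmfun_cst.
have -> : p u = - I (fun z => p1 z * (((u <= z)%R : bool)%:R - z)).
  by rewrite bridge_integral// opprK.
rewrite -I01_B//; last exact: bmfunM.
apply: (le_trans (I01_norm _)); first by apply: bmfunB => //; exact: bmfunM.
rewrite -I01_Z; last exact: bmfun_norm.
apply: I01_le.
- by apply: bmfun_norm; apply: bmfunB => //; exact: bmfunM.
- by apply: bmfunZ; exact: bmfun_norm.
move=> z z01.
set h := _%:R - z.
have -> : p1 z * h * r z - p1 z * h = p1 z * (h * (r z - 1)) by ring.
rewrite 2!normrM ler_pM// ?p1_le// -[leRHS]mul1r ler_wpM2r//.
by move: z01 => /andP[z0 z1]; rewrite /h; case: (u <= z) => /=; rewrite ler_norml; lra.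
Qed.

End smooth_on_unit.

(** * The statistic at one frequency *)

Section empirical_noise.
Context {d : measure_display} {T : measurableType d} {R : realType}.
Variables (n m : nat) (P : probability T R).
Variables (X : 'I_n -> T -> R) (Y : 'I_m -> T -> R).
Hypotheses (n_gt0 : (0 < n)%N) (m_gt0 : (0 < m)%N).
Hypothesis mX : forall i, measurable_fun setT (X i).
Hypothesis mY : forall j, measurable_fun setT (Y j).
Hypothesis XY_indep : mutual_indep P (join2 X Y).
Variable F : R -> R.
Hypothesis XF : forall i, has_cdf P (X i) F.
Hypothesis F_dense : forall a b, 0 <= a -> a < b -> b <= 1 ->
  exists2 y, a < F y & F y < b.
Local Notation lam := (@lebesgue_measure R).
Local Notation I01 := (`[0%R, 1%R]%classic : set R).
Local Notation I f := (Rintegral lam I01 f).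
Local Notation E f := (Rintegral P setT f).
Local Notation bm := (bmfun setT).
Variable r : R -> R.
Hypothesis br : bmfun I01 r.
Hypothesis Yr : forall j (A : set R), measurable A ->
  P [set w | A (F (Y j w))] = (\int[lam]_(z in A `&` `]0%R, 1%R[) (r z)%:E)%E.
Variables (p p1 p2 : R -> R) (S0 S1 S2 : R).
Hypothesis dp : forall x, is_derive x (1 : R) p (p1 x).
Hypothesis dp1 : forall x, is_derive x (1 : R) p1 (p2 x).
Hypothesis p_le : forall x, 0 <= x <= 1 -> `|p x| <= S0.
Hypothesis p1_le : forall x, 0 <= x <= 1 -> `|p1 x| <= S1.
Hypothesis p2_le : forall x, 0 <= x <= 1 -> `|p2 x| <= S2.
Hypothesis p_mean : I p = 0.
Hypothesis p_norm : I (fun z => p z ^+ 2) = 1.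

Local Notation Z := (join2 X Y).
Let mZ s : measurable_fun setT (Z s).
Proof. by case: s => [i|j]; [exact: mX|exact: mY]. Qed.

Let i0 : 'I_n := Ordinal n_gt0.
Let j0 : 'I_m := Ordinal m_gt0.
Let F01 x : 0 <= F x <= 1 := has_cdf_itv01 (mX i0) (XF i0) x.
Let mF : measurable_fun setT F := has_cdf_measurable (mX i0) (XF i0).
Let cp : continuous p := continuous_of_derive dp.
Let cp1 : continuous p1 := continuous_of_derive dp1.
Let S1_ge0 : 0 <= S1.
Proof. by apply: le_trans (normr_ge0 _) (p1_le _); apply: (F01 0). Qed.

Let dev (z : R * R) : R := ((z.1 <= z.2)%R : bool)%:R - F z.2.
(** Kernel of the first-order term: [p1 (F (Y j)) * (Fn (Y j) - F (Y j))] is the average over [i] of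
    [h (X i, Y j)]. *)
Let h (z : R * R) : R := p1 (F z.2) * dev z.
Let r1 := I (fun z => `|r z - 1|).

Let mprodle : measurable [set z : R * R | z.1 <= z.2].
Proof. exact: (measurable_ler measurable_fst measurable_snd). Qed.

Let dev_le z : `|dev z| <= 1.
Proof. by rewrite /dev; have /andP[? ?] := F01 z.2; case: (z.1 <= z.2) => /=; rewrite ler_norml; lra. Qed.

Let bdev : bm dev.
Proof.
split; last by exists 1 => z _; exact: dev_le.
apply: measurable_funB; first by rewrite (ler_indicE fst snd); exact: measurable_indic.
by apply: measurableT_comp => //; exact: measurable_snd.
Qed.

Let h_le z : `|h z| <= S1.
Proof. by rewrite /h normrM -[S1]mulr1 ler_pM// p1_le. Qed.

Let bh : bm h.
Proof.
split; last by exists S1 => z _; exact: h_le.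
apply: measurable_funM; last exact: bdev.1.
apply: measurableT_comp; first exact: continuous_measurable_fun.
by apply: measurableT_comp => //; exact: measurable_snd.
Qed.

Let bpair a b (k : R * R -> R) : bm k -> bm (fun w => k (Z a w, Z b w)).
Proof.
move=> [mk [M kM]]; split; last by exists M => z _; exact: kM.
by apply: measurableT_comp => //; exact: measurable_fun_pair.
Qed.

Let bsing a (k : R -> R) : bm k -> bm (fun w => k (Z a w)).
Proof.
move=> [mk [M kM]]; split; last by exists M => z _; exact: kM.
exact: measurableT_comp.
Qed.

Let bsec (k : R * R -> R) y : bm k -> bm (fun x : R => k (x, y)).
Proof.
move=> [mk [M kM]]; split; last by exists M => z _; exact: kM.
by apply: measurableT_comp => //; exact: measurable_fun_pair.
Qed.

Let bswap (k : R * R -> R) : bm k -> bm (fun z : R * R => k (z.2, z.1)).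
Proof.
move=> [mk [M kM]]; split; last by exists M => z _; exact: kM.
apply: measurableT_comp => //; apply: measurable_fun_pair.
  exact: measurable_snd.
exact: measurable_fst.
Qed.

Let E_dev i y : E (fun w => dev (X i w, y)) = 0.
Proof.
have mA : measurable [set w | X i w <= y] := measurable_ler (mX i) (measurable_cst y).
have -> : (fun w => dev (X i w, y)) = (fun w => \1_[set w | X i w <= y] w - F y).
  by rewrite -ler_indicE.
have b1 : bm (\1_[set w | X i w <= y] : T -> R) by exact: bmfun_indic.
rewrite (E_B P b1 (bmfun_cst _ _)) (E_cst P).
have -> : E (\1_[set w | X i w <= y]) = F y; last by rewrite subrr.
by rewrite /Rintegral integral_indic// setIT; have /= -> := XF i y.
Qed.

Let E_h i y : E (fun w => h (X i w, y)) = 0.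
Proof.
by rewrite /h (E_Z P (p1 (F y)) (@bsing (inl i) _ (bsec y bdev))) E_dev mulr0.
Qed.

Let phi x := bridge_mean p1 r (F x).

Let E_hY j x : E (fun w => h (x, Y j w)) = phi x.
Proof.
have bG : bmfun I01 (fun z => p1 z * (((F x <= z)%R : bool)%:R - z)).
  apply: bmfunM; first exact: continuous_bmfun.
  apply: bmfunB; first exact: bmfun_ge_indicator.
  by apply: continuous_bmfun => ?; exact: cvg_id.
have mFY : measurable_fun setT (fun w => F (Y j w)) by exact: measurableT_comp.
(* [x <= y] and [F x <= F y] can differ only when [F y = F x], which has
   probability 0 for [y = Y j]. *)
rewrite /phi /bridge_mean -(@density_mean _ _ _ P (fun w => F (Y j w)) r)//; last exact: Yr.
have mA : measurable [set w | F (Y j w) = F x].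
  rewrite -[X in measurable X]setTI; apply: (mFY measurableT [set F x]).
  exact: measurable_set1.
have A0 : P [set w | F (Y j w) = F x] = 0.
  have := @Yr j [set F x] (measurable_set1 _) => /= ->.
  apply: null_set_integral.
  - by apply: measurableI.
  - apply/measurable_EFinP; apply: measurable_funS br.1 => //.
    by move=> z [_] /=; rewrite !in_itv/= => /andP[/ltW-> /ltW->].
  - apply/eqP; rewrite eq_le measure_ge0 andbT -(lebesgue_measure_set1 (F x)).
    by apply: le_measure; rewrite ?inE//; exact: measurableI.
have bl : bm (fun w => h (x, Y j w)).
  exact: (@bsing (inr j) _ (bsec x (bswap bh))).
have br' : bm (fun w => p1 (F (Y j w)) * (((F x <= F (Y j w))%R : bool)%:R - F (Y j w))).
  case: bG => mG [M GM]; split; last by exists M => w _; apply: GM; rewrite /= in_itv/=; exact: F01.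
  apply: measurable_funM.
    by apply: measurableT_comp => //; exact: continuous_measurable_fun.
  apply: measurable_funB => //.
  rewrite (ler_indicE (fun=> F x)); apply: measurable_indic.
  exact: (measurable_ler (measurable_cst (F x)) mFY).
apply/eqP; rewrite -subr_eq0 -normr_le0 -E_B//.
have b1 : bm (\1_[set w | F (Y j w) = F x] : T -> R) by exact: bmfun_indic.
apply: (le_trans (bm_le_normr_Rintegral measurableT (probT_lty P) (bmfunB bl br'))).
apply: (@le_trans _ _ (E (fun w => S1 * \1_[set w | F (Y j w) = F x] w))).
  apply: E_le; [by apply: bmfun_norm; exact: bmfunB|exact: bmfunZ|].
  move=> w; rewrite /h /dev /= -mulrBr normrM.
  apply: ler_pM => //; first by rewrite p1_le.
  rewrite indicE opprB addrA subrK.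
  have [xy|yx] := leP x (Y j w).
    by rewrite (has_cdf_homo (mX i0) (XF i0) xy) subrr normr0 ler0n.
  have [Fxy|_] := leP (F x) (F (Y j w)); last by rewrite subrr normr0 ler0n.
  have wA : w \in [set w | F (Y j w) = F x].
    by rewrite inE /=; apply/eqP; rewrite eq_le Fxy (has_cdf_homo (mX i0) (XF i0) (ltW yx)).
  by rewrite wA /= sub0r normrN normr1.
by rewrite E_Z// /Rintegral integral_indic// setIT; have /= -> := A0; rewrite mulr0.
Qed.

Let bphi : bm phi.
Proof.
have := bmfun_partial_mean P (mY j0) bh.
by under eq_fun do rewrite E_hY.
Qed.

Let phi_le x : `|phi x| <= S1.
Proof.
rewrite -(E_hY j0); have b : bm (fun w => h (x, Y j0 w)).
  exact: (@bsing (inr j0) _ (bsec x (bswap bh))).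
apply: (le_trans (bm_le_normr_Rintegral measurableT (probT_lty P) b)).
rewrite -[leRHS](E_cst P); apply: E_le; [exact: bmfun_norm|exact: bmfun_cst|].
by move=> w; exact: h_le.
Qed.

(** Integrate [h] over both variables in the two orders: [Y] first produces [phi], whereas [X] first
    produces 0, because the indicator of [X i <= y] has mean [F y]. *)
Let E_phi i : E (fun w => phi (X i w)) = 0.
Proof.
have lr : inl i != inr j0 :> ('I_n + 'I_m)%type by [].
transitivity (E (fun w => h (Z (inl i) w, Z (inr j0) w))).
  rewrite (fubini_avoiding2 mZ XY_indep lr bh).
  by apply: Rintegral_eq => w _; rewrite -(E_hY j0).
rewrite eq_sym in lr; rewrite (fubini_avoiding2 mZ XY_indep lr (bswap bh)).
by rewrite -[RHS](E_cst P); apply: Rintegral_eq => w _; exact: E_h.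
Qed.

Let ht (z : R * R) := h z - phi z.1.

Let bht : bm ht.
Proof.
apply: bmfunB => //; case: bphi => mphi [M phiM]; split; last by exists M => z _; exact: phiM.
by apply: measurableT_comp => //; exact: measurable_fst.
Qed.

Let E_htX i y : E (fun w => ht (X i w, y)) = 0.
Proof.
by rewrite /ht (E_B P (@bsing (inl i) _ (bsec y bh)) (@bsing (inl i) _ bphi)) E_h E_phi subrr.
Qed.

Let E_htY j x : E (fun w => ht (x, Y j w)) = 0.
Proof.
have b1 : bm (fun w => h (x, Y j w)) by exact: (@bsing (inr j) _ (bsec x (bswap bh))).
by rewrite /ht /= (E_B P b1 (bmfun_cst _ _)) E_hY (E_cst P) subrr.
Qed.

Let bpF : bm (fun x => p (F x)).
Proof.
split; last by exists S0 => x _; rewrite p_le.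
by apply: measurableT_comp => //; exact: continuous_measurable_fun.
Qed.

Let mu := I (fun z => p z * r z).

Let bp : bmfun I01 p. Proof. exact: continuous_bmfun. Qed.

Let E_pY j : E (fun w => p (F (Y j w))) = mu.
Proof. by rewrite /mu -(@density_mean _ _ _ P (fun w => F (Y j w)) r)//; [exact: measurableT_comp|exact: Yr]. Qed.

(* Hoeffding decomposition of the first-order term: [ht] has mean zero in each
   variable, so the summands of each of [T1], [T2], [T3] are orthogonal. *)
Let T1 w := m%:R^-1 * \sum_j (p (F (Y j w)) - mu).
Let T2 w := n%:R^-1 * \sum_i phi (X i w).
Let T3 w := (n%:R * m%:R)^-1 * \sum_(ij : 'I_n * 'I_m) ht (X ij.1 w, Y ij.2 w).
Let Dj j w := n%:R^-1 * \sum_i dev (X i w, Y j w).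

Let bmT1 j : bm (fun w => p (F (Y j w)) - mu).
Proof. by apply: bmfunB; [exact: (@bsing (inr j) _ bpF)|exact: bmfun_cst]. Qed.

(** The variance is at most the second moment, which would be 1 for uniform [V]; passing from the
    density 1 to [r] raises it by at most [S0^2 r1]. *)
Let E_T1 : E (fun w => T1 w ^+ 2) <= (1 + S0 ^+ 2 * r1) / m%:R.
Proof.
have := @orthogonal_mean _ T R P 'I_m (fun j w => p (F (Y j w)) - mu) (1 + S0 ^+ 2 * r1).
rewrite card_ord => om; apply: om => //.
- move=> j j' jj'; have s_ne : inr j != inr j' :> ('I_n + 'I_m)%type.
    by apply: contra jj' => /eqP[->].
  apply: (@fresh_orthogonal1 _ _ _ _ P Z mZ XY_indep (inr j')
    (fun w => p (F (Z (inr j) w)) - mu) (fun y => p (F y) - mu)).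
  + apply: (@bmfun_avoiding1 _ _ _ _ Z _ _ (fun y => p (F y) - mu)) => //.
    by apply: bmfunB => //; exact: bmfun_cst.
  + by apply: bmfunB => //; exact: bmfun_cst.
  + rewrite E_B ?E_pY ?E_cst ?subrr//; [exact: (@bsing (inr j') _ bpF)|exact: bmfun_cst].
- move=> j.
  have bpY := @bsing (inr j) _ bpF.
  have -> : E (fun w => (p (F (Y j w)) - mu) ^+ 2) =
      E (fun w => p (F (Y j w)) ^+ 2) - mu ^+ 2.
    have -> : (fun w => (p (F (Y j w)) - mu) ^+ 2) =
       (fun w => p (F (Y j w)) ^+ 2 - (2 * mu * p (F (Y j w)) - mu ^+ 2)).
      by apply/funext => w; ring.
    rewrite E_B; [|exact: bmfunX|apply: bmfunB; [exact: bmfunZ|exact: bmfun_cst]].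
    rewrite E_B; [|exact: bmfunZ|exact: bmfun_cst].
    by rewrite E_Z// E_pY E_cst; ring.
  apply: (@le_trans _ _ (E (fun w => p (F (Y j w)) ^+ 2))).
    by rewrite gerBl sqr_ge0.
  rewrite (@density_mean _ _ _ P (fun w => F (Y j w)) r (fun z => p z ^+ 2))//;
    [|exact: measurableT_comp|exact: Yr|exact: bmfunX].
  have br' : bmfun I01 (fun z => r z - 1) by apply: bmfunB => //; exact: bmfun_cst.
  have -> : 1 + S0 ^+ 2 * r1 = I (fun z => p z ^+ 2 + S0 ^+ 2 * `|r z - 1|).
    rewrite I01_D; [|exact: bmfunX|by apply: bmfunZ; exact: bmfun_norm].
    by rewrite p_norm I01_Z//; exact: bmfun_norm.
  apply: I01_le.
  + by apply: bmfunM => //; exact: bmfunX.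
  + by apply: bmfunD; [exact: bmfunX|by apply: bmfunZ; exact: bmfun_norm].
  move=> z z01; rewrite -lerBlDl -{2}[p z ^+ 2]mulr1 -mulrBr.
  apply: (le_trans (ler_norm _)); rewrite normrM ler_wpM2r//.
  by rewrite normrX lerXn2r ?nnegrE// ?p_le// (le_trans _ (p_le z01)).
Qed.

(** [phi x] is [- p (F x)] up to [S1 r1], and [p (F (X i))] has second moment 1 because [F (X i)] is
    uniform under the alternative as well. *)
Let E_T2 : E (fun w => T2 w ^+ 2) <= (2 + 2 * S1 ^+ 2 * r1 ^+ 2) / n%:R.
Proof.
have := @orthogonal_mean _ T R P 'I_n (fun i w => phi (X i w)) (2 + 2 * S1 ^+ 2 * r1 ^+ 2).
rewrite card_ord => om; apply: om => //.
- by move=> i; exact: (@bsing (inl i) _ bphi).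
- move=> i i' ii'; have s_ne : inl i != inl i' :> ('I_n + 'I_m)%type.
    by apply: contra ii' => /eqP[->].
  apply: (@fresh_orthogonal1 _ _ _ _ P Z mZ XY_indep (inl i')
    (fun w => phi (Z (inl i) w)) phi) => //; last exact: E_phi.
  exact: (@bmfun_avoiding1 _ _ _ _ Z _ _ phi).
- move=> i.
  have bpX := @bsing (inl i) _ bpF.
  have EpX : E (fun w => p (F (X i w)) ^+ 2) = 1.
    rewrite (@density_mean _ _ _ P (fun w => F (X i w)) (fun=> 1) (fun z => p z ^+ 2)).
    + by rewrite -[RHS]p_norm; apply: I01_eq => z _; rewrite mulr1.
    + exact: measurableT_comp.
    + by [].
    + exact: bmfun_cst.
    + by move=> A mA; exact: (uniform_cdf_transform (mX i) (XF i) F_dense mA).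
    + exact: bmfunX.
  have -> : 2 + 2 * S1 ^+ 2 * r1 ^+ 2 =
      E (fun w => 2 * p (F (X i w)) ^+ 2 + 2 * S1 ^+ 2 * r1 ^+ 2).
    rewrite E_D; [|by apply: bmfunZ; exact: bmfunX|exact: bmfun_cst].
    by rewrite E_Z ?EpX ?E_cst ?mulr1//; exact: bmfunX.
  apply: E_le.
  + by apply: bmfunX; exact: (@bsing (inl i) _ bphi).
  + by apply: bmfunD; [by apply: bmfunZ; exact: bmfunX|exact: bmfun_cst].
  move=> w; have := bridge_mean_approx dp dp1 p1_le p_mean br (F01 (X i w)).
  rewrite -/(phi _) -/r1; set q := p _; set f := phi _ => hq.
  have r10 : 0 <= r1 by apply: Rintegral_ge0.
  have : (f + q) ^+ 2 <= (S1 * r1) ^+ 2.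
    by rewrite -[(f + q) ^+ 2]real_normK ?num_real// lerXn2r ?nnegrE// mulr_ge0.
  (* [2 q^2 + 2 (f + q)^2 - f^2 = (f + 2 q)^2]. *)
  have := sqr_ge0 (f + 2 * q); nra.
Qed.

Let E_T3 : E (fun w => T3 w ^+ 2) <= (4 * S1 ^+ 2) / (n%:R * m%:R).
Proof.
have := @orthogonal_mean _ T R P ('I_n * 'I_m)%type
  (fun ij w => ht (X ij.1 w, Y ij.2 w)) (4 * S1 ^+ 2).
rewrite card_prod !card_ord natrM => om; apply: om => //.
- by move=> ij; exact: (@bpair (inl ij.1) (inr ij.2) _ bht).
- move=> [i j] [i' j'] /= ne.
  (* If the X-indices differ, [X i'] occurs in the second factor only, even when [j = j']. Otherwise
     the Y-indices differ and [Y j'] is the fresh variable. *)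
  have [ii'|ii'] := eqVneq i i'; last first.
    have s_ne : inl i != inl i' :> ('I_n + 'I_m)%type by apply: contra ii' => /eqP[->].
    apply: (@fresh_orthogonal2 _ _ _ _ P Z mZ XY_indep (inl i') (inr j')
      (fun w => ht (Z (inl i) w, Z (inr j) w)) (fun z => ht (z.2, z.1))) => //.
    + exact: (@bmfun_avoiding2 _ _ _ _ Z).
    + exact: bswap.
    + by move=> y; exact: E_htX.
  have s_ne : inr j != inr j' :> ('I_n + 'I_m)%type.
    by apply: contra ne => /eqP[->]; rewrite ii'.
  apply: (@fresh_orthogonal2 _ _ _ _ P Z mZ XY_indep (inr j') (inl i')
    (fun w => ht (Z (inl i) w, Z (inr j) w)) ht) => //.
  + exact: (@bmfun_avoiding2 _ _ _ _ Z).
  + by move=> x; exact: E_htY.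
- move=> [i j]; rewrite -[leRHS](E_cst P); apply: E_le.
  + by apply: bmfunX; exact: (@bpair (inl i) (inr j) _ bht).
  + exact: bmfun_cst.
  move=> w; have -> : 4 * S1 ^+ 2 = (2 * S1) ^+ 2 by ring.
  rewrite -[leLHS]real_normK ?num_real// lerXn2r ?nnegrE ?mulr_ge0//.
  rewrite /ht (le_trans (ler_normB _ _))// mulr_natl mulr2n lerD//.
- by rewrite muln_gt0 n_gt0.
Qed.

(** Given [Y j], the deviations of the X-indicators are centred and bounded by 1, so the empirical
    distribution function keeps its mean squared error [1/n] at the random point [Y j]. *)
Let E_Dj j : E (fun w => Dj j w ^+ 2) <= n%:R^-1.
Proof.
have := @orthogonal_mean _ T R P 'I_n (fun i w => dev (X i w, Y j w)) 1.
rewrite card_ord mul1r => om; apply: om => //.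
- by move=> i; exact: (@bpair (inl i) (inr j) _ bdev).
- move=> i i' ii'; have s_ne : inl i != inl i' :> ('I_n + 'I_m)%type.
    by apply: contra ii' => /eqP[->].
  apply: (@fresh_orthogonal2 _ _ _ _ P Z mZ XY_indep (inl i') (inr j)
    (fun w => dev (Z (inl i) w, Z (inr j) w)) (fun z => dev (z.2, z.1))) => //.
  + exact: (@bmfun_avoiding2 _ _ _ _ Z).
  + exact: bswap.
  + by move=> y; exact: E_dev.
- move=> i; rewrite -[leRHS](E_cst P); apply: E_le.
  + by apply: bmfunX; exact: (@bpair (inl i) (inr j) _ bdev).
  + exact: bmfun_cst.
  move=> w; rewrite -[leLHS]real_normK ?num_real// -[1](expr1n _ 2).
  by rewrite lerXn2r ?nnegrE//.
Qed.

(** [L] is [T1 + T2 + T3], measured in mean square, with the 3 of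
    [(a + b + c)^2 <= 3 (a^2 + b^2 + c^2)]. [Rem] dominates the Taylor remainder; it is already
    quadratic in [Fn - F], so a first moment suffices. *)
Lemma psihat_noise :
  exists L Rem : T -> R, [/\ bm L, bm Rem, (forall w, 0 <= Rem w),
   (forall w, `|m%:R^-1 * \sum_j p (Fn (X^~ w) (Y j w)) - I (fun z => p z * r z)|
       <= `|L w| + Rem w) &
   E (fun w => L w ^+ 2) <= 3 * ((1 + S0 ^+ 2 * r1) / m%:R +
      (2 + 2 * S1 ^+ 2 * r1 ^+ 2) / n%:R + 4 * S1 ^+ 2 / (n%:R * m%:R)) /\
   E Rem <= S2 / n%:R].
Proof.
have n0 : n%:R != 0 :> R by rewrite pnatr_eq0 -lt0n.
have m0 : m%:R != 0 :> R by rewrite pnatr_eq0 -lt0n.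
have S20 : 0 <= S2 by apply: le_trans (normr_ge0 _) (p2_le _); exact: (F01 0).
have bT1 : bm T1 by apply: bmfunZ; apply: bmfun_sum => j; exact: bmT1.
have bT2 : bm T2 by apply: bmfunZ; apply: bmfun_sum => i; exact: (@bsing (inl i) _ bphi).
have bT3 : bm T3.
  by apply: bmfunZ; apply: bmfun_sum => ij; exact: (@bpair (inl ij.1) (inr ij.2) _ bht).
have bDj j : bm (Dj j).
  by apply: bmfunZ; apply: bmfun_sum => i; exact: (@bpair (inl i) (inr j) _ bdev).
exists (fun w => T1 w + T2 w + T3 w), (fun w => S2 * (m%:R^-1 * \sum_j Dj j w ^+ 2)).
have bRem : bm (fun w => m%:R^-1 * \sum_j Dj j w ^+ 2).
  by apply: bmfunZ; apply: bmfun_sum => j; exact: bmfunX.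
split.
- by apply: bmfunD => //; exact: bmfunD.
- exact: bmfunZ.
- move=> w; rewrite mulr_ge0// mulr_ge0 ?invr_ge0 ?ler0n//.
  by apply: sumr_ge0 => j _; exact: sqr_ge0.
- move=> w.
  have FnE j : Fn (X^~ w) (Y j w) = F (Y j w) + Dj j w.
    rewrite /Dj /dev /Fn /= sumrB sumr_const card_ord mulrBr -[F _ *+ n]mulr_natl mulrA mulVf// mul1r.
    by rewrite addrC subrK.
  have Fn01 j : 0 <= Fn (X^~ w) (Y j w) <= 1.
    rewrite /Fn; apply/andP; split.
      by rewrite mulr_ge0 ?invr_ge0 ?ler0n// sumr_ge0.
    rewrite mulrC ler_pdivrMr ?ltr0n// mul1r.
    apply: (@le_trans _ _ (\sum_(i < n) 1)); last by rewrite sumr_const card_ord.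
    by apply: ler_sum => i _; case: (X i w <= Y j w); rewrite ?ler01 ?lexx.
  pose rem j := p (F (Y j w) + Dj j w) - p (F (Y j w)) - p1 (F (Y j w)) * Dj j w.
  have rem_le j : `|rem j| <= S2 * Dj j w ^+ 2.
    have := taylor2_le dp dp1 p2_le (Fn01 j) (F01 (Y j w)).
    by rewrite FnE [_ + Dj j w - _]addrAC subrr add0r.
  (* The first-order term is the double average of [h = phi + ht]; averaging [phi (X i)] over [j]
     changes nothing. *)
  have T23 : m%:R^-1 * \sum_j p1 (F (Y j w)) * Dj j w = T2 w + T3 w.
    have -> : T2 w = (n%:R * m%:R)^-1 * \sum_(ij : 'I_n * 'I_m) phi (X ij.1 w).
      rewrite -(pair_big xpredT xpredT (fun i j => phi (X i w)))/=.
      under eq_bigr do rewrite sumr_const card_ord -mulr_natl.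
      by rewrite -mulr_sumr /T2 invfM -mulrA; congr (_ * _); rewrite mulrA mulVf// mul1r.
    rewrite /T3 -mulrDr -big_split/=.
    under [in RHS]eq_bigr do rewrite /ht addrC subrK.
    rewrite -(pair_big xpredT xpredT (fun i j => h (X i w, Y j w)))/= exchange_big/=.
    rewrite invfM [n%:R^-1 * _]mulrC -mulrA; congr (_ * _).
    rewrite mulr_sumr; apply: eq_bigr => j _.
    by rewrite /Dj mulrCA; congr (_ * _); rewrite mulr_sumr; apply: eq_bigr.
  have -> : m%:R^-1 * \sum_j p (Fn (X^~ w) (Y j w)) - I (fun z => p z * r z) =
      T1 w + T2 w + T3 w + m%:R^-1 * \sum_j rem j.
    rewrite -[T1 w + _ + _]addrA -T23 /T1 -!mulrDr -!big_split/=.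
    have -> : I (fun z => p z * r z) = m%:R^-1 * \sum_(j < m) mu.
      by rewrite sumr_const card_ord -[mu *+ m]mulr_natl mulrA mulVf// mul1r.
    rewrite -mulrBr -sumrB; congr (_ * _); apply: eq_bigr => j _.
    by rewrite FnE /rem /mu; ring.
  apply: (le_trans (ler_normD _ _)); rewrite lerD2l normrM ger0_norm ?invr_ge0 ?ler0n//.
  rewrite mulrCA ler_wpM2l ?invr_ge0 ?ler0n//.
  apply: (le_trans (ler_norm_sum _ _ _)); rewrite mulr_sumr.
  by apply: ler_sum => j _.
- split.
    apply: (@le_trans _ _ (E (fun w => 3 * (T1 w ^+ 2 + T2 w ^+ 2 + T3 w ^+ 2)))).
      apply: E_le; first by apply: bmfunX; apply: bmfunD => //; exact: bmfunD.
        apply: bmfunZ; apply: bmfunD; last exact: bmfunX.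
        by apply: bmfunD; exact: bmfunX.
      move=> w; have := sqr_ge0 (T1 w - T2 w); have := sqr_ge0 (T1 w - T3 w).
      have := sqr_ge0 (T2 w - T3 w); nra.
    have b12 : bm (fun w => T1 w ^+ 2 + T2 w ^+ 2) by apply: bmfunD; exact: bmfunX.
    rewrite (E_Z P 3 (bmfunD b12 (bmfunX 2 bT3))) (E_D P b12 (bmfunX 2 bT3)).
    rewrite (E_D P (bmfunX 2 bT1) (bmfunX 2 bT2)).
    by rewrite ler_pM2l// !lerD.
  rewrite (E_Z P S2 bRem) ler_wpM2l//.
  have bs : bm (fun w => \sum_j Dj j w ^+ 2) by apply: bmfun_sum => j; exact: bmfunX.
  rewrite (E_Z P m%:R^-1 bs) E_sum; last by move=> j; exact: bmfunX.
  rewrite mulrC ler_pdivrMr ?ltr0n//.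
  apply: (le_trans (ler_sum _ (fun j _ => E_Dj j))).
  by rewrite sumr_const card_ord mulr_natr.
Qed.

End empirical_noise.

(** * The exponential family *)

Section exponential_tilt.
Context {R : realType}.
Local Notation lam := (@lebesgue_measure R).
Local Notation I01 := (`[0%R, 1%R]%classic : set R).
Local Notation I f := (Rintegral lam I01 f).
Local Notation bm := (bmfun I01).

Lemma bmfun_expR (f : R -> R) : bm f -> bm (fun x => expR (f x)).
Proof.
move=> [mf [M fM]]; split; first exact: measurableT_comp.
exists (expR M) => x Dx; rewrite ger0_norm ?expR_ge0// ler_expR.
exact: (le_trans (ler_norm _) (fM x Dx)).
Qed.

Lemma I01_ge0 f : (forall x, 0 <= x <= 1 -> 0 <= f x) -> 0 <= I f.
Proof. by move=> f0; apply: Rintegral_ge0 => x /=; rewrite in_itv; exact: f0. Qed.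

(* Integrate (f - If) (B f - B (If)) >= 0. *)
Lemma chebyshev_association (f B : R -> R) : bm f -> bm (fun x => B (f x)) ->
  {homo B : x y / x <= y} -> I f * I (fun x => B (f x)) <= I (fun x => f x * B (f x)).
Proof.
move=> bf bB hB; set a := I f.
have -> : a * I (fun x => B (f x)) = I (fun x => a * B (f x) + (B a * f x - a * B a)).
  rewrite I01_D; [|exact: bmfunZ|by apply: bmfunB; [exact: bmfunZ|exact: bmfun_cst]].
  rewrite I01_Z// I01_B; [|exact: bmfunZ|exact: bmfun_cst].
  by rewrite I01_Z// I01_cst -/a; ring.
apply: I01_le.
- by apply: bmfunD; [exact: bmfunZ|by apply: bmfunB; [exact: bmfunZ|exact: bmfun_cst]].
- exact: bmfunM.
move=> x _; rewrite -subr_ge0.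
have -> : f x * B (f x) - (a * B (f x) + (B a * f x - a * B a)) =
  (f x - a) * (B (f x) - B a) by ring.
have [fa|af] := leP (f x) a.
  by rewrite mulr_le0// subr_le0// hB.
by rewrite mulr_ge0// subr_ge0 ?hB// ltW.
Qed.

(* Chebyshev's inequality is applied to the positive and to the negative part of
   [s]; since [expR s] has mean 1, both parts of [expR s - 1] have the same mass. *)
Lemma tilt_association (s : R -> R) : bm s -> I (fun x => expR (s x)) = 1 ->
  I (fun x => `|expR (s x) - 1|) * I (fun x => `|s x|) <=
  2 * I (fun x => s x * (expR (s x) - 1)).
Proof.
move=> bs e1.
pose sp x := (`|s x| + s x) / 2; pose sn x := (`|s x| - s x) / 2.
have bsp : bm sp.
  by apply: bmfunM; [apply: bmfunD => //; exact: bmfun_norm|exact: bmfun_cst].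
have bsn : bm sn.
  by apply: bmfunM; [apply: bmfunB => //; exact: bmfun_norm|exact: bmfun_cst].
pose bp x := expR (sp x) - 1; pose bn x := 1 - expR (- sn x).
have bbp : bm bp by apply: bmfunB; [exact: bmfun_expR|exact: bmfun_cst].
have bbn : bm bn.
  by apply: bmfunB; [exact: bmfun_cst|apply: bmfun_expR; exact: bmfunN].
have split_sign x : [/\ `|s x| = sp x + sn x, `|expR (s x) - 1| = bp x + bn x,
    expR (s x) - 1 = bp x - bn x &
    s x * (expR (s x) - 1) = sp x * bp x + sn x * bn x].
  rewrite /bp /bn /sp /sn; have [s0|s0] := ger0P (s x).
    have -> : (s x + s x) / 2 = s x by lra.
    rewrite subrr mul0r oppr0 expR0 ger0_norm ?subr_ge0 -?expR0 ?ler_expR//.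
    by split; rewrite ?expR0; lra.
  have -> : (- s x + s x) / 2 = 0 by lra.
  have -> : (- s x - s x) / 2 = - s x by lra.
  rewrite opprK expR0 subrr ltr0_norm; last by rewrite subr_lt0 -expR0 ltr_expR.
  by split; lra.
have mean_pn : I bp = I bn.
  apply/eqP; rewrite -subr_eq0 -I01_B//.
  have -> : (fun x => bp x - bn x) = (fun x => expR (s x) - 1).
    by apply/funext => x; have [_ _ ->] := split_sign x.
  by rewrite I01_B ?e1 ?I01_cst ?subrr//; [exact: bmfun_expR|exact: bmfun_cst].
have -> : I (fun x => `|expR (s x) - 1|) = 2 * I bp.
  have -> : (fun x => `|expR (s x) - 1|) = (fun x => bp x + bn x).
    by apply/funext => x; have [_ ->] := split_sign x.
  by rewrite I01_D// -mean_pn; lra.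
have -> : I (fun x => `|s x|) = I sp + I sn.
  have -> : (fun x => `|s x|) = (fun x => sp x + sn x).
    by apply/funext => x; have [->] := split_sign x.
  by rewrite I01_D.
have -> : I (fun x => s x * (expR (s x) - 1)) = I (fun x => sp x * bp x) + I (fun x => sn x * bn x).
  have -> : (fun x => s x * (expR (s x) - 1)) = (fun x => sp x * bp x + sn x * bn x).
    by apply/funext => x; have [_ _ _ ->] := split_sign x.
  by rewrite I01_D//; exact: bmfunM.
have hp := @chebyshev_association sp (fun t => expR t - 1) bsp bbp.
have hn := @chebyshev_association sn (fun t => 1 - expR (- t)) bsn bbn.
have {}hp : I sp * I bp <= I (fun x => sp x * bp x).
  by apply: hp => x y xy; rewrite lerD2r ler_expR.
have {}hn : I sn * I bn <= I (fun x => sn x * bn x).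
  by apply: hn => x y xy; rewrite lerD2l lerN2 ler_expR lerN2.
rewrite -mean_pn in hn.
rewrite -mulrA ler_pM2l// mulrDr [I bp * _]mulrC [I bp * I sn]mulrC.
exact: lerD.
Qed.

(** Both signs come from [1 + t <= e^t]: directly for [s >= 0], through [(1 - s) e^s <= 1] for
    [s < 0]. The factor is linear in [|s|], which keeps the signal bound polynomial rather than
    exponential in the size of [theta]. *)
Lemma sqr_le_tilt (s : R) : s ^+ 2 <= (1 + `|s|) * (s * (expR s - 1)).
Proof.
have [s0|s0] := leP 0 s.
  have e := expR_ge1Dx s; have h : s * s <= s * (expR s - 1) by rewrite ler_wpM2l//; lra.
  have := mulr_ge0 s0 (le_trans (mulr_ge0 s0 s0) h).
  by rewrite expr2 ger0_norm//; lra.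
have e := expR_ge1Dx (- s).
have e1 : expR (- s) * expR s = 1 by rewrite -expRD addrC subrr expR0.
have e0 : 0 < expR s := expR_gt0 s.
have h : (1 - s) * expR s <= 1.
  by rewrite -[leRHS]e1 ler_wpM2r// ltW.
have : - s * - s <= - s * ((1 - s) * (1 - expR s)).
  by rewrite ler_wpM2l//; nra.
by rewrite expr2 ltr0_norm//; lra.
Qed.

(** [(1 - x) e^x <= 1], while [(1 - x) (1 + x + 2 x^2) = 1 + x^2 (1 - 2 x) >= 1]. *)
Lemma expR_taylor2 (x : R) : x <= 2^-1 -> `|expR x - 1 - x| <= 2 * x ^+ 2.
Proof.
move=> x2; have e := expR_ge1Dx x; rewrite ger0_norm; last by lra.
have e' := expR_ge1Dx (- x).
have e1 : expR (- x) * expR x = 1 by rewrite -expRD addrC subrr expR0.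
have h : (1 - x) * expR x <= 1.
  by rewrite -[leRHS]e1 ler_wpM2r// expR_ge0.
have h2 : 1 <= (1 - x) * (1 + x + 2 * x ^+ 2).
  have -> : (1 - x) * (1 + x + 2 * x ^+ 2) = 1 + x ^+ 2 * (1 - 2 * x) by ring.
  by rewrite lerDl mulr_ge0 ?sqr_ge0//; lra.
have : expR x <= 1 + x + 2 * x ^+ 2.
  rewrite -(@ler_pM2l _ (1 - x)); first exact: le_trans h h2.
  by lra.
lra.
Qed.

Variables (dim : nat) (ps : 'I_dim -> R -> R) (theta : 'I_dim -> R) (S0 tmax : R).
Hypothesis dim_gt0 : (0 < dim)%N.
Hypothesis cps : forall k, continuous (ps k).
Hypothesis ps_le : forall k x, 0 <= x <= 1 -> `|ps k x| <= S0.
Hypothesis ps_mean : forall k, I (ps k) = 0.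
Hypothesis ps_orth : forall j k, I (fun x => ps j x * ps k x) = (j == k)%:R.
Hypothesis theta_le : forall k, `|theta k| <= tmax.

Let Q x := \sum_k theta k * ps k x.
Let N := I (fun x => expR (Q x)).
Let rh x := N^-1 * expR (Q x).
(** Sup bound for [Q] on [0,1]. It also bounds [|ln N|], so that the log-density [s = Q - ln N]
    stays within [2 kap]. *)
Let kap := dim%:R * S0 * tmax.
Let r1 := I (fun x => `|rh x - 1|).
Let mu k := I (fun x => ps k x * rh x).
Let k0 : 'I_dim := Ordinal dim_gt0.

Let bps k : bm (ps k). Proof. exact: continuous_bmfun. Qed.

Let S0_ge0 : 0 <= S0.
Proof. by apply: le_trans (normr_ge0 _) (ps_le k0 (_ : 0 <= 0 <= 1)); rewrite lexx ler01. Qed.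

Let tmax_ge0 : 0 <= tmax.
Proof. exact: le_trans (normr_ge0 _) (theta_le k0). Qed.

Let kap_ge0 : 0 <= kap.
Proof. by rewrite /kap !mulr_ge0. Qed.

Let bQ : bm Q.
Proof. by apply: bmfun_sum => k; exact: bmfunZ. Qed.

Let Q_le x : 0 <= x <= 1 -> `|Q x| <= kap.
Proof.
move=> x01; apply: (le_trans (ler_norm_sum _ _ _)).
apply: (@le_trans _ _ (\sum_(k < dim) S0 * tmax)).
  by apply: ler_sum => k _; rewrite normrM mulrC ler_pM// ps_le.
by rewrite sumr_const card_ord -[_ *+ dim]mulr_natl mulrA.
Qed.

Let I_Q : I Q = 0.
Proof.
rewrite /Q I01_sum; last by move=> k; exact: bmfunZ.
by rewrite big1// => k _; rewrite I01_Z// ps_mean mulr0.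
Qed.

Let I_Qps k : I (fun x => Q x * ps k x) = theta k.
Proof.
have -> : (fun x => Q x * ps k x) = (fun x => \sum_j theta j * (ps j x * ps k x)).
  by apply/funext => x; rewrite /Q mulr_suml; apply: eq_bigr => j _; rewrite mulrA.
rewrite I01_sum; last by move=> j; apply: bmfunZ; exact: bmfunM.
rewrite (bigD1 k)//= big1 => [|j jk]; rewrite I01_Z ?ps_orth ?eqxx ?mulr1 ?addr0//; try exact: bmfunM.
by rewrite (negbTE jk) mulr0.
Qed.

Let I_Qsqr : I (fun x => Q x ^+ 2) = \sum_k theta k ^+ 2.
Proof.
have -> : (fun x => Q x ^+ 2) = (fun x => \sum_k theta k * (Q x * ps k x)).
  apply/funext => x; rewrite expr2 {2}/Q mulr_sumr; apply: eq_bigr => k _.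
  by rewrite mulrCA.
rewrite I01_sum; last by move=> j; apply: bmfunZ; exact: bmfunM.
by apply: eq_bigr => k _; rewrite I01_Z ?I_Qps ?expr2//; exact: bmfunM.
Qed.

Let N_ge : expR (- kap) <= N.
Proof.
rewrite -[leLHS]I01_cst; apply: I01_le; [exact: bmfun_cst|exact: bmfun_expR|].
by move=> x /Q_le; rewrite ler_norml ler_expR => /andP[].
Qed.

Let N_le : N <= expR kap.
Proof.
rewrite -[leRHS]I01_cst; apply: I01_le; [exact: bmfun_expR|exact: bmfun_cst|].
by move=> x /Q_le; rewrite ler_norml ler_expR => /andP[].
Qed.

Let N_gt0 : 0 < N. Proof. exact: lt_le_trans (expR_gt0 _) N_ge. Qed.

Let s x := Q x - ln N.

Let rhE x : rh x = expR (s x).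
Proof. by rewrite /rh /s expRD expRN lnK// mulrC. Qed.

Let bs : bm s. Proof. by apply: bmfunB => //; exact: bmfun_cst. Qed.

Lemma bmfun_tilt : bm rh. Proof. by apply: bmfunZ; exact: bmfun_expR. Qed.

Lemma tilt_mass : I rh = 1.
Proof. by rewrite /rh I01_Z ?mulVf ?gt_eqF//; exact: bmfun_expR. Qed.

Let lnN_le : `|ln N| <= kap.
Proof.
rewrite ler_norml -ler_expR -[ln N <= _]ler_expR lnK//.
by rewrite N_ge N_le.
Qed.

Let s_le x : 0 <= x <= 1 -> `|s x| <= 2 * kap.
Proof.
by move=> x01; rewrite mulr_natl mulr2n (le_trans (ler_normB _ _))// lerD// Q_le.
Qed.

Lemma tilt_ge x : 0 <= x <= 1 -> expR (- (2 * kap)) <= rh x.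
Proof. by move=> /s_le; rewrite rhE ler_expR ler_norml => /andP[]. Qed.

(** Symmetrized Kullback-Leibler divergence between [rh] and the uniform density. *)
Let J := I (fun x => s x * (rh x - 1)).

Let bdiff : bm (fun x => rh x - 1).
Proof. by apply: bmfunB; [exact: bmfun_tilt|exact: bmfun_cst]. Qed.

(** The constant [ln N] drops out because [rh - 1] has mean 0, and [Q] itself has mean 0, so [J] is
    linear in the moments [mu k]. *)
Let J_le M : (forall k, `|mu k| <= M) -> J <= M * \sum_k `|theta k|.
Proof.
move=> muM.
have -> : J = \sum_k theta k * mu k.
  rewrite /J; have -> : (fun x => s x * (rh x - 1)) =
      (fun x => \sum_k theta k * (ps k x * rh x) - (Q x + ln N * (rh x - 1))).
    apply/funext => x.
    have -> : \sum_k theta k * (ps k x * rh x) = Q x * rh x.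
      by rewrite /Q mulr_suml; apply: eq_bigr => k _; rewrite mulrA.
    by rewrite /s; ring.
  have bk k : bm (fun x => ps k x * rh x) by apply: bmfunM => //; exact: bmfun_tilt.
  rewrite I01_B; last 2 first.
  - by apply: bmfun_sum => k; exact: bmfunZ.
  - by apply: bmfunD => //; exact: bmfunZ.
  rewrite I01_D//; last exact: bmfunZ.
  rewrite I_Q I01_Z// I01_B; [|exact: bmfun_tilt|exact: bmfun_cst].
  rewrite tilt_mass I01_cst subrr mulr0 addr0 subr0.
  rewrite I01_sum; last by move=> k; exact: bmfunZ.
  by apply: eq_bigr => k _; rewrite I01_Z.
rewrite mulr_sumr; apply: ler_sum => k _.
by rewrite (le_trans (ler_norm _))// normrM mulrC ler_wpM2r.
Qed.

(** Association gives [r1 |s|_1 <= 2 J <= 2 M dim tmax]. Conversely, the largest coefficient is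
    recovered by integrating [Q] against its basis function, so [tmax <= S0 |Q|_1 <= 2 S0 |s|_1].
    Combined, the two cancel [tmax], and with it the dependence on the size of [theta]. *)
Lemma tilt_distance_le M : 0 < tmax -> (exists k, `|theta k| = tmax) ->
  (forall k, `|mu k| <= M) -> r1 <= 4 * dim%:R * S0 * M.
Proof.
move=> t0 [k tk] muM.
have As : r1 * I (fun x => `|s x|) <= 2 * J.
  have e1 : I (fun x => expR (s x)) = 1.
    by rewrite -[RHS]tilt_mass; congr Rintegral; apply/funext => x; exact/esym/rhE.
  have rhs : rh = (fun x => expR (s x)) by apply/funext => x; exact: rhE.
  by rewrite /r1 /J rhs; exact: tilt_association bs e1.
(* [ln N] is minus the mean of [s], so adding it back costs at most another [|s|_1]. *)
have sQ : I (fun x => `|Q x|) <= 2 * I (fun x => `|s x|).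
  have lnE : ln N = - I s by rewrite /s I01_B ?I_Q ?I01_cst ?sub0r ?opprK//; exact: bmfun_cst.
  have lnle : `|ln N| <= I (fun x => `|s x|) by rewrite lnE normrN; exact: I01_norm.
  apply: (@le_trans _ _ (I (fun x => `|s x| + `|ln N|))).
    apply: I01_le; [exact: bmfun_norm|apply: bmfunD; [exact: bmfun_norm|exact: bmfun_cst]|].
    move=> x _; have -> : Q x = s x + ln N by rewrite /s subrK.
    exact: ler_normD.
  rewrite I01_D; [|exact: bmfun_norm|exact: bmfun_cst].
  by rewrite I01_cst; lra.
have tQ : tmax <= S0 * I (fun x => `|Q x|).
  rewrite -tk -(I_Qps k) -I01_Z; last exact: bmfun_norm.
  apply: (le_trans (I01_norm _)); first exact: bmfunM.
  apply: I01_le; [by apply: bmfun_norm; exact: bmfunM|by apply: bmfunZ; exact: bmfun_norm|].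
  by move=> x x01; rewrite normrM mulrC ler_wpM2r// ps_le.
have Jle : J <= M * (dim%:R * tmax).
  have M0 : 0 <= M := le_trans (normr_ge0 _) (muM k0).
  apply: (le_trans (J_le muM)); rewrite ler_wpM2l//.
  apply: (le_trans (ler_sum _ (fun k _ => theta_le k))).
  by rewrite sumr_const card_ord -[tmax *+ _]mulr_natl.
have r10 : 0 <= r1 by apply: I01_ge0.
have : r1 * tmax <= 4 * dim%:R * S0 * M * tmax.
  apply: (@le_trans _ _ (r1 * (S0 * (2 * I (fun x => `|s x|))))).
    rewrite ler_wpM2l// (le_trans tQ)// ler_wpM2l//.
  have -> : r1 * (S0 * (2 * I (fun x => `|s x|))) =
    2 * S0 * (r1 * I (fun x => `|s x|)) by ring.
  have -> : 4 * dim%:R * S0 * M * tmax = 2 * S0 * (2 * (M * (dim%:R * tmax))) by ring.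
  rewrite ler_wpM2l ?mulr_ge0// (le_trans As)// ler_wpM2l//.
by rewrite ler_pM2r.
Qed.

(** [|theta|_2^2 <= |s|_2^2 <= (1 + 2 kap) J <= (1 + 2 kap) M |theta|_1]. After squaring,
    Cauchy-Schwarz bounds [|theta|_1^2] by [dim |theta|_2^2], and one factor [|theta|_2^2]
    cancels. *)
Lemma tilt_signal_le M : (exists k, `|theta k| = tmax) ->
  (forall k, `|mu k| <= M) -> tmax ^+ 2 <= M ^+ 2 * dim%:R * (1 + 2 * kap) ^+ 2.
Proof.
move=> [k tk] muM.
have M0 : 0 <= M := le_trans (normr_ge0 _) (muM k0).
pose n2 := \sum_k theta k ^+ 2; pose n1 := \sum_k `|theta k|.
have n10 : 0 <= n1 by apply: sumr_ge0.
have n2J : n2 <= (1 + 2 * kap) * J.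
  have n2s : n2 <= I (fun x => s x ^+ 2).
    have -> : I (fun x => s x ^+ 2) = n2 + ln N ^+ 2.
      have -> : (fun x => s x ^+ 2) = (fun x => Q x ^+ 2 - (2 * ln N * Q x - ln N ^+ 2)).
        by apply/funext => x; rewrite /s; ring.
      have b2 : bm (fun x => 2 * ln N * Q x - ln N ^+ 2).
        by apply: bmfunB; [exact: bmfunZ|exact: bmfun_cst].
      rewrite I01_B//; last exact: bmfunX.
      rewrite I01_B; [|exact: bmfunZ|exact: bmfun_cst].
      by rewrite I01_Z// I_Q I01_cst I_Qsqr /n2; ring.
    by rewrite lerDl sqr_ge0.
  apply: (le_trans n2s); rewrite /J -I01_Z; last exact: bmfunM.
  apply: I01_le; [exact: bmfunX|by apply: bmfunZ; exact: bmfunM|].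
  move=> x x01; rewrite rhE; apply: (le_trans (sqr_le_tilt (s x))).
  rewrite ler_wpM2r ?lerD2l ?s_le//.
  have : 0 <= (1 + `|s x|) * (s x * (expR (s x) - 1)).
    by apply: le_trans (sqr_le_tilt _); exact: sqr_ge0.
  by rewrite pmulr_rge0// ltr_wpDr.
(* Cauchy-Schwarz, as the nonnegativity of the double sum of squared differences. *)
have n1n2 : n1 ^+ 2 <= dim%:R * n2.
  have h : 0 <= \sum_i \sum_j (`|theta i| - `|theta j|) ^+ 2.
    by apply: sumr_ge0 => i _; apply: sumr_ge0 => j _; exact: sqr_ge0.
  have e : \sum_i \sum_j (`|theta i| - `|theta j|) ^+ 2 = 2 * (dim%:R * n2) - 2 * n1 ^+ 2.
    have -> : \sum_i \sum_j (`|theta i| - `|theta j|) ^+ 2 =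
       \sum_i \sum_j (theta i ^+ 2 + theta j ^+ 2 - 2 * (`|theta i| * `|theta j|)).
      apply: eq_bigr => i _; apply: eq_bigr => j _.
      by rewrite sqrrB !real_normK ?num_real// -mulr_natl; ring.
    under eq_bigr do rewrite sumrB big_split/= sumr_const card_ord -mulr_sumr -mulr_sumr -/n1 -/n2.
    rewrite sumrB big_split/= sumr_const card_ord -!mulr_sumr -mulr_suml -/n1.
    rewrite sumrMnl -/n2 -[n2 *+ _]mulr_natl; ring.
  by lra.
have tn2 : tmax ^+ 2 <= n2.
  rewrite -tk real_normK ?num_real// /n2 (bigD1 k)//= lerDl.
  by apply: sumr_ge0 => j _; exact: sqr_ge0.
have kk : 0 < 1 + 2 * kap by rewrite ltr_wpDr// mulr_ge0.
have n20 : 0 <= n2 by apply: sumr_ge0 => j _; exact: sqr_ge0.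
have h1 : n2 <= (1 + 2 * kap) * (M * n1).
  by apply: (le_trans n2J); rewrite ler_pM2l// J_le.
have h2 : n2 ^+ 2 <= (1 + 2 * kap) ^+ 2 * (M ^+ 2 * (dim%:R * n2)).
  apply: (@le_trans _ _ (((1 + 2 * kap) * (M * n1)) ^+ 2)).
    by rewrite lerXn2r ?nnegrE// !mulr_ge0// ltW.
  rewrite !exprMn ler_wpM2l ?sqr_ge0// ler_wpM2l ?sqr_ge0//.
have [n2z|n2z] := eqVneq n2 0.
  apply: (le_trans tn2); rewrite n2z; apply: mulr_ge0; last exact: sqr_ge0.
  by apply: mulr_ge0; rewrite ?sqr_ge0 ?ler0n.
apply: (le_trans tn2); rewrite -(@ler_pM2r _ n2) ?lt_def ?n2z//.
by rewrite -expr2 (le_trans h2)// le_eqVlt; apply/orP; left; apply/eqP; ring.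
Qed.

(** [N mu k] is the integral of [ps k e^Q]; it equals [theta k] up to a quadratic term of size at
    most [2 S0 |Q|_2^2 <= 2 kap tmax]. The factor [1 - kap] pays for
    [N <= e^kap <= 1 / (1 - kap)]. *)
Lemma tilt_linear_le k : kap <= 2^-1 -> `|theta k| = tmax ->
  (1 - kap) * (1 - 2 * kap) * tmax <= `|mu k|.
Proof.
move=> kap2 tk.
pose e := I (fun x => ps k x * (expR (Q x) - 1 - Q x)).
have be : bm (fun x => expR (Q x) - 1 - Q x).
  by apply: bmfunB => //; apply: bmfunB; [exact: bmfun_expR|exact: bmfun_cst].
have NmuE : N * mu k = theta k + e.
  have bk : bm (fun x => ps k x * rh x) by apply: bmfunM => //; exact: bmfun_tilt.
  rewrite /mu -I01_Z// /e -(I_Qps k).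
  have -> : (fun x => N * (ps k x * rh x)) =
     (fun x => ps k x + (Q x * ps k x + ps k x * (expR (Q x) - 1 - Q x))).
    apply/funext => x; have -> : N * (ps k x * rh x) = ps k x * expR (Q x).
      by rewrite /rh mulrCA; congr (_ * _); rewrite mulrA mulfV ?mul1r// gt_eqF.
    by ring.
  rewrite I01_D//; last by apply: bmfunD; exact: bmfunM.
  by rewrite ps_mean add0r I01_D//; exact: bmfunM.
have e_le : `|e| <= 2 * kap * tmax.
  apply: (le_trans (I01_norm _)); first exact: bmfunM.
  apply: (@le_trans _ _ (I (fun x => 2 * S0 * Q x ^+ 2))).
    apply: I01_le; [by apply: bmfun_norm; exact: bmfunM|by apply: bmfunZ; exact: bmfunX|].
    move=> x x01; rewrite normrM [2 * S0]mulrC -mulrA ler_pM// ?ps_le//.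
    apply: expR_taylor2; apply: le_trans kap2.
    exact: (le_trans (ler_norm _) (Q_le x01)).
  rewrite I01_Z ?I_Qsqr; last exact: bmfunX.
  have n2 : \sum_k theta k ^+ 2 <= dim%:R * tmax ^+ 2.
    apply: (@le_trans _ _ (\sum_(k < dim) tmax ^+ 2)).
      by apply: ler_sum => j _; rewrite -[theta j ^+ 2]real_normK ?num_real// lerXn2r ?nnegrE.
    by rewrite sumr_const card_ord -[_ *+ dim]mulr_natl.
  have -> : 2 * kap * tmax = 2 * S0 * (dim%:R * tmax ^+ 2) by rewrite /kap; ring.
  by rewrite ler_wpM2l// mulr_ge0.
have h1 : (1 - 2 * kap) * tmax <= `|N * mu k|.
  rewrite NmuE; have := ler_normB (theta k + e) e; rewrite addrK tk; lra.
rewrite normrM (ger0_norm (ltW N_gt0)) in h1.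
have h2 : (1 - kap) * N <= 1.
  have := expR_ge1Dx (- kap) => h.
  apply: (@le_trans _ _ (expR (- kap) * N)); first by rewrite ler_wpM2r// ltW.
  apply: (@le_trans _ _ (expR (- kap) * expR kap)); first by rewrite ler_wpM2l// expR_ge0.
  by rewrite -expRD addNr expR0.
rewrite -mulrA; apply: (@le_trans _ _ ((1 - kap) * (N * `|mu k|))).
  by rewrite ler_wpM2l//; lra.
by rewrite mulrA -[leRHS]mul1r ler_wpM2r.
Qed.

End exponential_tilt.

(** * The two orthonormal systems *)

Section trigonometric_system.
Context {R : realType}.
Local Notation lam := (@lebesgue_measure R).
Local Notation I01 := (`[0%R, 1%R]%classic : set R).
Local Notation I f := (Rintegral lam I01 f).
Local Notation bm := (bmfun I01).

Let cos_scale_derive (a x : R) :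
  is_derive x (1 : R) (fun z => cos (a * z)) (- a * sin (a * x)).
Proof.
have d1 : is_derive x (1 : R) (fun z : R => a * z) a.
  by apply: is_derive_eq; rewrite /GRing.scale/= mulr1.
have -> : - a * sin (a * x) = - sin (a * x) * a by ring.
exact: (@is_derive1_comp _ cos (fun z : R => a * z)).
Qed.

Let sin_scale_derive (a x : R) :
  is_derive x (1 : R) (fun z => sin (a * z)) (a * cos (a * x)).
Proof.
have d1 : is_derive x (1 : R) (fun z : R => a * z) a.
  by apply: is_derive_eq; rewrite /GRing.scale/= mulr1.
have -> : a * cos (a * x) = cos (a * x) * a by ring.
exact: (@is_derive1_comp _ sin (fun z : R => a * z)).
Qed.

Lemma sin_pi_nat (k : nat) : sin (pi * k%:R) = 0 :> R.
Proof.
elim: k => [|k ih]; first by rewrite mulr0 sin0.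
by rewrite -natr1 mulrDr mulr1 sinD ih mul0r sinpi mulr0 addr0.
Qed.

Lemma cos_scale_continuous (a : R) : continuous (fun z : R => cos (a * z)).
Proof. exact: (continuous_of_derive (cos_scale_derive a)). Qed.

Lemma integral_cos (k : nat) : (0 < k)%N -> I (fun z => cos (pi * k%:R * z)) = 0.
Proof.
move=> k0; set a := pi * k%:R.
have a0 : a != 0 by rewrite mulf_neq0 ?gt_eqF ?pi_gt0 ?ltr0n.
have dS x : is_derive x (1 : R) (fun z => a^-1 * sin (a * z)) (cos (a * x)).
  have := sin_scale_derive a x => ?; apply: is_derive_eq.
  by rewrite /GRing.scale/= mulrA mulVf// mul1r.
rewrite (continuous_FTC (@cos_scale_continuous a) dS ler01).
by rewrite mulr1 mulr0 sin0 mulr0 subr0 sin_pi_nat mulr0.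
Qed.

Lemma integral_cos_cos (i j : nat) : (0 < i)%N -> (0 < j)%N ->
  I (fun z => cos (pi * i%:R * z) * cos (pi * j%:R * z)) = (i == j)%:R / 2.
Proof.
wlog ij : i j / (i <= j)%N.
  move=> hw i0 j0; case/orP: (leq_total i j) => [ij|ji]; first exact: hw.
  by rewrite eq_sym -(hw j i)//; congr Rintegral; apply/funext => z; rewrite mulrC.
move=> i0 j0.
have bc k : bm (fun z => cos (pi * k%:R * z)).
  by apply: continuous_bmfun; exact: cos_scale_continuous.
have -> : (fun z : R => cos (pi * i%:R * z) * cos (pi * j%:R * z)) =
  (fun z : R => 2^-1 * (cos (pi * (j + i)%:R * z) + cos (pi * (j - i)%:R * z))).
  apply/funext => z.
  have -> : pi * (j + i)%:R * z = pi * j%:R * z + pi * i%:R * z by rewrite natrD; ring.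
  have -> : pi * (j - i)%:R * z = pi * j%:R * z - pi * i%:R * z by rewrite natrB//; ring.
  by rewrite cosD cosB; field.
rewrite I01_Z; last exact: bmfunD.
rewrite I01_D// integral_cos ?addn_gt0 ?j0// add0r mulrC; congr (_ * _).
have [->|ne] := eqVneq i j.
  rewrite subnn; have -> : (fun z : R => cos (pi * 0%:R * z)) = (fun=> 1).
    by apply/funext => z; rewrite mulr0 mul0r cos0.
  by rewrite I01_cst.
by rewrite integral_cos// subn_gt0 ltn_neqAle ne.
Qed.

Lemma trig_mean k : (0 < k)%N -> I (psi Trig k) = 0.
Proof.
move=> k0; rewrite /psi I01_Z ?integral_cos ?mulr0//.
by apply: continuous_bmfun; exact: cos_scale_continuous.
Qed.

Lemma trig_orth i j : (0 < i)%N -> (0 < j)%N ->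
  I (fun z => psi Trig i z * psi Trig j z) = (i == j)%:R.
Proof.
move=> i0 j0.
have bc k : bm (fun z => cos (pi * k%:R * z)).
  by apply: continuous_bmfun; exact: cos_scale_continuous.
have -> : (fun z => psi Trig i z * psi Trig j z) =
  (fun z => 2 * (cos (pi * i%:R * z) * cos (pi * j%:R * z))) :> (R -> R).
  by apply/funext => z; rewrite /psi mulrACA -expr2 sqr_sqrtr.
rewrite I01_Z; last by apply: bmfunM; exact: bc.
by rewrite integral_cos_cos// mulrC divfK// pnatr_eq0.
Qed.

Lemma sqrt2_le2 : Num.sqrt 2 <= 2 :> R.
Proof. by rewrite -[leRHS]ger0_norm// -sqrtr_sqr ler_wsqrtr// -natrX ler_nat. Qed.

Lemma pi_le4 : pi <= 4 :> R.
Proof. by have := @pihalf_lt2 R; lra. Qed.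

(** The constants come from [sqrt 2 <= 2] and [pi <= 4]. *)
Lemma trig_smooth k d : (0 < k <= d)%N -> exists p1 p2 : R -> R,
  [/\ forall x, is_derive x (1 : R) (psi Trig k) (p1 x),
      forall x, is_derive x (1 : R) p1 (p2 x),
      forall x : R, `|psi Trig k x| <= 2,
      forall x, `|p1 x| <= 8 * d%:R &
      forall x, `|p2 x| <= 32 * d%:R ^+ 2].
Proof.
move=> /andP[k0 kd]; set a : R := pi * k%:R; set c : R := Num.sqrt 2.
have kd' : k%:R <= d%:R :> R by rewrite ler_nat.
have a0 : 0 <= a by rewrite mulr_ge0 ?pi_ge0.
have a4 : a <= 4 * d%:R by rewrite ler_pM ?pi_ge0 ?pi_le4.
have c0 : 0 <= c by exact: sqrtr_ge0.
have c2 : c <= 2 := sqrt2_le2.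
have sin1 x : `|sin x| <= 1 :> R by rewrite ler_norml sin_geN1 sin_le1.
have cos1 x : `|cos x| <= 1 :> R by rewrite ler_norml cos_geN1 cos_le1.
have ca : c * a <= 8 * d%:R.
  have -> : 8 * d%:R = 2 * (4 * d%:R) :> R by ring.
  exact: ler_pM.
exists (fun x => - (c * a) * sin (a * x)), (fun x => - (c * a ^+ 2) * cos (a * x)); split=> x.
- have := cos_scale_derive a x => ?; apply: is_derive_eq.
  by rewrite /GRing.scale/= /c; ring.
- have := sin_scale_derive a x => ?; apply: is_derive_eq.
  by rewrite /GRing.scale/=; ring.
- by rewrite /psi normrM (ger0_norm c0) -[leRHS]mulr1 ler_pM.
- have ca0 : 0 <= c * a by exact: mulr_ge0.
  by rewrite normrM normrN (ger0_norm ca0) -[leRHS]mulr1; exact: ler_pM.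
- have ca0 : 0 <= c * a ^+ 2 by rewrite mulr_ge0 ?sqr_ge0.
  rewrite normrM normrN (ger0_norm ca0) -[leRHS]mulr1; apply: ler_pM => //.
  have -> : 32 * d%:R ^+ 2 = 2 * (4 * d%:R) ^+ 2 :> R by ring.
  by rewrite ler_pM ?sqr_ge0// lerXn2r ?nnegrE// mulr_ge0.
Qed.

End trigonometric_system.

Section legendre_system.
Context {R : realType}.
Local Notation lam := (@lebesgue_measure R).
Local Notation I01 := (`[0%R, 1%R]%classic : set R).
Local Notation I f := (Rintegral lam I01 f).
Local Notation bm := (bmfun I01).

Let u : {poly R} := 'X^2 - 'X.
Let u' : {poly R} := 2%:R *: 'X - 1.

Let deriv_u : u^`() = u'.
Proof. by rewrite /u /u' derivB derivXn derivX/= expr1 scaler_nat. Qed.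

Let deriv_u' : u'^`() = 2%:P.
Proof. by rewrite /u' derivB derivZ derivX derivC subr0 alg_polyC. Qed.

Let u'_sqr : u' ^+ 2 = 4%:P * u + 1.
Proof. by rewrite /u' /u -mul_polyC polyC_natr; ring. Qed.

Let w k r := (u ^+ k)^`(r).

(** Differentiate [u (u^k)' = k u' u^k] exactly [r + 1] times. At [r = k] this is Legendre's
    equation on [0,1], at [r = k + s] the equation of the [s]-th derivative of the Legendre
    polynomial. *)
Lemma rodrigues_ode k r :
  u * w k r.+2 + (r.+1%:R - k%:R) *: (u' * w k r.+1) +
  (r.+1%:R * (r%:R - 2 * k%:R)) *: w k r = 0.
Proof.
have w1 : u * w k 1 = k%:R *: (u' * w k 0).
  rewrite /w derivn1 derivn0 deriv_exp deriv_u; case: k => [|k].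
    by rewrite mulr0n mulr0 scale0r.
  by rewrite exprS -scaler_nat -!scalerAr; congr (_ *: _); ring.
have dw s : (w k s)^`() = w k s.+1 by rewrite /w derivnS.
elim: r => [|r ih].
  have := congr1 (@deriv R) w1.
  rewrite derivZ !derivM !dw deriv_u deriv_u' => /eqP.
  rewrite -subr_eq0 => /eqP e.
  rewrite -[RHS]e -!mul_polyC; ring.
have := congr1 (@deriv R) ih.
rewrite deriv0 !derivD !derivZ !derivM !dw deriv_u deriv_u' => <-.
rewrite -!mul_polyC; ring.
Qed.

Let p k r (z : R) := (w k r).[z].

Let p_derive k r x : is_derive x (1 : R) (p k r) (p k r.+1 x).
Proof. by rewrite /p /w derivnS; exact: is_derive_poly. Qed.

Let p_ode k r z :
  (z ^+ 2 - z) * p k r.+2 z + (r.+1%:R - k%:R) * ((2 * z - 1) * p k r.+1 z) +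
  r.+1%:R * (r%:R - 2 * k%:R) * p k r z = 0.
Proof.
have := congr1 (fun q : {poly R} => q.[z]) (rodrigues_ode k r).
by rewrite /= /u /u' !hornerE.
Qed.

(** Each derivative removes one factor [u]; at an endpoint only the term that differentiates [u]
    survives, whence the falling factorial. Endpoints are encoded as roots of [e^2 - e], so that 0
    and 1 are treated together. Orders below [k] vanish there, and order [k] gives [k!] up to
    sign. *)
Let factor_power k r : (r <= k)%N -> exists q : {poly R}, w k r = u ^+ (k - r) * q /\
  forall e : R, e ^+ 2 - e = 0 -> q.[e] = (k ^_ r)%:R * (2 * e - 1) ^+ r.
Proof.
elim: r => [|r ih] rk.
  exists 1; rewrite subn0 mulr1 /w derivn0; split=> // e _.
  by rewrite hornerC ffactn0 expr0 mulr1.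
have [q [wq qe]] := ih (ltnW rk).
exists ((k - r)%:R *: (u' * q) + u * q^`()); split.
  rewrite /w derivnS -/(w k r) wq derivM deriv_exp deriv_u.
  have -> : (k - r = (k - r.+1).+1)%N by rewrite subnSK.
  by rewrite /= exprS -scaler_nat mulrDr -!scalerAr -!scalerAl; congr (_ *: _ + _); ring.
move=> e e0; rewrite !hornerE qe//= !hornerE.
have -> : e ^+ 2 - e = 0 by [].
rewrite mul0r addr0 ffactnSr natrM exprS /u' !hornerE /=; ring.
Qed.

Let p_end k r e : (r < k)%N -> e ^+ 2 - e = 0 -> p k r e = 0.
Proof.
move=> rk e0; have [q [wq _]] := factor_power (ltnW rk).
by rewrite /p wq hornerM horner_exp /u !hornerE e0 expr0n subn_eq0 leqNgt rk mul0r.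
Qed.

Let u'_end (e : R) : e ^+ 2 - e = 0 -> `|2 * e - 1| = 1.
Proof.
move=> e0; apply/eqP; rewrite -(@eqrXn2 _ 2)// ?normr_ge0// real_normK ?num_real// expr1n.
have -> : (2 * e - 1) ^+ 2 = 4 * (e ^+ 2 - e) + 1 by ring.
by rewrite e0 mulr0 add0r.
Qed.

Let p_end_top k e : e ^+ 2 - e = 0 -> `|p k k e| = k`!%:R.
Proof.
move=> e0; have [q [wq qe]] := factor_power (leqnn k).
rewrite /p wq subnn expr0 mul1r qe// ffactnn normrM normr_nat.
have -> : `|(2 * e - 1) ^+ k| = 1; last by rewrite mulr1.
by rewrite normrX u'_end// expr1n.
Qed.

(* The energy N y^2 + (z - z^2) y'^2 has derivative (2s+1)(2z-1) y'^2, so on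
   [0,1] it is largest at an endpoint. *)
Let p_max_lt k s B : (s < k)%N ->
  (forall e : R, e ^+ 2 - e = 0 -> `|p k (k + s) e| <= B) ->
  forall z, 0 <= z <= 1 -> `|p k (k + s) z| <= B.
Proof.
move=> sk endB z /andP[z0 z1].
set y := p k (k + s); pose y1 := p k (k + s).+1; pose y2 := p k (k + s).+2.
pose N : R := (k%:R + s%:R + 1) * (k%:R - s%:R).
have N0 : 0 < N.
  apply: mulr_gt0; last by rewrite subr_gt0 ltr_nat.
  by rewrite -addrA ltr_wpDl// ltr_wpDl.
have ode x : (x - x ^+ 2) * y2 x = (s%:R + 1) * (2 * x - 1) * y1 x - N * y x.
  have := p_ode k (k + s) x; rewrite -/y -/(y1 x) -/(y2 x) -!natr1 natrD /N => h.
  apply/eqP; rewrite -subr_eq0 -oppr_eq0; apply/eqP; rewrite -[RHS]h; ring.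
pose en x := N * y x ^+ 2 + (x - x ^+ 2) * y1 x ^+ 2.
have den x : is_derive x (1 : R) en ((2 * s%:R + 1) * (2 * x - 1) * y1 x ^+ 2).
  have dy : is_derive x (1 : R) y (y1 x) by exact: p_derive.
  have dy1 : is_derive x (1 : R) y1 (y2 x) by exact: p_derive.
  apply: is_derive_eq; rewrite /GRing.scale/=.
  transitivity (2 * N * y x * y1 x + (1 - 2 * x) * y1 x ^+ 2 + 2 * y1 x * ((x - x ^+ 2) * y2 x)).
    by ring.
  by rewrite ode; ring.
have cen : continuous en := continuous_of_derive den.
have yle : N * y z ^+ 2 <= en z by rewrite lerDl mulr_ge0 ?sqr_ge0// subr_ge0 expr2 ler_piMl.
have B0 : 0 <= B by apply: le_trans (normr_ge0 _) (endB 0 _); rewrite expr0n subr0.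
have enB e : e ^+ 2 - e = 0 -> en e <= N * B ^+ 2.
  move=> e0; rewrite /en; have -> : e - e ^+ 2 = 0 by rewrite -opprB e0 oppr0.
  rewrite mul0r addr0 ler_pM2l// -[y e ^+ 2]real_normK ?num_real//.
  by rewrite lerXn2r ?nnegrE// endB.
have le2 : N * y z ^+ 2 <= N * B ^+ 2.
  apply: (le_trans yle).
  have [zh|zh] := leP z (2^-1).
    apply: le_trans (enB 0 _); last by rewrite expr0n subr0.
    apply: (@ler0_derive1_le_cc _ en 0 (2^-1)) => //.
    - move=> x; rewrite in_itv/= => /andP[_ xh]; rewrite derive1E derive_val.
      by rewrite mulr_le0_ge0 ?sqr_ge0// mulr_ge0_le0//; lra.
    - exact: continuous_subspaceT.
    - by rewrite in_itv/= z0.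
    - by rewrite in_itv/= lexx invr_ge0 ler0n.
  apply: le_trans (enB 1 _); last by rewrite expr1n subrr.
  apply: (@ger0_derive1_le_cc _ en (2^-1) 1) => //.
  - move=> x; rewrite in_itv/= => /andP[xh _]; rewrite derive1E derive_val.
    by rewrite mulr_ge0 ?sqr_ge0// mulr_ge0//; lra.
  - exact: continuous_subspaceT.
  - by rewrite in_itv/= (ltW zh).
  - by rewrite in_itv/= lexx invf_le1 ?ler1n.
move: le2; rewrite ler_pM2l// -[y z ^+ 2]real_normK ?num_real//.
by rewrite ler_sqr ?nnegrE.
Qed.

Let size_u : size u = 3%N.
Proof. by rewrite /u size_polyDl ?size_polyXn// size_polyN size_polyX. Qed.

Let size_uX k : size (u ^+ k) = (2 * k).+1.
Proof.
have u0 : u != 0 by rewrite -size_poly_eq0 size_u.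
have := size_exp u k; rewrite size_u /= => <-.
by rewrite prednK// lt0n size_poly_eq0 expf_neq0.
Qed.

Let w_eq0 k r : (2 * k < r)%N -> w k r = 0.
Proof. by move=> kr; apply: derivn_poly0; rewrite size_uX. Qed.

(** The energy has a positive coefficient only for [s < k]. For [s >= k] the order [k + s] is at
    least the degree [2k] of [u^k], so the derivative is constant and equals its value at 0. *)
Let p_max k s B : (forall e : R, e ^+ 2 - e = 0 -> `|p k (k + s) e| <= B) ->
  forall z, 0 <= z <= 1 -> `|p k (k + s) z| <= B.
Proof.
move=> endB; have [sk|ks] := ltnP s k; first exact: p_max_lt.
move=> z z01; have e0 : 0 ^+ 2 - 0 = 0 :> R by rewrite expr0n subr0.
have d0 x : 0 <= x <= 1 -> `|p k (k + s).+1 x| <= 0.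
  by move=> _; rewrite /p w_eq0 ?horner0 ?normr0// ltnS mul2n -addnn leq_add2l.
have z00 : 0 <= (0 : R) <= 1 by rewrite lexx ler01.
have := increment_le (p_derive k (k + s)) d0 z01 z00.
rewrite mul0r normr_le0 subr_eq0 => /eqP ->; exact: endB.
Qed.

(** At an endpoint the leading coefficient of the differential equation vanishes, and what is left
    expresses a derivative by the preceding one. *)
Let p_end_top1 k e : e ^+ 2 - e = 0 -> `|p k (k + 1) e| <= k`!%:R * (k%:R * (k%:R + 1)).
Proof.
move=> e0; have := p_ode k k e; rewrite e0 mul0r add0r addn1 -natr1 => h.
have h1 : (2 * e - 1) * p k k.+1 e = (k%:R + 1) * k%:R * p k k e.
  by apply/eqP; rewrite -subr_eq0; apply/eqP; rewrite -[RHS]h; ring.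
have := congr1 (fun x : R => `|x|) h1; rewrite /= normrM u'_end// mul1r => ->.
rewrite normrM p_end_top// ger0_norm ?mulr_ge0// ?addr_ge0//.
by rewrite mulrC [_ * k%:R]mulrC.
Qed.

Let p_end_top2 k e : (0 < k)%N -> e ^+ 2 - e = 0 ->
  `|p k (k + 2) e| <= k`!%:R * (k%:R * (k%:R + 1)) ^+ 2.
Proof.
move=> k0 e0; have := p_ode k k.+1 e; rewrite e0 mul0r add0r addn2 -!natr1 => h.
have h1 : 2 * ((2 * e - 1) * p k k.+2 e) = (k%:R + 2) * (k%:R - 1) * p k k.+1 e.
  by apply/eqP; rewrite -subr_eq0; apply/eqP; rewrite -[RHS]h; ring.
have k1 : 1 <= k%:R :> R by rewrite ler1n.
have := congr1 (fun x : R => `|x|) h1; rewrite /= !normrM u'_end// mul1r => h2.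
have h3 := p_end_top1 k e0; rewrite addn1 in h3.
have h4 : `|k%:R + 2| * `|k%:R - 1| <= 2 * (k%:R * (k%:R + 1)) :> R.
  by rewrite !ger0_norm ?subr_ge0 ?addr_ge0//; nra.
have : 2 * `|p k k.+2 e| <= 2 * (k`!%:R * (k%:R * (k%:R + 1)) ^+ 2).
  rewrite -[X in X * _ <= _](@ger0_norm _ 2)// h2.
  apply: (@le_trans _ _ (2 * (k%:R * (k%:R + 1)) * (k`!%:R * (k%:R * (k%:R + 1))))).
    by apply: ler_pM => //; rewrite mulr_ge0.
  by rewrite le_eqVlt; apply/orP; left; apply/eqP; ring.
by rewrite ler_pM2l.
Qed.

Let coef k : R := Num.sqrt (2 * k%:R + 1) / k`!%:R.

Let psiE k : psi Legendre k = (fun z => coef k * p k k z) :> (R -> R).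
Proof. by []. Qed.

(** [sqrt (2 k + 1) <= 2 sqrt d], and each further derivative costs at most [k (k + 1) <= 2 d^2] at
    the endpoints, where [p_max] reduces the sup norms. *)
Lemma legendre_smooth k d : (0 < k <= d)%N -> exists p1 p2 : R -> R,
  [/\ forall x, is_derive x (1 : R) (psi Legendre k) (p1 x),
      forall x, is_derive x (1 : R) p1 (p2 x),
      forall x : R, 0 <= x <= 1 -> `|psi Legendre k x| <= 2 * Num.sqrt d%:R,
      forall x, 0 <= x <= 1 -> `|p1 x| <= 4 * d%:R ^+ 2 * Num.sqrt d%:R &
      forall x, 0 <= x <= 1 -> `|p2 x| <= 8 * d%:R ^+ 4 * Num.sqrt d%:R].
Proof.
move=> /andP[k0 kd].
have c0 : 0 <= coef k by rewrite divr_ge0 ?sqrtr_ge0.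
have kd' : k%:R <= d%:R :> R by rewrite ler_nat.
have k1 : 1 <= k%:R :> R by rewrite ler1n.
have f0 : 0 < k`!%:R :> R by rewrite ltr0n fact_gt0.
have ck : coef k * k`!%:R <= 2 * Num.sqrt d%:R.
  rewrite /coef divfK ?gt_eqF//.
  have -> : 2 * Num.sqrt d%:R = Num.sqrt (2 ^+ 2 * d%:R) :> R.
    by rewrite sqrtrM ?sqr_ge0// sqrtr_sqr ger0_norm.
  by apply: ler_wsqrtr; rewrite -natrX; lra.
have kk : k%:R * (k%:R + 1) <= 2 * d%:R ^+ 2 :> R by nra.
have kk0 : 0 <= k%:R * (k%:R + 1) :> R by rewrite mulr_ge0// addr_ge0.
have s0 : 0 <= Num.sqrt d%:R :> R by exact: sqrtr_ge0.
have bnd s B : (forall e : R, e ^+ 2 - e = 0 -> `|p k (k + s) e| <= k`!%:R * B) -> 0 <= B ->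
    forall z, 0 <= z <= 1 -> `|coef k * p k (k + s) z| <= 2 * Num.sqrt d%:R * B.
  move=> h B0 z z01; rewrite normrM ger0_norm//.
  apply: (@le_trans _ _ (coef k * (k`!%:R * B))); first by rewrite ler_wpM2l// (p_max h).
  by rewrite mulrA ler_wpM2r.
exists (fun x => coef k * p k (k + 1) x), (fun x => coef k * p k (k + 2) x); split.
- move=> x; rewrite psiE addn1; have := p_derive k k x => ?.
  by apply: is_derive_eq.
- move=> x; rewrite addn1 addn2; have := p_derive k k.+1 x => ?.
  by apply: is_derive_eq.
- have h0 e : e ^+ 2 - e = 0 -> `|p k (k + 0) e| <= k`!%:R * 1.
    by move=> e0; rewrite addn0 p_end_top// mulr1.
  by move=> x x01; rewrite psiE; have := bnd 0%N 1 h0 ler01 x x01; rewrite addn0 mulr1.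
- move=> x x01; apply: (le_trans (bnd _ _ (@p_end_top1 k) kk0 x x01)).
  have -> : 4 * d%:R ^+ 2 * Num.sqrt d%:R = 2 * Num.sqrt d%:R * (2 * d%:R ^+ 2) :> R by ring.
  by rewrite ler_wpM2l// mulr_ge0.
- move=> x x01; apply: (le_trans (bnd _ _ (fun e => @p_end_top2 k e k0) (sqr_ge0 _) x x01)).
  have -> : 8 * d%:R ^+ 4 * Num.sqrt d%:R = 2 * Num.sqrt d%:R * (2 * d%:R ^+ 2) ^+ 2 :> R by ring.
  by rewrite ler_wpM2l ?mulr_ge0// lerXn2r ?nnegrE// mulr_ge0// sqr_ge0.
Qed.

Let Ip (q : {poly R}) := I (fun z => q.[z]).

Let bpoly (q : {poly R}) : bm (fun z => q.[z]).
Proof. by apply: continuous_bmfun; exact: continuous_horner. Qed.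

Let Ip0 : Ip 0 = 0.
Proof.
rewrite /Ip; have -> : (fun z : R => (0 : {poly R}).[z]) = (fun=> 0).
  by apply/funext => z; rewrite horner0.
exact: I01_cst.
Qed.

Let Ip1 : Ip 1 = 1.
Proof.
rewrite /Ip; have -> : (fun z : R => (1 : {poly R}).[z]) = (fun=> 1).
  by apply/funext => z; rewrite hornerC.
exact: I01_cst.
Qed.

Let Ip_deriv q : Ip q^`() = q.[1] - q.[0].
Proof. exact: (continuous_FTC (@continuous_horner _ q^`()) (@is_derive_poly _ q) ler01). Qed.

Let IpD q1 q2 : Ip (q1 + q2) = Ip q1 + Ip q2.
Proof. by rewrite /Ip -I01_D//; congr Rintegral; apply/funext => z; rewrite hornerD. Qed.

Let IpZ c q : Ip (c *: q) = c * Ip q.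
Proof. by rewrite /Ip -I01_Z//; congr Rintegral; apply/funext => z; rewrite hornerZ. Qed.

(** Integration by parts [j] times; each boundary term contains a derivative of [u^k] of order below
    [k], which vanishes at 0 and 1. *)
Let Ip_rodrigues k j q : (j <= k)%N ->
  Ip (w k k * q) = (-1) ^+ j * Ip (w k (k - j) * q^`(j)).
Proof.
elim: j => [|j ih] jk; first by rewrite subn0 expr0 mul1r.
rewrite ih 1?ltnW// exprS -mulrA mulrCA; congr (_ * _).
have kj : (k - j = (k - j.+1).+1)%N by rewrite subnSK.
have kj' : (k - j.+1 < k)%N by rewrite ltn_subrL (leq_ltn_trans _ jk).
have := Ip_deriv (w k (k - j.+1) * q^`(j)).
have dw : (w k (k - j.+1))^`() = w k (k - j.+1).+1 by rewrite /w derivnS.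
rewrite derivM -derivnS dw kj IpD !hornerM.
rewrite -/(p k (k - j.+1) 1) -/(p k (k - j.+1) 0) !p_end ?expr1n ?expr0n ?subrr// !mul0r subrr.
by rewrite mulN1r => /eqP; rewrite addr_eq0 => /eqP.
Qed.

(** The Beta integral [B(k+1, k+1)], with a sign because [u = -(z - z^2)]. The recursion integrates
    the derivative of [u' u^(k+1)], a product that vanishes at both ends, and uses
    [u'^2 = 4 u + 1]. *)
Let Ip_uX k : Ip (u ^+ k) = (-1) ^+ k * (k`!%:R ^+ 2 / (2 * k).+1`!%:R).
Proof.
elim: k => [|k ih].
  by rewrite expr0 Ip1 expr0 mul1r expr1n divr1.
have := Ip_deriv (u' * u ^+ k.+1).
have -> : (u' * u ^+ k.+1)^`() = (4 * k%:R + 6) *: u ^+ k.+1 + (k%:R + 1) *: u ^+ k.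
  rewrite derivM deriv_exp deriv_u deriv_u' /=.
  have -> : u' * (u' * u ^+ k *+ k.+1) = (u' ^+ 2 * u ^+ k) *+ k.+1 by ring.
  by rewrite u'_sqr -!mul_polyC exprS; ring.
have u0 : u.[0] = 0 by rewrite /u !hornerE expr0n subr0.
have u1 : u.[1] = 0 by rewrite /u !hornerE expr1n subrr.
rewrite !hornerM !horner_exp u0 u1 expr0n/= !mulr0 subrr IpD !IpZ ih => e.
have n6 : 4 * k%:R + 6 != 0 :> R by rewrite gt_eqF// ltr_wpDl// mulr_ge0.
apply: (mulfI n6).
have {e}-> : (4 * k%:R + 6) * Ip (u ^+ k.+1) =
    - ((k%:R + 1) * ((-1) ^+ k * (k`!%:R ^+ 2 / (2 * k).+1`!%:R))).
  by apply/eqP; rewrite -addr_eq0; apply/eqP.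
have -> : (2 * k.+1).+1`!%:R =
    (2 * k%:R + 3) * (2 * k%:R + 2) * (2 * k%:R + 1) * (2 * k)`!%:R :> R.
  have -> : (2 * k.+1).+1 = (2 * k).+3 by rewrite mulnS.
  rewrite !factS !natrM; set f := (2 * k)`!%:R.
  have -> : (2 * k).+3%:R = 2 * k%:R + 3 :> R by rewrite -addn3 natrD natrM.
  have -> : (2 * k).+2%:R = 2 * k%:R + 2 :> R by rewrite -addn2 natrD natrM.
  have -> : (2 * k).+1%:R = 2 * k%:R + 1 :> R by rewrite -addn1 natrD natrM.
  by rewrite !mulrA.
have -> : (2 * k).+1`!%:R = (2 * k%:R + 1) * (2 * k)`!%:R :> R.
  by rewrite factS natrM -addn1 natrD natrM.
have -> : k.+1`!%:R = (k%:R + 1) * k`!%:R :> R by rewrite factS natrM -addn1 natrD.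
rewrite [(-1) ^+ k.+1]exprS.
have f0 : (2 * k)`!%:R != 0 :> R by rewrite pnatr_eq0 -lt0n fact_gt0.
have k3 : 2 * k%:R + 3 != 0 :> R by rewrite gt_eqF// ltr_wpDl// mulr_ge0.
have k2 : 2 * k%:R + 2 != 0 :> R by rewrite gt_eqF// ltr_wpDl// mulr_ge0.
have k1 : 2 * k%:R + 1 != 0 :> R by rewrite gt_eqF// ltr_wpDl// mulr_ge0.
by field; rewrite ?f0 ?k1 ?k2 ?k3.
Qed.

Let w_top k : w k (2 * k) = (2 * k)`!%:R%:P.
Proof.
have s1 : (size (w k (2 * k)) <= 1)%N.
  by rewrite leqNgt; apply/negP => s1; move: s1; rewrite /w;
  apply/negP; rewrite -leqNgt; apply/leq_sizeP => i i1;
  rewrite coef_derivn nth_default ?mul0rn// size_uX -[(2 * k).+1]addn1 leq_add2l.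
rewrite [LHS](size1_polyC s1); congr (_%:P).
rewrite /w coef_derivn addn0 ffactnn.
have -> : (u ^+ k)`_(2 * k) = lead_coef (u ^+ k) by rewrite lead_coefE size_uX.
have -> : lead_coef (u ^+ k) = 1.
  rewrite lead_coef_exp; have -> : lead_coef u = 1; last by rewrite expr1n.
  by rewrite /u lead_coefDl ?lead_coefXn// size_polyN size_polyX size_polyXn.
by [].
Qed.

Lemma legendre_mean k : (0 < k)%N -> I (psi Legendre k) = 0.
Proof.
move=> k0; rewrite psiE I01_Z; last exact: bpoly.
have -> : I (p k k) = Ip (w k k * 1) by rewrite mulr1.
rewrite (Ip_rodrigues _ (leqnn k)).
by rewrite derivn_poly0 ?size_poly1// mulr0 Ip0 !mulr0.
Qed.

Lemma legendre_orth i j : (0 < i)%N -> (0 < j)%N ->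
  I (fun z => psi Legendre i z * psi Legendre j z) = (i == j)%:R.
Proof.
wlog ij : i j / (i <= j)%N.
  move=> hw i0 j0; case/orP: (leq_total i j) => [ij|ji]; first exact: hw.
  by rewrite eq_sym -(hw j i)//; congr Rintegral; apply/funext => z; rewrite mulrC.
move=> i0 j0.
have -> : (fun z => psi Legendre i z * psi Legendre j z) =
    (fun z => coef i * coef j * (w j j * w i i).[z]) :> (R -> R).
  by apply/funext => z; rewrite !psiE hornerM /p; ring.
rewrite I01_Z// -/(Ip (w j j * w i i)) (Ip_rodrigues _ (leqnn j)) subnn.
(* With all [j] derivatives moved onto the factor of lower degree, it becomes the derivative of
   order [i + j] of [u^i]: zero if [i < j], the constant [(2i)!] if [i = j]. *)
have -> : (w i i)^`(j) = w i (i + j).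
  by rewrite /w; elim: (j) => [|l ih]; rewrite ?addn0// derivnS ih addnS derivnS.
have [<-|ne] := eqVneq i j; last first.
  rewrite [w i _]w_eq0; last by rewrite mulSn mul1n ltn_add2l ltn_neqAle ne.
  by rewrite mulr0 Ip0 !mulr0.
rewrite addnn -mul2n w_top [w i 0 * _]mulrC mul_polyC IpZ /w derivn0 Ip_uX factS natrM /coef.
have sq : Num.sqrt (2 * i%:R + 1) ^+ 2 = 2 * i%:R + 1 :> R.
  by rewrite sqr_sqrtr// addr_ge0// mulr_ge0.
have sg : (-1) ^+ i * (-1) ^+ i = 1 :> R by rewrite -exprMn mulrNN mulr1 expr1n.
have f0 : (2 * i)`!%:R != 0 :> R by rewrite pnatr_eq0 -lt0n fact_gt0.
have g0 : i`!%:R != 0 :> R by rewrite pnatr_eq0 -lt0n fact_gt0.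
have k1 : 2 * i%:R + 1 != 0 :> R by rewrite gt_eqF// ltr_wpDl// mulr_ge0.
have -> : (2 * i).+1%:R = 2 * i%:R + 1 :> R by rewrite -natr1 natrM.
set f := (2 * i)`!%:R in f0 *; set g := i`!%:R in g0 *.
transitivity (((-1) ^+ i * (-1) ^+ i) * (Num.sqrt (2 * i%:R + 1) ^+ 2 / (2 * i%:R + 1)) : R).
  by field; rewrite f0 g0 k1.
by rewrite sg sq mulfV// mulr1.
Qed.

End legendre_system.

(** * The rejection threshold *)

Section threshold.
Context {R : realType}.
Local Notation lam := (@lebesgue_measure R).

Lemma bernoulli_ineq (t : R) (n : nat) : -1 <= t -> 1 + n%:R * t <= (1 + t) ^+ n.
Proof.
move=> t1; elim: n => [|n ih]; first by rewrite mul0r addr0 expr0.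
rewrite exprS; apply: (@le_trans _ _ ((1 + t) * (1 + n%:R * t))); last first.
  by rewrite ler_wpM2l//; lra.
rewrite -natr1; have := mulr_ge0 (ler0n R n) (sqr_ge0 t); lra.
Qed.

(* Beyond [c], the standard density is at most [expR (- c^2 / 2)] times the
   normal density centered at [c]. *)
Lemma normal_tail_le (c : R) : 0 <= c -> 1 - Phi c <= expR (- (c ^+ 2 / 2)).
Proof.
move=> c0.
have mC : measurable (`]-oo, c]%classic : set (measurableTypeR R)) by exact: measurable_itv.
have mD : measurable (`]c, +oo[%classic : set (measurableTypeR R)) by exact: measurable_itv.
have -> : 1 - Phi c = fine (normal_prob 0 1 (`]c, +oo[ : set R)).
  have CE : ~` (`]-oo, c]%classic : set R) = `]c, +oo[%classic by rewrite setCitvl.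
  have := probability_setC (normal_prob 0 1) mC; rewrite CE => ->.
  by rewrite fineB// fin_num_measure.
have key : (normal_prob 0 1 (`]c, +oo[ : set R) <= (expR (- (c ^+ 2 / 2)))%:E)%E.
  rewrite -[leRHS]mule1 -(@integral_normal_pdf R c 1) -ge0_integralZl//; last 2 first.
  - by apply/measurable_EFinP; exact: measurable_normal_pdf.
  - by move=> x _; rewrite lee_fin normal_pdf_ge0.
  apply: (@le_trans _ _ (\int[lam]_(x in `]c, +oo[)
      ((expR (- (c ^+ 2 / 2)))%:E * (normal_pdf c 1 x)%:E))%E); last first.
    apply: ge0_subset_integral => //.
    - by apply: emeasurable_funM => //; apply/measurable_EFinP; exact: measurable_normal_pdf.
    - by move=> x _; rewrite mule_ge0 ?lee_fin ?expR_ge0 ?normal_pdf_ge0.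
  apply: ge0_le_integral => //.
  - by move=> x _; rewrite lee_fin normal_pdf_ge0.
  - by apply/measurable_EFinP/measurable_funTS; exact: measurable_normal_pdf.
  - by apply/measurable_funTS/emeasurable_funM => //; apply/measurable_EFinP; exact: measurable_normal_pdf.
  - move=> x /=; rewrite in_itv/= andbT => cx.
    rewrite -EFinM lee_fin /normal_pdf oner_eq0 /normal_fun.
    rewrite mulrCA ler_wpM2l ?normal_peak_ge0// -expRD ler_expR expr1n subr0.
    have := mulr_ge0 c0 (ltW (_ : 0 < x - c)); rewrite subr_gt0 => /(_ cx).
    by lra.
rewrite -lee_fin fineK// fin_num_measure//.
Qed.

(** With [y = (1 - alpha)^(1/d)] one has [1 - Phi c = (1 - y) / 2], and Bernoulli's inequality for
    [y^d = 1 - alpha] gives [1 - y >= alpha / d]. Hence [alpha / (2 d)] is at most the normal tail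
    at [c]. *)
Lemma c_alpha_le (alpha : R) (d : nat) : 0 < alpha < 1 -> (0 < d)%N ->
  0 < c_alpha alpha d -> c_alpha alpha d ^+ 2 <= 2 * (ln d%:R + ln (2 / alpha)).
Proof.
move=> /andP[a0 a1] d0; set c := c_alpha alpha d; move=> c0.
pose p := 2^-1 + (1 - alpha) `^ d%:R^-1 / 2.
(* [Phi_inv] is 0 off the range of [Phi], so [0 < c] forces a genuine quantile. *)
have cp : Phi c = p.
  have [ex|nex] := pselect (exists x, Phi x = p).
    exact: (@xgetPex _ 0 [set x : R | Phi x = p] ex).
  move: c0; rewrite /c /c_alpha /Phi_inv xgetPN ?ltxx// => x /= px.
  by apply: nex; exists x.
have d0' : 0 < d%:R :> R by rewrite ltr0n.
set y := (1 - alpha) `^ d%:R^-1.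
have y0 : 0 <= y by exact: powR_ge0.
have yd : y ^+ d = 1 - alpha.
  rewrite -powR_mulrn// /y -powRrM mulVf ?gt_eqF// powRr1//; lra.
have yle : d%:R * (y - 1) <= - alpha.
  have := @bernoulli_ineq (y - 1) d; rewrite addrCA subrr addr0 yd; lra.
have tail : alpha / (2 * d%:R) <= expR (- (c ^+ 2 / 2)).
  have h := normal_tail_le (ltW c0); rewrite cp /p -/y in h.
  apply: le_trans h; rewrite ler_pdivrMr ?mulr_gt0//; lra.
have q0 : 0 < alpha / (2 * d%:R) by rewrite divr_gt0 ?mulr_gt0.
have := tail; rewrite -ler_ln ?posrE ?expR_gt0// expRK.
have -> : alpha / (2 * d%:R) = (d%:R * (2 / alpha))^-1.
  by rewrite !invfM !invrK; field; rewrite !gt_eqF.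
have a2 : 0 < 2 / alpha by rewrite divr_gt0.
have da : 0 < d%:R * (2 / alpha) by exact: mulr_gt0.
have -> : ln (d%:R * (2 / alpha))^-1 = - (ln d%:R + ln (2 / alpha)).
  by rewrite lnV ?posrE// lnM.
by lra.
Qed.

End threshold.

(** * Growth of the bases with the dimension *)

Section basis_bounds.
Context {R : realType}.
Local Notation lam := (@lebesgue_measure R).
Local Notation I01 := (`[0%R, 1%R]%classic : set R).
Local Notation I f := (Rintegral lam I01 f).

Definition psi_sup (b : obasis) (d : nat) : R :=
  match b with Trig => 2 | Legendre => 2 * Num.sqrt d%:R end.
Definition psi_sup1 (b : obasis) (d : nat) : R :=
  match b with Trig => 8 * d%:R | Legendre => 4 * d%:R ^+ 2 * Num.sqrt d%:R end.
Definition psi_sup2 (b : obasis) (d : nat) : R :=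
  match b with Trig => 32 * d%:R ^+ 2 | Legendre => 8 * d%:R ^+ 4 * Num.sqrt d%:R end.

Lemma psi_smooth b k d : (0 < k <= d)%N -> exists p1 p2 : R -> R,
  [/\ forall x, is_derive x (1 : R) (psi b k) (p1 x),
      forall x, is_derive x (1 : R) p1 (p2 x),
      forall x : R, 0 <= x <= 1 -> `|psi b k x| <= psi_sup b d,
      forall x, 0 <= x <= 1 -> `|p1 x| <= psi_sup1 b d &
      forall x, 0 <= x <= 1 -> `|p2 x| <= psi_sup2 b d].
Proof.
case: b; last exact: legendre_smooth.
move=> kd; have [p1 [p2 [h1 h2 h3 h4 h5]]] := @trig_smooth R k d kd.
by exists p1, p2; split.
Qed.

Lemma psi_continuous b k : (0 < k)%N -> continuous (psi b k : R -> R).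
Proof.
move=> k0; have [|p1 [p2 [h1 _ _ _ _]]] := @psi_smooth b k k; first by rewrite k0 leqnn.
exact: continuous_of_derive h1.
Qed.

Lemma psi_mean b k : (0 < k)%N -> I (psi b k) = 0.
Proof. by case: b; [exact: trig_mean|exact: legendre_mean]. Qed.

Lemma psi_orth b i j : (0 < i)%N -> (0 < j)%N ->
  I (fun z => psi b i z * psi b j z) = (i == j)%:R.
Proof. by case: b; [exact: trig_orth|exact: legendre_orth]. Qed.

Lemma psi_sup_ge0 b d : 0 <= psi_sup b d.
Proof. by case: b => /=; rewrite ?mulr_ge0 ?sqrtr_ge0. Qed.

Lemma psi_sup1_ge0 b d : 0 <= psi_sup1 b d.
Proof. by case: b => /=; rewrite ?mulr_ge0 ?sqrtr_ge0 ?sqr_ge0. Qed.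

Lemma psi_sup2_ge0 b d : 0 <= psi_sup2 b d.
Proof. by case: b => /=; rewrite ?mulr_ge0 ?sqrtr_ge0 ?exprn_ge0. Qed.

Definition rate_deg (b : obasis) : nat := match b with Trig => 4 | Legendre => 9 end.

(** Allows the error [S0^2 r1] in the variance of the Y-average to be absorbed by [1 + (S1 r1)^2],
    whose second term the X-average produces anyway. *)
Lemma psi_sup_sqr_le b d : (0 < d)%N -> psi_sup b d ^+ 2 <= 2 * psi_sup1 b d.
Proof.
move=> d0; have d1 : 1 <= d%:R :> R by rewrite ler1n.
case: b => /=; first by lra.
have s1 : 1 <= Num.sqrt d%:R :> R by rewrite -[leLHS]sqrtr1 ler_wsqrtr.
rewrite exprMn sqr_sqrtr//.
have : d%:R ^+ 2 <= d%:R ^+ 2 * Num.sqrt d%:R :> R by rewrite ler_peMr// sqr_ge0.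
have : d%:R <= d%:R ^+ 2 :> R by rewrite expr2 ler_peMr.
by lra.
Qed.

(** The four quantities that the rate must make small against [n]: the term in pairs, the effect of
    [rho] on the X-average, the Taylor remainder, and the signal bound for large [theta]. For
    cosines the last three have order [d^4]; for Legendre polynomials the third decides, with
    [d^9]. *)
Lemma psi_growth b d : (0 < d)%N ->
  [/\ psi_sup1 b d ^+ 2 <= 64 * d%:R ^+ rate_deg b,
      (d%:R * psi_sup b d * psi_sup1 b d) ^+ 2 <= 256 * d%:R ^+ rate_deg b,
      psi_sup2 b d ^+ 2 <= 1024 * d%:R ^+ rate_deg b &
      d%:R ^+ 4 * psi_sup b d ^+ 2 <= 4 * d%:R ^+ rate_deg b].
Proof.
move=> d0; have d1 : 1 <= d%:R :> R by rewrite ler1n.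
have mono (i j : nat) : (i <= j)%N -> d%:R ^+ i <= d%:R ^+ j :> R.
  by move=> ij; exact: ler_weXn2l.
have s2 : Num.sqrt d%:R ^+ 2 = d%:R :> R by rewrite sqr_sqrtr.
case: b; rewrite /psi_sup1 /psi_sup2 /psi_sup /rate_deg; split.
- rewrite exprMn; have := mono 2%N 4%N isT; lra.
- by rewrite le_eqVlt; apply/orP; left; apply/eqP; ring.
- by rewrite le_eqVlt; apply/orP; left; apply/eqP; ring.
- by rewrite le_eqVlt; apply/orP; left; apply/eqP; ring.
- rewrite exprMn s2; have -> : (4 * d%:R ^+ 2) ^+ 2 * d%:R = 16 * d%:R ^+ 5 :> R by ring.
  have := mono 5%N 9%N isT; have := exprn_ge0 9 (le_trans ler01 d1); lra.
- have -> : (d%:R * (2 * Num.sqrt d%:R) * (4 * d%:R ^+ 2 * Num.sqrt d%:R)) ^+ 2 =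
      64 * d%:R ^+ 6 * (Num.sqrt d%:R ^+ 2) ^+ 2 :> R by ring.
  rewrite s2; have -> : 64 * d%:R ^+ 6 * d%:R ^+ 2 = 64 * d%:R ^+ 8 :> R by ring.
  have := mono 8%N 9%N isT; have := exprn_ge0 9 (le_trans ler01 d1); lra.
- rewrite exprMn s2; have -> : (8 * d%:R ^+ 4) ^+ 2 * d%:R = 64 * d%:R ^+ 9 :> R by ring.
  have := exprn_ge0 9 (le_trans ler01 d1); lra.
- rewrite exprMn s2; have -> : d%:R ^+ 4 * (2 ^+ 2 * d%:R) = 4 * d%:R ^+ 5 :> R by ring.
  have := mono 5%N 9%N isT; lra.
Qed.

End basis_bounds.

Section charged_intervals.
Context {d : measure_display} {T : measurableType d} {R : realType}.
Local Notation lam := (@lebesgue_measure R).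

(** An interval missed by [Z] would have probability 0, against at least [c (b - a)]. *)
Lemma density_charges (P : probability T R) (Z : T -> R) (r : R -> R) (c : R) :
  bmfun (`[0%R, 1%R]%classic : set R) r -> 0 < c ->
  (forall z, 0 <= z <= 1 -> c <= r z) ->
  (forall A : set R, measurable A ->
     P [set w | A (Z w)] = (\int[lam]_(z in A `&` `]0%R, 1%R[) (r z)%:E)%E) ->
  forall a b, 0 <= a -> a < b -> b <= 1 -> exists w, a < Z w < b.
Proof.
move=> br c0 cr Zr a b a0 ab b1; apply: contrapT => /forallNP none.
have mI : measurable (`]a, b[%classic : set R) by exact: measurable_itv.
have := Zr _ mI.
have -> : [set w | (`]a, b[%classic : set R) (Z w)] = set0.
  by apply/seteqP; split=> w //=; rewrite in_itv/=; exact: none.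
have -> : `]a, b[ `&` `]0, 1[ = `]a, b[%classic :> set R.
  apply/seteqP; split=> z /=; rewrite !in_itv/=; first by case.
  by move=> /andP[az zb]; rewrite az zb (le_lt_trans a0 az) (lt_le_trans zb b1).
rewrite measure0 => h.
have : ((c * (b - a))%:E <= \int[lam]_(z in `]a, b[) (r z)%:E)%E.
  have -> : (c * (b - a))%:E = (\int[lam]_(z in `]a, b[) (c%:E))%E.
    rewrite integral_cst//; have /= -> := @lebesgue_measure_itv R `]a, b[.
    by rewrite lte_fin ab -EFinB -EFinM.
  have subI : (`]a, b[%classic : set R) `<=` (`[0, 1]%classic : set R).
    by apply: subset_itv; rewrite bnd_simp.
  have sub z : (`]a, b[%classic : set R) z -> 0 <= z <= 1.
    rewrite /= in_itv/= => /andP[az zb].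
    by rewrite (le_trans a0 (ltW az)) (le_trans (ltW zb) b1).
  apply: ge0_le_integral => //.
  - by move=> z _; rewrite lee_fin ltW.
  - apply/measurable_EFinP; exact: measurable_funS subI br.1.
  - by move=> z /sub /cr; rewrite lee_fin.
by rewrite -h lee_fin leNgt mulr_gt0// subr_gt0.
Qed.

End charged_intervals.

(** * Power at fixed sample sizes *)

Section fixed_sample_sizes.
Context {dT : measure_display} {T : measurableType dT} {R : realType}.
Variables (b : obasis) (n m d : nat) (P : probability T R) (F : R -> R).
Variables (X : 'I_n -> T -> R) (Y : 'I_m -> T -> R) (theta : 'I_d -> R) (tmax : R).
Hypotheses (n_gt0 : (0 < n)%N) (m_gt0 : (0 < m)%N) (d_gt0 : (0 < d)%N).
Hypothesis mX : forall i, measurable_fun setT (X i).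
Hypothesis mY : forall j, measurable_fun setT (Y j).
Hypothesis XY_indep : mutual_indep P (join2 X Y).
Hypothesis XF : forall i, has_cdf P (X i) F.
Local Notation lam := (@lebesgue_measure R).
Local Notation I01 := (`[0%R, 1%R]%classic : set R).
Local Notation I f := (Rintegral lam I01 f).
Local Notation E f := (Rintegral P setT f).
Hypothesis Yrho : forall j (A : set R), measurable A ->
  P [set w | A (F (Y j w))] = (\int[lam]_(z in A `&` `]0%R, 1%R[) (rho b theta z)%:E)%E.
Hypothesis tmax_gt0 : 0 < tmax.
Hypothesis theta_le : forall k, `|theta k| <= tmax.
Hypothesis theta_max : exists k, `|theta k| = tmax.

Let S0 : R := psi_sup b d.
Let S1 : R := psi_sup1 b d.
Let S2 : R := psi_sup2 b d.
Let kap := d%:R * S0 * tmax.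
Let g := Num.sqrt (n%:R * m%:R / (n%:R + m%:R)) : R.
Let ps (k : 'I_d) : R -> R := psi b k.+1.
Let mu k := I (fun z => ps k z * rho b theta z).

Let cps k : continuous (ps k). Proof. exact: psi_continuous. Qed.
Let ps_le k x : 0 <= x <= 1 -> `|ps k x| <= S0.
Proof.
move=> x01; have [|p1 [p2 [_ _ h _ _]]] := @psi_smooth R b k.+1 d; first by rewrite ltn_ord.
exact: h.
Qed.
Let ps_mean k : I (ps k) = 0. Proof. exact: psi_mean. Qed.
Let ps_orth j k : I (fun x => ps j x * ps k x) = (j == k)%:R.
Proof. by rewrite /ps psi_orth// eqSS. Qed.

Let brho : bmfun I01 (rho b theta) := bmfun_tilt theta cps.

Let F_dense a c : 0 <= a -> a < c -> c <= 1 -> exists2 y, a < F y & F y < c.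
Proof.
move=> a0 ac c1.
have [w /andP[aw wc]] := density_charges brho (expR_gt0 _)
  (tilt_ge cps ps_le theta_le) (Yrho (Ordinal m_gt0)) a0 ac c1.
by exists (Y (Ordinal m_gt0) w).
Qed.

Let measurable_max (J : Type) (q : seq J) (f : J -> T -> R) :
  (forall k, measurable_fun setT (f k)) ->
  measurable_fun setT (fun w => \big[Num.max/0]_(k <- q) f k w).
Proof.
move=> mf; elim: q => [|k q ih].
  by under eq_fun do rewrite big_nil; exact: measurable_cst.
by under eq_fun do rewrite big_cons; exact: measurable_maxr.
Qed.

Lemma measurable_Psihat : measurable_fun setT (fun w => Psihat b (X^~ w) (Y^~ w) d).
Proof.
apply: measurable_funM; first exact: measurable_cst.
apply: measurable_max => k; apply: measurableT_comp => //.
apply: measurable_funM; first exact: measurable_cst.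
apply: measurable_sum => j; apply: measurableT_comp.
  by apply: continuous_measurable_fun; exact: psi_continuous.
apply: measurable_funM; first exact: measurable_cst.
apply: measurable_sum => i.
by rewrite ler_indicE; apply: measurable_indic; exact: measurable_ler.
Qed.

(** [M] is attained at some frequency. If the statistic stays below [g (1 - delta) M], the noise
    there exceeds [delta M], so one of its two parts reaches [delta M / 2]. In the last bound
    [4 d S0 M] stands in for [|rho - 1|_1]. *)
Lemma power_bound : exists M : R, [/\ 0 <= M,
  kap <= 2^-1 -> (1 - kap) * (1 - 2 * kap) * tmax <= M,
  tmax ^+ 2 <= M ^+ 2 * d%:R * (1 + 2 * kap) ^+ 2 &
  forall c delta, 0 < M -> 0 < delta -> c <= g * ((1 - delta) * M) ->
  1 - fine (P [set w | c <= Psihat b (X^~ w) (Y^~ w) d]) <=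
  3 * ((1 + S0 ^+ 2 * (4 * d%:R * S0 * M)) / m%:R +
       (2 + 2 * S1 ^+ 2 * (4 * d%:R * S0 * M) ^+ 2) / n%:R +
       4 * S1 ^+ 2 / (n%:R * m%:R)) / (delta * M / 2) ^+ 2 +
  S2 / n%:R / (delta * M / 2)].
Proof.
pose k0 : 'I_d := Ordinal d_gt0.
(* The default 0 of the maximum is harmless: the values are nonnegative and [d > 0]. *)
have [|k _ Mk] := @eq_bigmax _ R 'I_d 0 k0 xpredT (fun k => `|mu k|) isT; first by [].
set M := \big[_/_]_(i < d) _ in Mk.
have mu_le j : `|mu j| <= M by rewrite /M; exact: le_bigmax.
have M0 : 0 <= M by rewrite Mk.
have r1M := tilt_distance_le d_gt0 cps ps_le ps_mean ps_orth theta_le tmax_gt0 theta_max mu_le.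
exists M; split=> //.
- move=> kap2; have [k1 tk1] := theta_max.
  apply: le_trans (mu_le k1).
  exact: (tilt_linear_le d_gt0 cps ps_le ps_mean ps_orth theta_le kap2 tk1).
- exact: (tilt_signal_le d_gt0 cps ps_le ps_mean ps_orth theta_le theta_max mu_le).
move=> c delta M_gt0 delta0 cM.
have [|p1 [p2 [dp dp1 p_le p1_le p2_le]]] := @psi_smooth R b k.+1 d; first by rewrite ltn_ord.
have p_norm : I (fun z => psi b k.+1 z ^+ 2) = 1.
  have -> : (fun z => psi b k.+1 z ^+ 2) = (fun z => ps k z * ps k z).
    by apply/funext => z; rewrite expr2.
  by rewrite ps_orth eqxx.
have [L [Rem [bL bRem Rem0 noise [EL ER]]]] := psihat_noise n_gt0 m_gt0 mX mY XY_indep XF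
  F_dense brho Yrho dp dp1 p_le p1_le p2_le (ps_mean k) p_norm.
set r1 := I _ in EL; set q := 4 * d%:R * S0 * M.
have r10 : 0 <= r1 by apply: I01_ge0.
have r1q : r1 <= q by exact: r1M.
have q0 : 0 <= q := le_trans r10 r1q.
have n0 : 0 < n%:R :> R by rewrite ltr0n.
have m0 : 0 < m%:R :> R by rewrite ltr0n.
have S00 : 0 <= S0 by exact: psi_sup_ge0.
have S10 : 0 <= S1 by exact: psi_sup1_ge0.
set t := delta * M / 2; have t0 : 0 < t by rewrite !mulr_gt0.
(* [fl >= 1] as soon as [|L| >= t] or [Rem >= t], so a single use of Markov's inequality covers both
   parts. *)
pose fl w := L w ^+ 2 / t ^+ 2 + Rem w / t.
have bfl : bmfun setT fl.
  by apply: bmfunD; apply: bmfunM => //; [exact: bmfunX|exact: bmfun_cst|exact: bmfun_cst].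
have fl0 w : 0 <= fl w.
  by apply: addr_ge0; apply: divr_ge0; rewrite ?sqr_ge0 ?Rem0// ltW.
have mA : measurable [set w | c <= Psihat b (X^~ w) (Y^~ w) d].
  exact: (measurable_ler (measurable_cst c) measurable_Psihat).
have mB : measurable [set w | 1 <= fl w].
  exact: (measurable_ler (measurable_cst (1 : R)) bfl.1).
have AB : ~` [set w | c <= Psihat b (X^~ w) (Y^~ w) d] `<=` [set w | 1 <= fl w].
  move=> w /= /negP; rewrite -ltNge => hc.
  have hP : g * `|psihat b (X^~ w) (Y^~ w) k.+1| <= Psihat b (X^~ w) (Y^~ w) d.
    rewrite /Psihat ler_wpM2l ?sqrtr_ge0//.
    exact: (@le_bigmax _ R 'I_d 0 (fun k => `|psihat b (X^~ w) (Y^~ w) k.+1|) k).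
  have := le_lt_trans hP (lt_le_trans hc cM) => hlt.
  have g0 : 0 < g.
    by rewrite sqrtr_gt0 divr_gt0 ?mulr_gt0 ?addr_gt0.
  rewrite ltr_pM2l// in hlt.
  have hn := noise w; rewrite -/(psihat b (X^~ w) (Y^~ w) k.+1) -/(mu k) in hn.
  have htri : M - `|psihat b (X^~ w) (Y^~ w) k.+1| <= `|L w| + Rem w.
    apply: le_trans hn; rewrite Mk distrC; exact: lerB_dist.
  have sumt : 2 * t <= `|L w| + Rem w.
    by rewrite /t mulrCA mulfV// mulr1; apply: le_trans htri; lra.
  have [Lt|tL] := leP t `|L w|.
    have : 1 <= L w ^+ 2 / t ^+ 2.
      rewrite ler_pdivlMr ?exprn_gt0// mul1r -[leRHS]real_normK ?num_real//.
      by rewrite lerXn2r ?nnegrE// ltW.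
    by move=> h; rewrite /fl (le_trans h)// lerDl; apply: divr_ge0; [exact: Rem0|exact: ltW].
  have : 1 <= Rem w / t by rewrite ler_pdivlMr// mul1r; lra.
  by move=> h; rewrite /fl (le_trans h)// lerDr; apply: divr_ge0; exact: sqr_ge0.
have PA : 1 - fine (P [set w | c <= Psihat b (X^~ w) (Y^~ w) d]) <=
    fine (P [set w | 1 <= fl w]).
  have -> : 1 - fine (P [set w | c <= Psihat b (X^~ w) (Y^~ w) d]) =
      fine (P (~` [set w | c <= Psihat b (X^~ w) (Y^~ w) d])).
    by rewrite (probability_setC P mA) fineB// fin_num_measure.
  rewrite fine_le ?fin_num_measure//; first exact: measurableC.
  by apply: le_measure; rewrite ?inE//; exact: measurableC.
apply: (le_trans PA); apply: (le_trans (markov_bm P bfl fl0 ltr01)); rewrite divr1.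
rewrite /fl E_D; [|by apply: bmfunM; [exact: bmfunX|exact: bmfun_cst]|
  by apply: bmfunM => //; exact: bmfun_cst].
have bL2 : bmfun setT (fun w => L w ^+ 2) by exact: bmfunX.
have -> : E (fun w => L w ^+ 2 / t ^+ 2) = E (fun w => L w ^+ 2) / t ^+ 2.
  rewrite mulrC -(E_Z P _ bL2); congr Rintegral; apply/funext => w; exact: mulrC.
have -> : E (fun w => Rem w / t) = E Rem / t.
  rewrite mulrC -(E_Z P _ bRem); congr Rintegral; apply/funext => w; exact: mulrC.
have t20 : 0 < t ^+ 2 by rewrite exprn_gt0.
apply: lerD; last by rewrite ler_pM2r ?invr_gt0.
rewrite ler_pM2r ?invr_gt0//; apply: (le_trans EL).
rewrite ler_pM2l// lerD2r lerD// ler_pM2r ?invr_gt0// lerD2l.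
  by rewrite ler_wpM2l ?sqr_ge0.
by rewrite ler_wpM2l ?mulr_ge0 ?sqr_ge0// lerXn2r ?nnegrE.
Qed.

End fixed_sample_sizes.

(** * From the bounds to the limit *)

Section asymptotics.
Context {R : realType}.

(** [N], [D], [ld], [Dr] stand for [n], [d], [ln d] and [d] to the rate exponent. For [kap <= eta]
    the linear bound loses only the factor [1 - 3 eta]; for larger [kap] the bound by [1 + 2 kap] is
    used and the rate makes up for its lack of sharpness. *)
Lemma signal_le (N m D S0 tmax M lam ld c0 eps Dr : R) :
  0 < N -> 0 < c0 -> c0 * N <= m -> m <= N -> 1 <= D -> 0 <= S0 -> 0 < eps ->
  0 <= M -> 2 + eps <= lam -> 0 <= ld -> ld <= D -> 0 < Dr ->
  D ^+ 4 * S0 ^+ 2 <= 4 * Dr ->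
  tmax ^+ 2 = lam ^+ 2 * (ld / (2 * (N^-1 + m^-1)^-1)) -> 0 <= tmax ->
  let kap := D * S0 * tmax in let eta := eps / (6 * (2 + eps)) in
  (kap <= 2^-1 -> (1 - kap) * (1 - 2 * kap) * tmax <= M) ->
  tmax ^+ 2 <= M ^+ 2 * D * (1 + 2 * kap) ^+ 2 ->
  Dr / N * (4 * (eta^-1 + 2) ^+ 2 * (2 + eps / 2) ^+ 2) <= c0 ->
  (2 + eps / 2) ^+ 2 / 2 * ld <= N * m / (N + m) * M ^+ 2.
Proof.
move=> N0 c00 cm mN D1 S00 e0 M0 lam2 ld0 ldD Dr0 DS tE t0 kap eta hA hB hx.
have m0 : 0 < m by apply: lt_le_trans cm; exact: mulr_gt0.
have D0 : 0 < D by apply: lt_le_trans D1.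
have Nm0 : 0 < N + m by exact: addr_gt0.
have gE : N * m / (N + m) = (N^-1 + m^-1)^-1.
  by field; rewrite !gt_eqF// addrC.
have eta0 : 0 < eta by rewrite divr_gt0// mulr_gt0// addr_gt0.
have etaE : 6 * (2 + eps) * eta = eps.
  by rewrite /eta mulrC divfK// gt_eqF// mulr_gt0// addr_gt0.
have eta2 : eta <= 6^-1.
  rewrite /eta invfM mulrCA ler_piMr ?invr_ge0// ler_pdivrMr ?addr_gt0//; lra.
have [kape|ekap] := leP kap eta.
  have kap0 : 0 <= kap by rewrite !mulr_ge0// ltW.
  have h1 : (1 - 3 * eta) * tmax <= M.
    apply: le_trans (hA _); last by lra.
    rewrite ler_wpM2r//; have := mulr_ge0 kap0 kap0; lra.
  have h2 : (1 - 3 * eta) ^+ 2 * tmax ^+ 2 <= M ^+ 2.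
    by rewrite -exprMn lerXn2r ?nnegrE// mulr_ge0//; lra.
  rewrite gE; set w := N^-1 + m^-1 in tE *.
  have w0 : 0 < w by rewrite addr_gt0 ?invr_gt0.
  apply: (@le_trans _ _ (w^-1 * ((1 - 3 * eta) ^+ 2 * tmax ^+ 2))); last first.
    by rewrite ler_pM2l ?invr_gt0.
  rewrite tE.
  have -> : w^-1 * ((1 - 3 * eta) ^+ 2 * (lam ^+ 2 * (ld / (2 * w^-1)))) =
     ((1 - 3 * eta) * lam) ^+ 2 / 2 * ld by field; rewrite gt_eqF.
  rewrite ler_wpM2r// ler_pM2r ?invr_gt0//.
  have h3 : 2 + eps / 2 <= (1 - 3 * eta) * lam.
    apply: (@le_trans _ _ ((1 - 3 * eta) * (2 + eps))); first by lra.
    by rewrite ler_wpM2l//; lra.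
  by rewrite lerXn2r ?nnegrE//; lra.
have kap0 : 0 < kap by exact: lt_trans ekap.
(* Since [1 < kap / eta], the factor [1 + 2 kap] is at most [kap H]. The signal bound then has
   [kap^2] on both sides, and cancelling it removes the size of [theta]. *)
set H := eta^-1 + 2 in hx.
have H0 : 0 < H by rewrite addr_gt0 ?invr_gt0.
have h1 : 1 + 2 * kap <= kap * H.
  rewrite /H mulrDr [2 * _]mulrC lerD2r -ler_pdivrMl// mulr1.
  by rewrite lef_pV2 ?posrE// ltW.
have h2 : kap ^+ 2 <= (D ^+ 3 * S0 ^+ 2 * M ^+ 2 * H ^+ 2) * kap ^+ 2.
  have -> : kap ^+ 2 = (D * S0) ^+ 2 * tmax ^+ 2 by rewrite -exprMn.
  apply: (@le_trans _ _ ((D * S0) ^+ 2 * (M ^+ 2 * D * (1 + 2 * kap) ^+ 2))).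
    by rewrite ler_wpM2l ?sqr_ge0.
  apply: (@le_trans _ _ ((D * S0) ^+ 2 * (M ^+ 2 * D * (kap * H) ^+ 2))).
    rewrite ler_wpM2l ?sqr_ge0// ler_wpM2l ?mulr_ge0 ?sqr_ge0 ?(ltW D0)//.
    have a1 : 0 <= 1 + 2 * kap by lra.
    have a2 : 0 <= kap * H by rewrite mulr_ge0// ltW.
    by rewrite lerXn2r ?nnegrE.
  rewrite le_eqVlt; apply/orP; left; apply/eqP; rewrite /kap; ring.
have h3 : 1 <= D ^+ 3 * S0 ^+ 2 * M ^+ 2 * H ^+ 2.
  by rewrite -(@ler_pM2r _ (kap ^+ 2)) ?exprn_gt0// mul1r.
(* [h3] multiplied by [D]. Together with the rate hypothesis [hx] it makes a multiple of [N M^2]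
   dominate [D], hence [ld]. *)
have h4 : D <= 4 * Dr * (M ^+ 2 * H ^+ 2).
  apply: (@le_trans _ _ (D * (D ^+ 3 * S0 ^+ 2 * M ^+ 2 * H ^+ 2))).
    by rewrite ler_peMr// ltW.
  have -> : D * (D ^+ 3 * S0 ^+ 2 * M ^+ 2 * H ^+ 2) =
     D ^+ 4 * S0 ^+ 2 * (M ^+ 2 * H ^+ 2) by ring.
  by rewrite ler_wpM2r// mulr_ge0 ?sqr_ge0.
have gN : c0 * N / 2 <= N * m / (N + m).
  rewrite ler_pdivlMr// mulrAC ler_pdivrMr//.
  apply: (@le_trans _ _ (c0 * N * (2 * N))).
    by rewrite ler_wpM2l ?mulr_ge0 ?(ltW c00) ?(ltW N0)//; lra.
  have := ler_wpM2l (ltW N0) cm; lra.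
have M20 : 0 <= M ^+ 2 by exact: sqr_ge0.
apply: (@le_trans _ _ (c0 * N / 2 * M ^+ 2)); last by rewrite ler_wpM2r.
have hx' : Dr * (4 * H ^+ 2 * (2 + eps / 2) ^+ 2) <= c0 * N.
  by rewrite -ler_pdivrMr// mulrAC.
have B0 : 0 <= (2 + eps / 2) ^+ 2 by exact: sqr_ge0.
apply: (@le_trans _ _ ((2 + eps / 2) ^+ 2 / 2 * (4 * Dr * (M ^+ 2 * H ^+ 2)))).
  by apply: ler_wpM2l; [rewrite mulr_ge0|exact: le_trans ldD h4].
have := ler_wpM2r M20 hx'; lra.
Qed.

(** Each term of the bracket is at most a constant times [(1 + Dr M^2) / (c0 N)]. Division by [M^2]
    leaves [1 / (N M^2) <= 1 / ld] and [Dr / N], both vanishing in the limit whatever the size of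
    [M]. *)
Lemma error_le (N m D S0 S1 S2 M c0 delta ld Dr : R) :
  0 < N -> 0 < c0 -> c0 * N <= m -> m <= N -> 0 < c0 <= 1 -> 0 < D -> 0 <= S0 ->
  0 <= S1 -> 0 <= S2 -> 0 < M -> 0 < delta -> 1 <= ld -> 0 < Dr -> Dr <= N ->
  S0 ^+ 2 <= 2 * S1 -> S1 ^+ 2 <= 64 * Dr -> (D * S0 * S1) ^+ 2 <= 256 * Dr ->
  S2 ^+ 2 <= 1024 * Dr -> ld <= N * M ^+ 2 ->
  3 * ((1 + S0 ^+ 2 * (4 * D * S0 * M)) / m +
       (2 + 2 * S1 ^+ 2 * (4 * D * S0 * M) ^+ 2) / N +
       4 * S1 ^+ 2 / (N * m)) / (delta * M / 2) ^+ 2 + S2 / N / (delta * M / 2) <=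
  12 / (c0 * delta ^+ 2) * (260 / ld + 12288 * (Dr / N)) +
  64 / delta * Num.sqrt (Dr / N).
Proof.
move=> N0 c00 cm mN /andP[_ c01] D0 S00 S10 S20 M0 de0 ld1 Dr0 DrN h0 h1 h01 h2 hM.
have m0 : 0 < m by apply: lt_le_trans cm; exact: mulr_gt0.
have ld0 : 0 < ld by exact: lt_le_trans ld1.
have cN0 : 0 < c0 * N by exact: mulr_gt0.
set q := 4 * D * S0 * M.
have q0 : 0 <= q by rewrite /q !mulr_ge0 ?(ltW D0) ?(ltW M0).
have S1q : S1 ^+ 2 * q ^+ 2 <= 4096 * Dr * M ^+ 2.
  have -> : S1 ^+ 2 * q ^+ 2 = 16 * ((D * S0 * S1) ^+ 2 * M ^+ 2) by rewrite /q; ring.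
  have := ler_wpM2r (sqr_ge0 M) h01; lra.
(* [S0^2 q <= 2 S1 q <= 1 + (S1 q)^2]. *)
have S0q : S0 ^+ 2 * q <= 1 + S1 ^+ 2 * q ^+ 2.
  have := ler_wpM2r q0 h0; have := sqr_ge0 (S1 * q - 1); lra.
have x1 : Dr / N <= 1 by rewrite ler_pdivrMr// mul1r.
have x0 : 0 < Dr / N by rewrite divr_gt0.
have iv : N^-1 <= (c0 * N)^-1.
  by rewrite lef_pV2 ?posrE// ler_piMl// ltW.
have ivm : m^-1 <= (c0 * N)^-1 by rewrite lef_pV2 ?posrE.
have M20 : 0 < M ^+ 2 by exact: exprn_gt0.
(* 260 is 2 + 2 + 256 and 12288 is 4096 + 8192, collected from the three noise terms. *)
have bracket : (1 + S0 ^+ 2 * q) / m + (2 + 2 * S1 ^+ 2 * q ^+ 2) / N + 4 * S1 ^+ 2 / (N * m) <=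
    (260 + 12288 * Dr * M ^+ 2) / (c0 * N).
  have a1 : (1 + S0 ^+ 2 * q) / m <= (2 + 4096 * Dr * M ^+ 2) / (c0 * N).
    apply: ler_pM => //; last by lra.
      by rewrite addr_ge0// mulr_ge0// sqr_ge0.
    by rewrite invr_ge0 ltW.
  have a2 : (2 + 2 * S1 ^+ 2 * q ^+ 2) / N <= (2 + 8192 * Dr * M ^+ 2) / (c0 * N).
    apply: ler_pM => //; last by lra.
      have := mulr_ge0 (sqr_ge0 S1) (sqr_ge0 q); lra.
    by rewrite invr_ge0 ltW.
  have a3 : 4 * S1 ^+ 2 / (N * m) <= 256 / (c0 * N).
    rewrite invfM mulrA; apply: ler_pM => //.
    - by rewrite mulr_ge0 ?invr_ge0 ?(ltW N0)// mulr_ge0// sqr_ge0.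
    - by rewrite invr_ge0 ltW.
    - by rewrite ler_pdivrMr//; lra.
  have -> : (260 + 12288 * Dr * M ^+ 2) / (c0 * N) = (2 + 4096 * Dr * M ^+ 2) / (c0 * N) +
    (2 + 8192 * Dr * M ^+ 2) / (c0 * N) + 256 / (c0 * N) by rewrite -!mulrDl; congr (_ / _); ring.
  by rewrite !lerD.
have t0 : 0 < delta * M / 2 by rewrite !mulr_gt0.
apply: lerD.
  apply: (@le_trans _ _ (3 * ((260 + 12288 * Dr * M ^+ 2) / (c0 * N)) / (delta * M / 2) ^+ 2)).
    by rewrite ler_pM2r ?invr_gt0 ?exprn_gt0// ler_pM2l.
  have -> : 3 * ((260 + 12288 * Dr * M ^+ 2) / (c0 * N)) / (delta * M / 2) ^+ 2 =
     12 / (c0 * delta ^+ 2) * (260 / (N * M ^+ 2) + 12288 * (Dr / N)).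
    by field; rewrite !gt_eqF.
  have K0 : 0 <= 12 / (c0 * delta ^+ 2) by rewrite divr_ge0// mulr_ge0 ?sqr_ge0// ltW.
  apply: ler_wpM2l => //; rewrite lerD2r ler_pM2l//.
  by rewrite lef_pV2 ?posrE// mulr_gt0.
have -> : S2 / N / (delta * M / 2) = 2 / delta * (S2 / (N * M)).
  by field; rewrite !gt_eqF.
have -> : 64 / delta * Num.sqrt (Dr / N) = 2 / delta * (32 * Num.sqrt (Dr / N)).
  by field; rewrite gt_eqF.
rewrite ler_wpM2l ?divr_ge0 ?(ltW de0)//.
(* Compared through squares: [S2^2 <= 1024 Dr] and [N M^2 >= ld >= 1]. *)
rewrite -ler_sqr ?nnegrE; last 2 first.
- by rewrite divr_ge0// mulr_ge0// ltW.
- by rewrite mulr_ge0// sqrtr_ge0.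
rewrite [leRHS]exprMn sqr_sqrtr ?(ltW x0)// expr_div_n ler_pdivrMr ?exprn_gt0 ?mulr_gt0//.
have -> : 32 ^+ 2 * (Dr / N) * (N * M) ^+ 2 = 1024 * Dr * (N * M ^+ 2).
  by field; rewrite gt_eqF.
apply: (le_trans h2); rewrite -[leLHS]mulr1; apply: ler_wpM2l; first by lra.
exact: le_trans hM.
Qed.

End asymptotics.

Theorem theorem2 (R : realType) (b : obasis) (c0 alpha eps : R)
  (hc0 : 0 < c0 <= 1) (halpha : 0 < alpha < 1) (heps : 0 < eps)
  (m d : nat -> nat)
  (hm : forall n, c0 * n%:R <= (m n)%:R /\ (m n <= n)%N)
  (hd : (fun n => ((d n)%:R : R)) @ \oo --> +oo)
  (hrate : (fun n => (d n)%:R / (n%:R `^ (rate_exp b)^-1) : R) @ \oo --> 0)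
  (dT : measure_display) (T : nat -> measurableType dT)
  (P : forall n, probability (T n) R)
  (F : R -> R) (hF : abs_cont_cdf F)
  (G : nat -> R -> R) (hG : forall n, abs_cont_cdf (G n))
  (X : forall n, 'I_n -> T n -> R) (Y : forall n, 'I_(m n) -> T n -> R)
  (hXmeas : forall n i, measurable_fun setT (X n i))
  (hYmeas : forall n j, measurable_fun setT (Y n j))
  (hindep : forall n, mutual_indep (P n) (join2 (X n) (Y n)))
  (hXF : forall n i, has_cdf (P n) (X n i) F)
  (hYG : forall n j, has_cdf (P n) (Y n j) (G n))
  (theta : forall n, 'I_(d n) -> R)
  (htheta : forall n, exists lam : R, 2 + eps <= lam /\
     \big[Num.max/0]_(k < d n) `|theta n k| =
       lam * Num.sqrt (ln ((d n)%:R) / nbar n (m n)))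
  (hV : forall n j (A : set R), measurable A ->
     P n [set w | A (F (Y n j w))] =
     (\int[lebesgue_measure]_(z in A `&` `]0%R, 1%R[) (rho b (theta n) z)%:E)%E) :
  (fun n => fine (P n [set w | c_alpha alpha (d n) <=
      Psihat b (fun i => X n i w) (fun j => Y n j w) (d n)])) @ \oo --> (1 : R).
Proof.
have /andP[c00 c01] := hc0; have /andP[al0 al1] := halpha.
pose e := rate_deg b; pose x n : R := (d n)%:R ^+ e / n%:R.
(* Chosen so that [(1 - delta) (1 + eps / 4) = 1 + eps / 8]: half of the margin goes to the noise,
   half is kept for [ln (2 / alpha)]. *)
pose delta : R := (eps / 8) / (1 + eps / 4).
have de0 : 0 < delta by rewrite divr_gt0// ?addr_gt0 ?divr_gt0.
have deE : (1 - delta) * (1 + eps / 4) = 1 + eps / 8.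
  by rewrite mulrBl /delta divfK ?gt_eqF ?addr_gt0 ?divr_gt0//; lra.
have e_pos : (0 < e)%N by rewrite /e; case: (b).
have rateE : rate_exp b = e%:R :> R by rewrite /e; case: (b).
(* [d^e / n] is the [e]-th power of [d / n^(1/e)], which tends to 0 by the rate hypothesis. *)
have x0 : x n @[n --> \oo] --> (0 : R).
  have ce : {for (0 : R), continuous (fun z : R => z ^+ e)} by exact: exprn_continuous.
  have := cvg_comp _ _ hrate ce.
  have -> : (0 : R) ^+ e = 0 by rewrite expr0n gtn_eqF.
  apply: cvg_trans; apply: near_eq_cvg; near=> n.
  have n0 : 0 < n%:R :> R by rewrite ltr0n; near: n; exact: nbhs_infty_gt.
  rewrite /x /= expr_div_n; congr (_ / _).
  rewrite -powR_mulrn ?powR_ge0// -powRrM rateE mulVf ?powRr1 ?(ltW n0)//.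
  by rewrite pnatr_eq0 -lt0n.
have ldy : ln ((d n)%:R : R) @[n --> \oo] --> +oo.
  apply/cvgryPge => A; have /cvgryPge/(_ (expR A)) := hd; apply: filterS => n hn.
  by rewrite -ler_expR lnK ?posrE// (lt_le_trans (expR_gt0 A)).
have ld0 : (ln ((d n)%:R : R))^-1 @[n --> \oo] --> (0 : R).
  by apply/gtr0_cvgV0 => //; move/cvgryPgt : ldy; exact.
pose eta := eps / (6 * (2 + eps)).
pose K1 := 12 / (c0 * delta ^+ 2).
(* The bound of [error_le] on the probability of not rejecting; [theta] and [M] no longer occur in
   it. *)
pose U n : R := K1 * (260 / ln ((d n)%:R) + 12288 * x n) + 64 / delta * Num.sqrt (x n).
have U0 : U n @[n --> \oo] --> (0 : R).
  have -> : 0 = K1 * (260 * 0 + 12288 * 0) + 64 / delta * Num.sqrt 0 :> R.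
    by rewrite sqrtr0 !(mulr0, addr0).
  apply: cvgD; apply: cvgM; try exact: cvg_cst.
    by apply: cvgD; apply: cvgM => //; exact: cvg_cst.
  by apply: continuous_cvg => //; exact: sqrt_continuous.
have xlt z : 0 < z -> \forall k \near \oo, x k <= z.
  move=> z0; have /cvgr0Pnorm_lt/(_ z z0) := x0; apply: filterS => k.
  by move=> /ltW; apply: le_trans; exact: ler_norm.
have B0 : 0 < 4 * (eta^-1 + 2) ^+ 2 * (2 + eps / 2) ^+ 2.
  by rewrite !mulr_gt0 ?exprn_gt0// addr_gt0 ?invr_gt0 ?divr_gt0// mulr_gt0// addr_gt0.
apply: (@squeeze_cvgr _ _ _ _ (fun n => 1 - U n) (fun=> 1)); last 2 first.
- by rewrite -[X in _ --> X]subr0; apply: cvgB => //; exact: cvg_cst.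
- exact: cvg_cst.
near=> n.
have mA : measurable [set w | c_alpha alpha (d n) <= Psihat b ((X n)^~ w) ((Y n)^~ w) (d n)].
  apply: (measurable_ler (measurable_cst (c_alpha alpha (d n)))).
  exact: (measurable_Psihat b (d n) (hXmeas n) (hYmeas n)).
apply/andP; split; last by rewrite -lee_fin fineK ?fin_num_measure//; exact: probability_le1.
have n0 : (0 < n)%N by near: n; exact: nbhs_infty_gt.
have N0 : 0 < n%:R :> R by rewrite ltr0n.
have [cm mn] := hm n.
have m0 : 0 < (m n)%:R :> R by apply: lt_le_trans cm; exact: mulr_gt0.
have ld1 : 1 <= ln ((d n)%:R : R) by near: n; move/cvgryPge : ldy; exact.
have lda : (eps / 4)^-1 * ln (2 / alpha) <= ln ((d n)%:R : R).
  by near: n; move/cvgryPge : ldy; exact.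
have x1 : x n <= 1 by near: n; exact: xlt.
have xc : x n <= c0 / (4 * (eta^-1 + 2) ^+ 2 * (2 + eps / 2) ^+ 2).
  by near: n; apply: xlt; exact: divr_gt0.
have d0 : (0 < d n)%N.
  by near: n; move/cvgryPge/(_ 1) : hd; apply: filterS => k; rewrite ler1n.
have D1 : 1 <= (d n)%:R :> R by rewrite ler1n.
have D0 : 0 < (d n)%:R :> R by rewrite ltr0n.
have ldD : ln ((d n)%:R : R) <= (d n)%:R.
  exact/ltW/ln_sublinear.
have ldg0 : 0 < ln ((d n)%:R : R) by exact: lt_le_trans ld1.
have Dr0 : 0 < (d n)%:R ^+ e :> R by exact: exprn_gt0.
have DrN : (d n)%:R ^+ e <= n%:R :> R by move: x1; rewrite /x ler_pdivrMr// mul1r.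
have mn' : (m n)%:R <= n%:R :> R by rewrite ler_nat.
have nb0 : 0 < nbar n (m n) :> R by rewrite mulr_gt0// invr_gt0 addr_gt0 ?invr_gt0.
have [lam [lam2 tmE]] := htheta n.
set tmax := \big[_/_]_(k < d n) _ in tmE.
have t_gt0 : 0 < tmax.
  have lam0 : 0 < lam by apply: lt_le_trans lam2; rewrite addr_gt0.
  by rewrite tmE mulr_gt0// sqrtr_gt0 divr_gt0.
have th_le k : `|theta n k| <= tmax.
  exact: (@le_bigmax _ R 'I_(d n) 0 (fun k => `|theta n k|) k).
have th_max : exists k, `|theta n k| = tmax.
  have [|k _ Ek] := @eq_bigmax _ R 'I_(d n) 0 (Ordinal d0) xpredT (fun k => `|theta n k|) isT.
    by [].
  by exists k; rewrite -Ek.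
have m0' : (0 < m n)%N by rewrite -(@ltr0n R).
have [M [M0 hA hB hP]] := power_bound n0 m0' d0 (hXmeas n) (hYmeas n) (hindep n) (hXF n)
  (hV n) t_gt0 th_le th_max.
have [g1 g01 g2 g4] := @psi_growth R b (d n) d0.
have tE : tmax ^+ 2 = lam ^+ 2 * (ln ((d n)%:R) / (2 * (n%:R^-1 + (m n)%:R^-1)^-1)).
  by rewrite tmE exprMn sqr_sqrtr// divr_ge0 ?ltW.
have hsig := signal_le N0 c00 cm mn' D1 (psi_sup_ge0 b (d n)) heps M0 lam2 (ltW ldg0) ldD
  Dr0 g4 tE (ltW t_gt0) hA hB.
have {}hsig := hsig _; rewrite /nbar in nb0.
set gg := n%:R * (m n)%:R / (n%:R + (m n)%:R) in hsig.
have {}hsig : 2 * (1 + eps / 4) ^+ 2 * ln ((d n)%:R) <= gg * M ^+ 2.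
  have -> : 2 * (1 + eps / 4) ^+ 2 = (2 + eps / 2) ^+ 2 / 2 :> R by field.
  by apply: hsig; rewrite -ler_pdivlMr.
have gg0 : 0 < gg by rewrite divr_gt0 ?mulr_gt0 ?addr_gt0.
have ggN : gg <= n%:R by rewrite ler_pdivrMr ?addr_gt0// ler_wpM2l ?(ltW N0)// lerDr ltW.
have e4 : 1 <= (1 + eps / 4) ^+ 2 by rewrite exprn_ege1// lerDl divr_ge0// ltW.
have ldM : ln ((d n)%:R) <= n%:R * M ^+ 2.
  apply: (@le_trans _ _ (gg * M ^+ 2)); last by rewrite ler_wpM2r ?sqr_ge0.
  apply: le_trans hsig; rewrite ler_peMl ?(ltW ldg0)//; lra.
have M_gt0 : 0 < M.
  rewrite lt_def M0 andbT; apply: contraTneq ldM => ->.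
  by rewrite expr0n mulr0 -ltNge.
have cM : c_alpha alpha (d n) <= Num.sqrt gg * ((1 - delta) * M).
  have r0 : 0 <= Num.sqrt gg * ((1 - delta) * M).
    rewrite mulr_ge0 ?sqrtr_ge0// mulr_ge0//.
    by rewrite -(@pmulr_lge0 _ (1 + eps / 4)) ?deE ?addr_ge0 ?divr_ge0 ?addr_gt0 ?divr_gt0 ?(ltW heps).
  (* A nonpositive threshold is below the right-hand side at once; this includes the default value 0
     of [Phi_inv]. *)
  have [c_le0|c_gt0] := leP (c_alpha alpha (d n)) 0; first exact: le_trans r0.
  have c2 := c_alpha_le halpha d0 c_gt0.
  rewrite -ler_sqr ?nnegrE ?(ltW c_gt0)//; apply: (le_trans c2).
  rewrite exprMn sqr_sqrtr ?(ltW gg0)// exprMn.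
  have lda' : ln (2 / alpha) <= eps / 4 * ln ((d n)%:R).
    by rewrite -ler_pdivrMl ?divr_gt0.
  have sq : 0 <= (1 - delta) ^+ 2 by exact: sqr_ge0.
  have h := ler_wpM2l sq hsig.
  have E2 : (1 - delta) ^+ 2 * (2 * (1 + eps / 4) ^+ 2 * ln ((d n)%:R)) =
     2 * (1 + eps / 8) ^+ 2 * ln ((d n)%:R).
    by rewrite -deE exprMn; ring.
  rewrite E2 in h; rewrite mulrCA; apply: le_trans h.
  (* [(1 + eps / 8)^2 = 1 + eps / 4 + (eps / 8)^2]; the middle term pays for [ln (2 / alpha)]. *)
  have := mulr_ge0 (sqr_ge0 (eps / 8)) (ltW ldg0); lra.
have /(le_trans (hP _ _ M_gt0 de0 cM)) h := error_le N0 c00 cm mn' hc0 D0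
  (psi_sup_ge0 b (d n)) (psi_sup1_ge0 b (d n)) (psi_sup2_ge0 b (d n)) M_gt0 de0 ld1 Dr0 DrN
  (psi_sup_sqr_le b d0) g1 g01 g2 ldM.
by rewrite lerBlDr addrC -lerBlDr; exact: h.
Unshelve. all: by end_near. Qed.
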